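(* Let $K$ be the finite convolution operator $(Ku)(x)=\int_{-1}^{1}k(x-y)u(y)\,dy$, and for $j=1,2$ let $L_ju=(b_ju')'+c_ju$ with $b_j(\pm1)=0$ be second order differential operators with complex coefficients, where $b_1,b_2,c_1,c_2,k$ are smooth complex-valued functions on $[-2,2]$. Assume that $k$ is nontrivial, that $K$ is self-adjoint, i.e. $k(-z)=\overline{k(z)}$ for $z\in[-2,2]$, and that $k$ is analytic at $0$ but not identically zero near $0$. If $K,L_1,L_2$ satisfy the sesquicommutation relation $\overline{K}L_1=L_2K$, $L_j^T=L_j$ ($j=1,2$), then either $L_1=L_2$ or $L_1=-L_2$.
   Context: $K$ acts on functions on $[-1,1]$; $\overline K$ is the convolution operator with kernel $\overline{k}$, i.e. $(\overline Ku)(x)=\int_{-1}^1\overline{k(x-y)}u(y)\,dy$. The operators $L_j$ act on smooth functions on $[-1,1]$, and $\overline K L_1=L_2K$ means $\overline KL_1u=L_2Ku$ for all smooth $u$ on $[-1,1]$. $L^T$ denotes the transpose with respect to the bilinear form $\int_{-1}^1uv\,dy$; operators of the form $Lu=(bu')'+cu$ with $b(\pm1)=0$ satisfy $L^T=L$. ''Second order'' means that $b_j$ is not identically zero. A kernel $k$ is called trivial if it is a finite linear combination of exponentials $e^{\alpha z}$ ($\alpha\in\mathbb{C}$), or has the form $e^{\alpha z}p(z)$ with $\alpha\in\mathbb C$ and $p$ a polynomial; otherwise it is nontrivial.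
   Formalization: ''Nontrivial'' is taken to mean that k coincides with a trivial kernel on no neighbourhood of 0, rather than merely not on all of [-2,2]; with the latter the claim fails, e.g. for k=1 on [-3/2,3/2], k(2)≠1, c_j=0 and b_j supported in [-1/2,1/2]. *)

(* Defs.v *)
(* Stdlib reals with Coquelicot. *)
From Stdlib Require Import Reals.
From Coquelicot Require Import Coquelicot.

Open Scope R_scope.

(* Functions on [a,b] are total functions R -> C of which only the values on
   [a,b] are ever used; derivatives are relative to [a,b], hence one-sided at
   a and b. *)
Definition is_derive_on (a b : R) (f : R -> C) (x : R) (l : C) : Prop :=
  @filterdiff R_AbsRing R_NormedModule C_R_NormedModule f
    (within (fun y => a <= y <= b) (locally x))
    (fun h => @scal R_AbsRing C_R_NormedModule h l).

Definition Derive_on (a b : R) (f : R -> C) (x : R) : C :=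
  @iota C_R_CompleteNormedModule (is_derive_on a b f x).

(* [d n] is the n-th derivative of f on [a,b]. *)
Definition smooth_on (a b : R) (f : R -> C) : Prop :=
  exists d : nat -> R -> C,
    (forall x, a <= x <= b -> d O x = f x) /\
    (forall n x, a <= x <= b -> is_derive_on a b (d n) x (d (S n) x)).

Definition CInt (f : R -> C) : C :=
  @RInt C_R_CompleteNormedModule f (-1) 1.

Definition Cexp (w : C) : C :=
  (exp (Re w) * cos (Im w), exp (Re w) * sin (Im w)).

Definition exp_sum_on (D : R -> Prop) (k : R -> C) : Prop :=
  exists (N : nat) (a alpha : nat -> C), forall z : R, D z ->
    k z = @sum_n C_AbelianMonoid
            (fun i => Cmult (a i) (Cexp (Cmult (alpha i) (RtoC z)))) N.

Definition exp_poly_on (D : R -> Prop) (k : R -> C) : Prop :=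
  exists (alpha : C) (N : nat) (p : nat -> C), forall z : R, D z ->
    k z = Cmult (Cexp (Cmult alpha (RtoC z)))
            (@sum_n C_AbelianMonoid
              (fun i => Cmult (p i) (Cpow (RtoC z) i)) N).

Definition trivial_on (D : R -> Prop) (k : R -> C) : Prop :=
  exp_sum_on D k \/ exp_poly_on D k.

(* Nontriviality is a property of the germ of k at 0: k coincides with a trivial
   kernel on no neighbourhood of 0.  For a kernel that is analytic on the whole
   of [-2,2] this is the same as not being trivial on [-2,2]; for one that is
   analytic only at 0 it is stronger.  The weaker condition would not do: let k
   be real, even and smooth, equal to 1 on [-3/2,3/2] but not on [-2,2], and let
   b_1, b_2 be supported in [-1/2,1/2], c_1 = c_2 = 0.  Then both sides of the
   sesquicommutation relation vanish, whatever b_1 and b_2 are. *)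
Definition nontrivial_kernel (k : R -> C) : Prop :=
  forall r : R, 0 < r -> ~ trivial_on (fun z => Rabs z < r) k.

Definition analytic_at_0 (k : R -> C) : Prop :=
  exists (a : nat -> C) (r : R), 0 < r /\
    forall z : R, Rabs z < r ->
      @is_pseries R_AbsRing C_R_NormedModule a z (k z).

Definition not_zero_near_0 (k : R -> C) : Prop :=
  forall r : R, 0 < r -> exists z : R, Rabs z < r /\ k z <> RtoC 0.

(* K; the operator with a bar on it is [convop (fun z => Cconj (k z))]. *)
Definition convop (k : R -> C) (u : R -> C) (x : R) : C :=
  CInt (fun y => Cmult (k (x - y)) (u y)).

(* L u = (b u')' + c u on [-1,1]. *)
Definition diffop (b c : R -> C) (u : R -> C) (x : R) : C :=
  Cplus (Derive_on (-1) 1 (fun t => Cmult (b t) (Derive_on (-1) 1 u t)) x)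
        (Cmult (c x) (u x)).

(* L^T = M for the bilinear (not sesquilinear) form int_{-1}^1 u v. *)
Definition is_transpose (L M : (R -> C) -> R -> C) : Prop :=
  forall u v : R -> C, smooth_on (-1) 1 u -> smooth_on (-1) 1 v ->
    CInt (fun y => Cmult (L u y) (v y)) = CInt (fun y => Cmult (u y) (M v y)).

Definition op_eq (L M : (R -> C) -> R -> C) : Prop :=
  forall u : R -> C, smooth_on (-1) 1 u ->
    forall x : R, -1 <= x <= 1 -> L u x = M u x.

Definition op_opp (L : (R -> C) -> R -> C) : (R -> C) -> R -> C :=
  fun u x => Copp (L u x).

Definition op_comp (L M : (R -> C) -> R -> C) : (R -> C) -> R -> C :=
  fun u => L (M u).

Definition second_order (b : R -> C) : Prop :=
  exists x : R, -1 <= x <= 1 /\ b x <> RtoC 0.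

(* Main.v *)
Require Import Defs.
From Stdlib Require Import Reals ZArith Lra Lia List Classical.
From Coquelicot Require Import Coquelicot.
From Corelib Require Import ssreflect.

Open Scope R_scope.

(** It is always the first alternative that holds: L_1 = L_2.

    Since L_1 is symmetric it can be moved onto the kernel, and testing against
    the conjugate of the resulting defect turns the operator identity into a
    pointwise one ([kernel_relation]).  Self-adjointness replaces the conjugate
    of k(x-y) by k(y-x), so the pointwise identity can be combined with the one
    obtained by exchanging x and y.  With
      H(x,z) = b(x) k''(z) + b'(x) k'(z) + c(x) k(z)
    this gives H(x,x-y) + e H(y,y-x) = 0 on the square, with e = 1 for
    (b,c) = (b_1-b_2, c_1-c_2) and e = -1 for (b,c) = (b_1+b_2, c_1+c_2).

    For x = s+z/2, y = s-z/2 the function z |-> H(s+z/2,z) is thus odd when e = 1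
    and even when e = -1, so its derivatives of even, respectively odd, order
    vanish at z = 0.  These conditions ([order_condition]) are linear differential
    equations in s for b and c with constant coefficients, made of the Taylor
    coefficients of k.

    Difference, k(0) <> 0 ([even_relation_nonvanishing_kernel]).  Order 0
    expresses c through b, and order 2 is an equation of second order for b.  If
    its leading coefficient is zero, then k agrees to second order with a multiple
    of an exponential; the first Taylor coefficient in which they differ forces b = 0,
    and if there is none then k is an exponential by analyticity.  Otherwise,
    after multiplying k and b by exponentials, b'' = kap b with b(-1) = b(1) = 0,
    so b is a combination of e^{rho s} and e^{-rho s} with rho = i pi n/2, n <> 0
    ([dirichlet_eigen]).  Comparing coefficients of these exponentials yields
    equations of second order for e^{rho z/2} k(z) + e^{-rho z/2} k(-z) and for
    its counterpart with -rho ([twist_ode]).  Hence both are multiples of hyperbolic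
    cosines, and k is a combination of exponentials divided by sinh(rho z).  The
    denominator vanishes at z = 2/n, which lies in [-2,2] where k is finite, so
    the numerator vanishes there too.  That ties the frequencies together so
    that the division is exact and k is a sum of exponentials
    ([even_two_frequencies]), which is excluded.

    Difference, k(0) = 0.  The first nonzero Taylor coefficient of k forces b = 0
    ([even_relation_leading_term]), and then either c = 0 or c is a multiple of
    an exponential and e^{mz} k(z) is odd for some m
    ([even_relation_zero_order]).  In the latter case the relation with e = -1
    is used, whose b is nonzero: the orders 1, 3 and 5 for the odd kernel
    O = e^{mz} k give either b'' = kap b or O'' = a O.  In the first case the
    pole at 2/n is cancelled as before ([odd_two_frequencies]), in the second O
    is a hyperbolic sine or linear.  So k is trivial ([odd_relation_trivial]),
    a contradiction. *)

(** * One-sided derivatives on an interval *)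

Lemma norm_C_R (x : C) : @norm R_AbsRing C_R_NormedModule x = Cmod x.
Proof. symmetry; exact (Cmod_norm x). Qed.

(** The usual first-order expansion with Cmod.  The filter form quantifies over
    all limit points of the filter; here there is only one. *)
Lemma is_derive_onP (a b : R) (f : R -> C) (x : R) (l : C) : a <= x <= b ->
  is_derive_on a b f x l <->
  (forall eps, 0 < eps -> exists delta, 0 < delta /\
     forall y, a <= y <= b -> Rabs (y - x) < delta ->
       Cmod (f y - f x - RtoC (y - x) * l)%C <= eps * Rabs (y - x)).
Proof.
  intros Hx.
  assert (Heq : forall y, (f y - f x - RtoC (y - x) * l)%C
    = minus (minus (f y) (f x)) (@scal R_AbsRing C_R_NormedModule (minus y x) l)).
  { intros y. rewrite scal_R_Cmult. reflexivity. }
  split.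
  - intros [_ H] eps Heps.
    assert (Hlim : is_filter_lim (within (fun y => a <= y <= b) (locally x)) x).
    { intros P HP. unfold within.
      apply: filter_imp HP => y Hy _. exact Hy. }
    destruct (H x Hlim (mkposreal eps Heps)) as [d Hd].
    exists d; split; [apply cond_pos|].
    intros y Hy Hyx. rewrite Heq -norm_C_R. exact (Hd y Hyx Hy).
  - intros H; split.
    { apply: is_linear_scal_l. }
    intros x' Hx' eps.
    assert (x' = x).
    { apply: eq_close. intros e.
      specialize (Hx' (ball x' e) (locally_ball x' e)).
      exact (locally_singleton _ _ Hx' Hx). }
    subst x'.
    destruct (H eps (cond_pos eps)) as [d [Hd0 Hd]].
    exists (mkposreal d Hd0). intros y Hyx Hy.
    specialize (Hd y Hy Hyx). rewrite Heq -norm_C_R in Hd. exact Hd.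
Qed.

Lemma is_derive_on_ext (a b : R) (f g : R -> C) (x : R) (l : C) : a <= x <= b ->
  (forall y, a <= y <= b -> f y = g y) -> is_derive_on a b f x l -> is_derive_on a b g x l.
Proof.
  intros Hx E H. apply is_derive_onP; auto. intros e He.
  destruct (proj1 (is_derive_onP a b f x l Hx) H e He) as [d [Hd K]].
  exists d; split; auto. intros y Hy Hyx.
  rewrite <- (E y Hy), <- (E x Hx). auto.
Qed.

Lemma is_derive_on_sub (a b a' b' : R) (f : R -> C) (x : R) (l : C) :
  a <= a' -> b' <= b -> a' <= x <= b' ->
  is_derive_on a b f x l -> is_derive_on a' b' f x l.
Proof.
  intros Ha Hb Hx H. apply is_derive_onP; auto. intros e He.
  destruct (proj1 (is_derive_onP a b f x l ltac:(lra)) H e He) as [d [Hd K]].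
  exists d; split; auto. intros y Hy Hyx. apply K; auto; lra.
Qed.

(** A nondegenerate interval contains points arbitrarily close to x and different
    from it, on at least one side. *)
Lemma is_derive_on_unique (a b : R) (f : R -> C) (x : R) (l l' : C) :
  a < b -> a <= x <= b -> is_derive_on a b f x l -> is_derive_on a b f x l' -> l = l'.
Proof.
  intros Hab Hx H H'.
  destruct (Ceq_dec l l') as [|Hne]; auto. exfalso.
  assert (Hp : 0 < Cmod (l - l')%C).
  { apply Cmod_gt_0. intros E. apply Hne. apply Ceq_minus. exact E. }
  set (e := Cmod (l - l')%C / 4). assert (He : 0 < e) by (unfold e; lra).
  destruct (proj1 (is_derive_onP a b f x l Hx) H e He) as [d [Hd K]].
  destruct (proj1 (is_derive_onP a b f x l' Hx) H' e He) as [d' [Hd' K']].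
  assert (exists y, a <= y <= b /\ y <> x /\ Rabs (y - x) < d /\ Rabs (y - x) < d') as [y [Hy [Hyx [H1 H2]]]].
  { set (m := Rmin (Rmin d d') (b - a) / 4).
    assert (Hm : 0 < m /\ m < d /\ m < d' /\ m < (b - a) / 2).
    { unfold m. unfold Rmin. repeat destruct Rle_dec; lra. }
    destruct (Rle_dec x ((a + b) / 2)).
    - exists (x + m). repeat split; try lra; replace (x + m - x) with m by ring;
      rewrite Rabs_pos_eq; lra.
    - exists (x - m). repeat split; try lra; replace (x - m - x) with (- m) by ring;
      rewrite Rabs_Ropp Rabs_pos_eq; lra. }
  specialize (K y Hy H1). specialize (K' y Hy H2).
  assert (Hr : 0 < Rabs (y - x)) by (apply Rabs_pos_lt; lra).
  assert (E : (RtoC (y - x) * (l - l') =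
     (f y - f x - RtoC (y - x) * l') - (f y - f x - RtoC (y - x) * l))%C) by ring.
  assert (Rabs (y - x) * Cmod (l - l')%C <= 2 * e * Rabs (y - x)).
  { rewrite <- (Cmod_R (y - x)) at 1. rewrite <- Cmod_mult, E.
    eapply Rle_trans; [apply Cmod_triangle|]. rewrite Cmod_opp. lra. }
  unfold e in *. nra.
Qed.

Lemma is_derive_on_bound (a b : R) (f : R -> C) (x : R) (l : C) : a <= x <= b ->
  is_derive_on a b f x l -> exists d, 0 < d /\ forall y, a <= y <= b -> Rabs (y - x) < d ->
    Cmod (f y - f x)%C <= (Cmod l + 1) * Rabs (y - x).
Proof.
  intros Hx H. destruct (proj1 (is_derive_onP a b f x l Hx) H 1 Rlt_0_1) as [d [Hd K]].
  exists d; split; auto. intros y Hy Hyx. specialize (K y Hy Hyx).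
  replace (f y - f x)%C with ((f y - f x - RtoC (y - x) * l) + RtoC (y - x) * l)%C by ring.
  eapply Rle_trans; [apply Cmod_triangle|]. rewrite Cmod_mult Cmod_R. lra.
Qed.

Lemma is_derive_on_plus (a b : R) (f g : R -> C) (x : R) (l m : C) : a <= x <= b ->
  is_derive_on a b f x l -> is_derive_on a b g x m ->
  is_derive_on a b (fun y => f y + g y)%C x (l + m)%C.
Proof.
  intros Hx H H'. apply is_derive_onP; auto. intros e He.
  destruct (proj1 (is_derive_onP a b f x l Hx) H (e/2) ltac:(lra)) as [d [Hd K]].
  destruct (proj1 (is_derive_onP a b g x m Hx) H' (e/2) ltac:(lra)) as [d' [Hd' K']].
  exists (Rmin d d'); split; [apply Rmin_pos; auto|]. intros y Hy Hyx.
  apply Rmin_Rgt_l in Hyx as [H1 H2].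
  specialize (K y Hy H1). specialize (K' y Hy H2).
  match goal with |- Cmod ?u <= _ => replace u with
   ((f y - f x - RtoC (y - x) * l) + (g y - g x - RtoC (y - x) * m))%C by ring end.
  eapply Rle_trans; [apply Cmod_triangle|]. lra.
Qed.

Lemma is_derive_on_const (a b : R) (c : C) (x : R) : a <= x <= b ->
  is_derive_on a b (fun _ => c) x (RtoC 0).
Proof.
  intros Hx. apply is_derive_onP; auto. intros e He. exists 1; split; [lra|].
  intros y _ _. replace (c - c - RtoC (y - x) * RtoC 0)%C with (RtoC 0) by ring.
  rewrite Cmod_0. apply Rmult_le_pos; [lra|apply Rabs_pos].
Qed.

Lemma is_derive_on_mult (a b : R) (f g : R -> C) (x : R) (l m : C) : a <= x <= b ->
  is_derive_on a b f x l -> is_derive_on a b g x m ->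
  is_derive_on a b (fun y => f y * g y)%C x (l * g x + f x * m)%C.
Proof.
  intros Hx H H'. apply is_derive_onP; auto. intros e He.
  destruct (is_derive_on_bound _ _ _ _ _ Hx H') as [d0 [Hd0 K0]].
  pose proof (Cmod_ge_0 (f x)) as Pf. pose proof (Cmod_ge_0 (g x)) as Pg.
  pose proof (Cmod_ge_0 l) as Pl. pose proof (Cmod_ge_0 m) as Pm.
  set (e1 := e / (3 * (Cmod (g x) + Cmod m + 1))).
  set (e2 := e / (3 * (Cmod (f x) + 1))).
  set (e3 := e / (3 * (Cmod l + 1) * (Cmod m + 1))).
  assert (He1 : 0 < e1) by (apply Rdiv_lt_0_compat; lra).
  assert (He2 : 0 < e2) by (apply Rdiv_lt_0_compat; lra).
  assert (He3 : 0 < e3).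
  { apply Rdiv_lt_0_compat; auto. apply Rmult_lt_0_compat; lra. }
  assert (E1 : e1 * (Cmod (g x) + Cmod m + 1) = e / 3) by (unfold e1; field; lra).
  assert (E2 : e2 * (Cmod (f x) + 1) = e / 3) by (unfold e2; field; lra).
  assert (E3 : Cmod l * ((Cmod m + 1) * e3) <= e / 3).
  { replace (e / 3) with ((Cmod l + 1) * ((Cmod m + 1) * e3)) by (unfold e3; field; lra).
    apply Rmult_le_compat_r; [|lra]. apply Rmult_le_pos; lra. }
  destruct (proj1 (is_derive_onP a b f x l Hx) H e1 He1) as [d [Hd K]].
  destruct (proj1 (is_derive_onP a b g x m Hx) H' e2 He2) as [d' [Hd' K']].
  exists (Rmin (Rmin d d') (Rmin (Rmin d0 1) e3)); split.
  { repeat apply Rmin_pos; auto; lra. }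
  intros y Hy Hyx.
  apply Rmin_Rgt_l in Hyx as [Q1 Q2]. apply Rmin_Rgt_l in Q1 as [H1 H1'].
  apply Rmin_Rgt_l in Q2 as [Q3 H3]. apply Rmin_Rgt_l in Q3 as [H2 H2'].
  specialize (K y Hy H1). specialize (K' y Hy H1'). specialize (K0 y Hy H2).
  match goal with |- Cmod ?u <= _ => replace u with
   ((f y - f x - RtoC (y - x) * l) * g y + f x * (g y - g x - RtoC (y - x) * m)
     + RtoC (y - x) * l * (g y - g x))%C by ring end.
  set (r := Rabs (y - x)) in *.
  assert (Hr : 0 <= r) by apply Rabs_pos.
  assert (Hg : Cmod (g y) <= Cmod (g x) + Cmod m + 1).
  { replace (g y) with (g x + (g y - g x))%C by ring.
    eapply Rle_trans; [apply Cmod_triangle|]. nra. }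
  eapply Rle_trans; [apply Cmod_triangle|].
  eapply Rle_trans; [apply Rplus_le_compat_r, Cmod_triangle|].
  rewrite !Cmod_mult Cmod_R. fold r.
  assert (T1 : Cmod (f y - f x - RtoC (y - x) * l)%C * Cmod (g y) <= e / 3 * r).
  { rewrite <- E1. replace (e1 * (Cmod (g x) + Cmod m + 1) * r) with ((e1 * r) * (Cmod (g x) + Cmod m + 1)) by ring.
    apply Rmult_le_compat; auto using Cmod_ge_0. }
  assert (T2 : Cmod (f x) * Cmod (g y - g x - RtoC (y - x) * m)%C <= e / 3 * r).
  { rewrite <- E2. replace (e2 * (Cmod (f x) + 1) * r) with ((Cmod (f x) + 1) * (e2 * r)) by ring.
    apply Rmult_le_compat; auto using Cmod_ge_0. lra. }
  assert (T3 : r * Cmod l * Cmod (g y - g x)%C <= e / 3 * r).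
  { apply Rle_trans with (r * (Cmod l * ((Cmod m + 1) * e3))).
    - rewrite Rmult_assoc. apply Rmult_le_compat_l; auto. apply Rmult_le_compat_l; auto.
      eapply Rle_trans; [exact K0|]. apply Rmult_le_compat_l; lra.
    - rewrite (Rmult_comm (e/3)). apply Rmult_le_compat_l; auto. }
  lra.
Qed.

Lemma is_derive_on_conj (a b : R) (f : R -> C) (x : R) (l : C) : a <= x <= b ->
  is_derive_on a b f x l -> is_derive_on a b (fun y => Cconj (f y)) x (Cconj l).
Proof.
  intros Hx H. apply is_derive_onP; auto. intros e He.
  destruct (proj1 (is_derive_onP a b f x l Hx) H e He) as [d [Hd K]].
  exists d; split; auto. intros y Hy Hyx. specialize (K y Hy Hyx).
  rewrite <- Cmod_conj in K.
  match goal with |- Cmod ?u <= _ => replace u with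
    (Cconj (f y - f x - RtoC (y - x) * l)%C); auto end.
  unfold Cconj, Cminus, Cplus, Copp, Cmult, RtoC; simpl. f_equal; ring.
Qed.

Lemma is_derive_on_affine (a b a' b' p q : R) (f : R -> C) (x : R) (l : C) :
  (forall y, a' <= y <= b' -> a <= p + q * y <= b) -> a' <= x <= b' ->
  is_derive_on a b f (p + q * x) l ->
  is_derive_on a' b' (fun y => f (p + q * y)) x (RtoC q * l)%C.
Proof.
  intros Hm Hx H. apply is_derive_onP; auto. intros e He.
  assert (Hq : 0 < Rabs q + 1) by (pose proof (Rabs_pos q); lra).
  destruct (proj1 (is_derive_onP a b f _ l (Hm x Hx)) H (e / (Rabs q + 1))) as [d [Hd K]].
  { apply Rdiv_lt_0_compat; lra. }
  exists (d / (Rabs q + 1)). split; [apply Rdiv_lt_0_compat; lra|].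
  intros y Hy Hyx. specialize (K (p + q * y) (Hm y Hy)).
  replace (p + q * y - (p + q * x)) with (q * (y - x)) in K by ring.
  rewrite Rabs_mult in K.
  pose proof (Rabs_pos (y - x)). pose proof (Rabs_pos q).
  assert (H1q : Rabs (y - x) * (Rabs q + 1) < d).
  { apply (Rmult_lt_compat_r _ _ _ Hq) in Hyx. replace (d / (Rabs q + 1) * (Rabs q + 1)) with d in Hyx by (field; lra). auto. }
  specialize (K ltac:(nra)).
  rewrite RtoC_mult in K. 
  match goal with |- Cmod ?u <= _ => replace u with
    (f (p + (q * y)%R)%R - f (p + (q * x)%R)%R - RtoC q * RtoC (y - x) * l)%C by ring end.
  eapply Rle_trans; [exact K|].
  assert (e / (Rabs q + 1) * Rabs q <= e).
  { apply Rle_trans with (e / (Rabs q + 1) * (Rabs q + 1)).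
    - apply Rmult_le_compat_l; [|lra]. apply Rlt_le, Rdiv_lt_0_compat; lra.
    - right; field; lra. }
  nra.
Qed.


Lemma Cmod_le_components (w : C) : Cmod w <= Rabs (fst w) + Rabs (snd w).
Proof.
  replace w with (RtoC (fst w) + Ci * RtoC (snd w))%C at 1
    by (destruct w; unfold Ci, RtoC, Cplus, Cmult; simpl; f_equal; ring).
  eapply Rle_trans; [apply Cmod_triangle|].
  rewrite Cmod_mult Cmod_Ci !Cmod_R. lra.
Qed.

Lemma is_derive_on_of_components (a b : R) (f : R -> C) (x : R) (l : C) : a <= x <= b ->
  is_derive (fun y => fst (f y)) x (fst l) -> is_derive (fun y => snd (f y)) x (snd l) ->
  is_derive_on a b f x l.
Proof.
  intros Hx H1 H2. apply is_derive_onP; auto. intros e He.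
  apply is_derive_Reals in H1. apply is_derive_Reals in H2.
  destruct (H1 (e/2) ltac:(lra)) as [d1 K1]. destruct (H2 (e/2) ltac:(lra)) as [d2 K2].
  exists (Rmin d1 d2). split; [apply Rmin_pos; apply cond_pos|].
  intros y Hy Hyx. apply Rmin_Rgt_l in Hyx as [Q1 Q2].
  destruct (Req_dec y x) as [->|Hne].
  { replace (f x - f x - RtoC (x - x) * l)%C with (RtoC 0).
    - rewrite Cmod_0. apply Rmult_le_pos; [lra|apply Rabs_pos].
    - replace (x - x) with 0 by ring. ring. }
  assert (Hr : 0 < Rabs (y - x)) by (apply Rabs_pos_lt; lra).
  assert (Key : forall u v w : R, Rabs ((u - v) / (y - x) - w) < e / 2 ->
     Rabs (u - v - (y - x) * w) <= e / 2 * Rabs (y - x)).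
  { intros u v w H. replace (u - v - (y - x) * w) with (((u - v) / (y - x) - w) * (y - x)) by (field; lra).
    rewrite Rabs_mult. apply Rmult_le_compat_r; lra. }
  specialize (K1 (y - x) ltac:(lra) Q1). specialize (K2 (y - x) ltac:(lra) Q2).
  replace (x + (y - x)) with y in K1 by ring. replace (x + (y - x)) with y in K2 by ring.
  apply Key in K1. apply Key in K2.
  eapply Rle_trans; [apply Cmod_le_components|].
  unfold Cminus, Cplus, Copp, Cmult, RtoC; simpl.
  replace (fst (f y) + - fst (f x) + - ((y - x) * fst l - 0 * snd l))
    with (fst (f y) - fst (f x) - (y - x) * fst l) by ring.
  replace (snd (f y) + - snd (f x) + - ((y - x) * snd l + 0 * fst l))
    with (snd (f y) - snd (f x) - (y - x) * snd l) by ring.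
  lra.
Qed.

Lemma is_derive_on_components (a b : R) (f : R -> C) (x : R) (l : C) : a < x < b ->
  is_derive_on a b f x l ->
  is_derive (fun y => fst (f y)) x (fst l) /\ is_derive (fun y => snd (f y)) x (snd l).
Proof.
  intros Hx H.
  assert (G : forall p : C -> R, (forall u v w (r : R), p (u - v - RtoC r * w)%C = p u - p v - r * p w) ->
     (forall u, Rabs (p u) <= Cmod u) -> is_derive (fun y => p (f y)) x (p l)).
  { intros p Hp Hb. apply is_derive_Reals. intros e He.
    destruct (proj1 (is_derive_onP a b f x l ltac:(lra)) H (e/2) ltac:(lra)) as [d [Hd K]].
    assert (Hd' : 0 < Rmin d (Rmin (x - a) (b - x))) by (repeat apply Rmin_pos; lra).
    exists (mkposreal _ Hd'). intros h Hh Hl. simpl in Hl.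
    apply Rmin_Rgt_l in Hl as [Q1 Q2]. apply Rmin_Rgt_l in Q2 as [Q2 Q3].
    apply Rabs_def2 in Q2. apply Rabs_def2 in Q3.
    specialize (K (x + h) ltac:(lra)). replace (x + h - x) with h in K by ring.
    specialize (K Q1). 
    assert (Hr : 0 < Rabs h) by (apply Rabs_pos_lt; lra).
    replace ((p (f (x + h)) - p (f x)) / h - p l)
      with (p (f (x + h)%R - f x - RtoC h * l)%C / h) by (rewrite Hp; field; auto).
    unfold Rdiv at 1. rewrite Rabs_mult Rabs_inv.
    apply (Rmult_lt_reg_r (Rabs h)); auto.
    replace (Rabs (p (f (x + h)%R - f x - RtoC h * l)%C) * / Rabs h * Rabs h)
      with (Rabs (p (f (x + h)%R - f x - RtoC h * l)%C)) by (field; lra).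
    eapply Rle_lt_trans; [apply Hb|]. eapply Rle_lt_trans; [exact K|]. nra. }
  split.
  - apply (G fst).
    + intros; unfold Cminus, Cplus, Copp, Cmult, RtoC; simpl; ring.
    + intros u. eapply Rle_trans; [apply Rmax_l|apply Rmax_Cmod].
  - apply (G snd).
    + intros; unfold Cminus, Cplus, Copp, Cmult, RtoC; simpl; ring.
    + intros u. eapply Rle_trans; [apply Rmax_r|apply Rmax_Cmod].
Qed.

(** Composition with the retraction of R onto [a,b] turns continuity on [a,b] into
    continuity on R, the form in which compactness, the mean value theorem and the
    integrability of continuous functions are available. *)
Definition clamp (a b y : R) : R := Rmax a (Rmin b y).

Lemma clamp_in a b y : a <= b -> a <= clamp a b y <= b.
Proof. intros H. unfold clamp, Rmax, Rmin. repeat destruct Rle_dec; lra. Qed.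

Lemma clamp_id a b y : a <= y <= b -> clamp a b y = y.
Proof. intros H. unfold clamp, Rmax, Rmin. repeat destruct Rle_dec; lra. Qed.

Lemma clamp_lip a b x y : a <= b -> Rabs (clamp a b x - clamp a b y) <= Rabs (x - y).
Proof. intros H. unfold clamp, Rmax, Rmin. repeat destruct Rle_dec;
  unfold Rabs; repeat destruct Rcase_abs; lra. Qed.

Definition cont_on (a b : R) (f : R -> C) : Prop :=
  forall x, a <= x <= b -> forall eps, 0 < eps -> exists delta, 0 < delta /\
    forall y, a <= y <= b -> Rabs (y - x) < delta -> Cmod (f y - f x)%C < eps.

Lemma cont_on_of_derive a b f f' :
  (forall x, a <= x <= b -> is_derive_on a b f x (f' x)) -> cont_on a b f.
Proof.
  intros H x Hx e He. destruct (is_derive_on_bound _ _ _ _ _ Hx (H x Hx)) as [d [Hd K]].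
  pose proof (Cmod_ge_0 (f' x)) as P.
  exists (Rmin d (e / (Cmod (f' x) + 1))). split.
  { apply Rmin_pos; auto. apply Rdiv_lt_0_compat; lra. }
  intros y Hy Hyx. apply Rmin_Rgt_l in Hyx as [Q1 Q2].
  eapply Rle_lt_trans; [apply K; auto|].
  apply (Rmult_lt_compat_l (Cmod (f' x) + 1)) in Q2; [|lra].
  replace ((Cmod (f' x) + 1) * (e / (Cmod (f' x) + 1))) with e in Q2 by (field; lra). auto.
Qed.

Lemma cont_on_clamp a b f : a <= b -> cont_on a b f ->
  forall x, @continuous R_UniformSpace C_R_NormedModule (fun y => f (clamp a b y)) x.
Proof.
  intros Hab H x. apply filterlim_locally_ball_norm. intros e.
  destruct (H (clamp a b x) (clamp_in _ _ _ Hab) e (cond_pos e)) as [d [Hd K]].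
  exists (mkposreal d Hd). intros y Hy. unfold ball_norm. rewrite norm_C_R.
  apply K; [apply clamp_in; auto|].
  eapply Rle_lt_trans; [apply clamp_lip; auto|]. exact Hy.
Qed.

Lemma cont_on_clamp_real a b f (p : C -> R) : a <= b -> cont_on a b f ->
  (forall u v, Rabs (p u - p v) <= Cmod (u - v)%C) ->
  continuity (fun y => p (f (clamp a b y))).
Proof.
  intros Hab H Hp x e He.
  destruct (H (clamp a b x) (clamp_in _ _ _ Hab) e He) as [d [Hd K]].
  exists d; split; auto. intros y [_ Hy]. simpl in *. unfold R_dist in *.
  eapply Rle_lt_trans; [apply Hp|]. apply K; [apply clamp_in; auto|].
  eapply Rle_lt_trans; [apply clamp_lip; auto|]. exact Hy.
Qed.

Lemma fst_le_Cmod u : Rabs (fst u) <= Cmod u.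
Proof. eapply Rle_trans; [apply Rmax_l|apply Rmax_Cmod]. Qed.
Lemma snd_le_Cmod u : Rabs (snd u) <= Cmod u.
Proof. eapply Rle_trans; [apply Rmax_r|apply Rmax_Cmod]. Qed.

Lemma Cmod_minus_le u v : Rabs (Cmod u - Cmod v) <= Cmod (u - v)%C.
Proof.
  apply Rabs_le. split.
  - pose proof (Cmod_triangle (v - u) u) as H. replace (v - u + u)%C with v in H by ring.
    replace (v - u)%C with (- (u - v))%C in H by ring. rewrite Cmod_opp in H. lra.
  - pose proof (Cmod_triangle (u - v) v) as H. replace (u - v + v)%C with u in H by ring. lra.
Qed.

Lemma cont_on_bounded a b f : a <= b -> cont_on a b f ->
  exists M, forall x, a <= x <= b -> Cmod (f x) <= M.
Proof.
  intros Hab H.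
  destruct (continuity_ab_maj (fun y => Cmod (f (clamp a b y))) a b Hab) as [m [Hm _]].
  { intros c _. apply (cont_on_clamp_real a b f Cmod); auto using Cmod_minus_le. }
  exists (Cmod (f (clamp a b m))). intros x Hx. specialize (Hm x Hx).
  rewrite (clamp_id a b x) in Hm; auto.
Qed.

(** The real mean value theorem for both components, hence the factor 2. *)
Lemma mean_value_le a b f f' M :
  (forall x, a <= x <= b -> is_derive_on a b f x (f' x)) ->
  (forall x, a <= x <= b -> Cmod (f' x) <= M) ->
  forall p q, a <= p <= b -> a <= q <= b -> Cmod (f p - f q)%C <= 2 * M * Rabs (p - q).
Proof.
  intros H HM.
  assert (Hp : forall p : C -> R, (p = fst \/ p = snd) -> forall x y, a <= x -> x < y -> y <= b ->
     Rabs (p (f y) - p (f x)) <= M * (y - x)).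
  { intros p Hpp x y Hx Hxy Hy.
    assert (Pd : forall t, a < t < b -> is_derive (fun t => p (f t)) t (p (f' t))).
    { intros t Ht. destruct (is_derive_on_components a b f t (f' t) Ht (H t ltac:(lra))).
      destruct Hpp; subst; auto. }
    assert (Pl : forall u, Rabs (p u) <= Cmod u).
    { destruct Hpp; subst; auto using fst_le_Cmod, snd_le_Cmod. }
    assert (Pm : forall u v, Rabs (p u - p v) <= Cmod (u - v)%C).
    { intros u v. eapply Rle_trans; [|apply Pl]. right. f_equal. destruct Hpp; subst; reflexivity. }
    destruct (MVT_gen (fun t => p (f (clamp a b t))) x y (fun t => p (f' t))) as [c [Hc E]].
    - intros t Ht. rewrite Rmin_left in Ht; try lra. rewrite Rmax_right in Ht; try lra.
      apply (is_derive_ext_loc (fun t => p (f t))).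
      + assert (Hd : 0 < Rmin (t - a) (b - t)) by (apply Rmin_pos; lra).
        exists (mkposreal _ Hd). intros s Hs. change (Rabs (s - t) < Rmin (t - a) (b - t)) in Hs.
        apply Rmin_Rgt_l in Hs as [Q1 Q2]. apply Rabs_def2 in Q1. apply Rabs_def2 in Q2.
        rewrite clamp_id; auto; lra.
      + apply Pd; lra.
    - intros t _. apply (cont_on_clamp_real a b f p); auto; try lra.
      apply cont_on_of_derive with f'; auto.
    - rewrite Rmin_left in Hc; try lra. rewrite Rmax_right in Hc; try lra.
      rewrite !clamp_id in E; try lra. rewrite E. rewrite Rabs_mult (Rabs_pos_eq (y - x)); [|lra].
      apply Rmult_le_compat_r; [lra|]. eapply Rle_trans; [apply Pl|]. apply HM; lra. }
  assert (H1 : forall x y, a <= x -> x < y -> y <= b -> Cmod (f y - f x)%C <= 2 * M * (y - x)).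
  { intros x y Hx Hxy Hy. eapply Rle_trans; [apply Cmod_le_components|].
    pose proof (Hp fst (or_introl eq_refl) x y Hx Hxy Hy).
    pose proof (Hp snd (or_intror eq_refl) x y Hx Hxy Hy).
    unfold Cminus, Cplus, Copp; simpl. unfold Rminus in *. lra. }
  intros p q Hpp Hq. destruct (Rtotal_order p q) as [Hl|[->|Hl]].
  - replace (f p - f q)%C with (- (f q - f p))%C by ring. rewrite Cmod_opp.
    rewrite Rabs_minus_sym Rabs_pos_eq; [|lra]. apply H1; lra.
  - replace (f q - f q)%C with (RtoC 0) by ring. rewrite Cmod_0.
    replace (q - q) with 0 by ring. rewrite Rabs_R0. lra.
  - rewrite Rabs_pos_eq; [|lra]. apply H1; lra.
Qed.

Lemma zero_derive_const a b f :
  (forall x, a <= x <= b -> is_derive_on a b f x (RtoC 0)) ->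
  forall p q, a <= p <= b -> a <= q <= b -> f p = f q.
Proof.
  intros H p q Hp Hq. apply Ceq_minus. apply Cmod_eq_0.
  apply Rle_antisym; [|apply Cmod_ge_0].
  pose proof (mean_value_le a b f (fun _ => RtoC 0) 0 H) as K.
  replace 0 with (2 * 0 * Rabs (p - q)) by ring. apply K; auto.
  intros. rewrite Cmod_0. lra.
Qed.

Lemma Cexp_plus u v : Cexp (u + v)%C = (Cexp u * Cexp v)%C.
Proof.
  unfold Cexp, Cplus, Cmult, Re, Im; simpl. rewrite exp_plus cos_plus sin_plus. f_equal; ring.
Qed.

Lemma Cexp_0 : Cexp (RtoC 0) = RtoC 1.
Proof. unfold Cexp, Re, Im, RtoC; simpl. rewrite exp_0 cos_0 sin_0. f_equal; ring. Qed.

Lemma is_derive_on_Cexp a b w x : a <= x <= b ->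
  is_derive_on a b (fun y => Cexp (w * RtoC y)%C) x (w * Cexp (w * RtoC x))%C.
Proof.
  intros Hx. apply is_derive_on_of_components; auto;
  destruct w as [u v]; unfold Cexp, Cmult, Re, Im, RtoC; simpl; auto_derive; auto;
  unfold Rminus; ring.
Qed.

(** * Sequences of derivatives *)

(** The number n is the order of the derivative: F is determined on [a,b] by its
    entry 0, see [jet_eq]. *)
Definition jet (a b : R) (F : nat -> R -> C) : Prop :=
  forall n x, a <= x <= b -> is_derive_on a b (F n) x (F (S n) x).

Lemma jet_sub a b a' b' F : a <= a' -> b' <= b -> jet a b F -> jet a' b' F.
Proof. intros Ha Hb H n x Hx. apply (is_derive_on_sub a b); auto. apply H; lra. Qed.

Lemma jet_cont a b F n : jet a b F -> cont_on a b (F n).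
Proof. intros H. apply cont_on_of_derive with (F (S n)). intros; apply H; auto. Qed.

Lemma jet_eq a b F G : a < b -> jet a b F -> jet a b G ->
  (forall x, a <= x <= b -> F O x = G O x) ->
  forall n x, a <= x <= b -> F n x = G n x.
Proof.
  intros Hab HF HG H n. induction n as [|n IH]; auto. intros x Hx.
  apply (is_derive_on_unique a b (F n) x); auto.
  apply (is_derive_on_ext a b (G n)); auto.
  - intros y Hy. symmetry; auto.
Qed.

Lemma cont_zero_closed a b f : a < b -> cont_on a b f ->
  (forall x, a < x < b -> f x = RtoC 0) -> forall x, a <= x <= b -> f x = RtoC 0.
Proof.
  intros Hab Hc H x Hx. destruct (Ceq_dec (f x) (RtoC 0)) as [|Hne]; auto. exfalso.
  apply Cmod_gt_0 in Hne. destruct (Hc x Hx _ Hne) as [d [Hd K]].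
  set (m := Rmin d (b - a) / 4).
  assert (Hm : 0 < m /\ m < d /\ m < (b - a) / 2).
  { unfold m. unfold Rmin. repeat destruct Rle_dec; lra. }
  assert (exists y, a < y < b /\ Rabs (y - x) < d) as [y [Hy Hyx]].
  { destruct (Rle_dec x ((a + b) / 2)).
    - exists (x + m). repeat split; try lra; replace (x + m - x) with m by ring;
      rewrite Rabs_pos_eq; lra.
    - exists (x - m). repeat split; try lra; replace (x - m - x) with (- m) by ring;
      rewrite Rabs_Ropp Rabs_pos_eq; lra. }
  specialize (K y ltac:(lra) Hyx). rewrite H in K; auto.
  replace (RtoC 0 - f x)%C with (- f x)%C in K by ring. rewrite Cmod_opp in K. lra.
Qed.

(** The n-th derivative at a point of a product, from the derivatives of the
    factors.  Unfolding the product rule instead of summing over binomial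
    coefficients makes the recursion agree definitionally with differentiation,
    and evaluates at a numeral n to an explicit polynomial. *)
Fixpoint leib (n : nat) (f g : nat -> C) : C :=
  match n with
  | O => (f O * g O)%C
  | S m => (leib m (fun i => f (S i)) g + leib m f (fun i => g (S i)))%C
  end.

Definition jmul (F G : nat -> R -> C) : nat -> R -> C :=
  fun n x => leib n (fun i => F i x) (fun i => G i x).
Definition jadd (F G : nat -> R -> C) : nat -> R -> C := fun n x => (F n x + G n x)%C.
Definition jscal (c : C) (F : nat -> R -> C) : nat -> R -> C := fun n x => (c * F n x)%C.
Definition jconj (F : nat -> R -> C) : nat -> R -> C := fun n x => Cconj (F n x).
Definition jshift (F : nat -> R -> C) : nat -> R -> C := fun n => F (S n).
Definition jaff (p q : R) (F : nat -> R -> C) : nat -> R -> C :=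
  fun n x => (RtoC q ^ n * F n (p + q * x)%R)%C.
Definition jexp (w : C) : nat -> R -> C := fun n x => (w ^ n * Cexp (w * RtoC x))%C.
Definition jconst (c : C) : nat -> R -> C := fun n _ => match n with O => c | _ => RtoC 0 end.

Lemma jet_mul a b F G : jet a b F -> jet a b G -> jet a b (jmul F G).
Proof.
  intros HF HG n. revert F G HF HG. induction n as [|n IH]; intros F G HF HG x Hx.
  - apply is_derive_on_mult; auto.
  - exact (is_derive_on_plus a b (jmul (jshift F) G n) (jmul F (jshift G) n) x _ _ Hx
      (IH (jshift F) G (fun m y Hy => HF (S m) y Hy) HG x Hx)
      (IH F (jshift G) HF (fun m y Hy => HG (S m) y Hy) x Hx)).
Qed.

Lemma jet_add a b F G : jet a b F -> jet a b G -> jet a b (jadd F G).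
Proof. intros HF HG n x Hx. apply is_derive_on_plus; auto. Qed.

Lemma jet_scal a b c F : jet a b F -> jet a b (jscal c F).
Proof.
  intros HF n x Hx.
  replace (jscal c F (S n) x) with (RtoC 0 * F n x + c * F (S n) x)%C by (unfold jscal; ring).
  apply (is_derive_on_mult a b (fun _ => c)); auto. apply is_derive_on_const; auto.
Qed.

Lemma jet_conj a b F : jet a b F -> jet a b (jconj F).
Proof. intros HF n x Hx. apply is_derive_on_conj; auto. Qed.

Lemma jet_shift a b F : jet a b F -> jet a b (jshift F).
Proof. intros HF n x Hx. apply HF; auto. Qed.

Lemma jet_aff a b a' b' p q F : (forall y, a' <= y <= b' -> a <= p + q * y <= b) ->
  jet a b F -> jet a' b' (jaff p q F).
Proof.
  intros Hm HF n x Hx.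
  replace (jaff p q F (S n) x) with
    (RtoC 0 * F n (p + q * x)%R + RtoC q ^ n * (RtoC q * F (S n) (p + q * x)%R))%C
    by (unfold jaff; simpl; ring).
  apply (is_derive_on_mult a' b' (fun _ => (RtoC q ^ n)%C) (fun y => F n (p + q * y))); auto.
  - apply is_derive_on_const; auto.
  - apply (is_derive_on_affine a b); auto.
Qed.

Lemma jet_exp a b w : jet a b (jexp w).
Proof.
  intros n x Hx.
  replace (jexp w (S n) x) with (RtoC 0 * Cexp (w * RtoC x) + w ^ n * (w * Cexp (w * RtoC x)))%C
    by (unfold jexp; simpl; ring).
  apply (is_derive_on_mult a b (fun _ => (w ^ n)%C) (fun y => Cexp (w * RtoC y)%C)); auto.
  - apply is_derive_on_const; auto.
  - apply is_derive_on_Cexp; auto.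
Qed.

Lemma jet_const a b c : jet a b (jconst c).
Proof. intros [|n] x Hx; apply is_derive_on_const; auto. Qed.

(** * Linear differential equations *)

Lemma Cexp_neg w x : (Cexp (w * RtoC x) * Cexp (- w * RtoC x) = 1)%C.
Proof. rewrite <- Cexp_plus. replace (w * RtoC x + - w * RtoC x)%C with (RtoC 0) by ring. apply Cexp_0. Qed.

(** f times e^{-wx} has zero derivative. *)
Lemma ode_first_order a b f w p : a <= p <= b ->
  (forall x, a <= x <= b -> is_derive_on a b f x (w * f x)%C) ->
  forall x, a <= x <= b -> f x = (f p * Cexp (w * RtoC (x - p)))%C.
Proof.
  intros Hp H x Hx.
  assert (E : (f x * Cexp (- w * RtoC x) = f p * Cexp (- w * RtoC p))%C).
  { apply (zero_derive_const a b (fun y => f y * Cexp (- w * RtoC y))%C); auto.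
    intros y Hy.
    replace (RtoC 0) with (w * f y * Cexp (- w * RtoC y) + f y * (- w * Cexp (- w * RtoC y)))%C by ring.
    apply is_derive_on_mult; auto. apply is_derive_on_Cexp; auto. }
  replace (w * RtoC (x - p))%C with (w * RtoC x + - w * RtoC p)%C
    by (rewrite RtoC_minus; ring).
  rewrite Cexp_plus.
  transitivity (f x * Cexp (- w * RtoC x) * Cexp (w * RtoC x))%C.
  - rewrite <- Cmult_assoc, (Cmult_comm (Cexp (- w * RtoC x))), Cexp_neg. ring.
  - rewrite E. ring.
Qed.

(** Half-angle formulas: the components have squares (|k| + Re k)/2 and
    (|k| - Re k)/2, and the sign of Im k fixes the quadrant. *)
Lemma Csqrt_exists (k : C) : exists s : C, (s * s = k)%C.
Proof.
  destruct k as [x y].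
  pose proof (Cmod_ge_0 (x, y)) as H0.
  assert (H2 : (Cmod (x, y)) ^ 2 = x ^ 2 + y ^ 2).
  { unfold Cmod. rewrite pow2_sqrt; simpl; nra. }
  set (r := Cmod (x, y)) in *.
  assert (H1 : Rabs x <= r).
  { apply Rsqr_incr_0_var; auto. rewrite <- Rsqr_abs. unfold Rsqr. nra. }
  assert (A1 : 0 <= (r + x) / 2) by (unfold Rabs in H1; destruct Rcase_abs in H1; lra).
  assert (A2 : 0 <= (r - x) / 2) by (unfold Rabs in H1; destruct Rcase_abs in H1; lra).
  pose proof (sqrt_sqrt _ A1) as S1. pose proof (sqrt_sqrt _ A2) as S2.
  assert (S3 : sqrt ((r + x) / 2) * sqrt ((r - x) / 2) = Rabs y / 2).
  { rewrite <- sqrt_mult; auto.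
    replace ((r + x) / 2 * ((r - x) / 2)) with ((Rabs y / 2) * (Rabs y / 2)).
    - apply sqrt_square. pose proof (Rabs_pos y). lra.
    - replace (Rabs y / 2 * (Rabs y / 2)) with (Rsqr (Rabs y) / 4) by (unfold Rsqr; field).
      rewrite <- Rsqr_abs. unfold Rsqr. nra. }
  set (u := sqrt ((r + x) / 2)) in *. set (v := sqrt ((r - x) / 2)) in *.
  destruct (Rle_dec 0 y) as [Hy|Hy].
  - exists (u, v). rewrite Rabs_pos_eq in S3; auto. unfold Cmult; simpl. f_equal; lra.
  - exists (u, - v). rewrite Rabs_left in S3; [|lra]. unfold Cmult; simpl. f_equal; lra.
Qed.

(** Factoring the operator through a square root of k reduces uniqueness to the
    first-order case used twice; this also covers k = 0. *)
Lemma ode_second_order_zero a b f f' k p : a <= p <= b ->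
  (forall x, a <= x <= b -> is_derive_on a b f x (f' x)) ->
  (forall x, a <= x <= b -> is_derive_on a b f' x (k * f x)%C) ->
  f p = RtoC 0 -> f' p = RtoC 0 -> forall x, a <= x <= b -> f x = RtoC 0.
Proof.
  intros Hp H H' E E'. destruct (Csqrt_exists k) as [s <-].
  assert (D : forall w x, a <= x <= b -> is_derive_on a b (fun y => w * f y)%C x (w * f' x)%C).
  { intros w x Hx. replace (w * f' x)%C with (RtoC 0 * f x + w * f' x)%C by ring.
    apply (is_derive_on_mult a b (fun _ => w)); auto. apply is_derive_on_const; auto. }
  (* f'' = s^2 f says that f' - s f is annihilated by d/dx + s *)
  assert (Z : forall x, a <= x <= b -> (f' x + - s * f x)%C = RtoC 0).
  { intros x Hx.
    rewrite (ode_first_order a b (fun y => f' y + - s * f y)%C (- s) p Hp); auto.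
    - rewrite E E'. ring.
    - intros y Hy. replace (- s * (f' y + - s * f y))%C with (s * s * f y + - s * f' y)%C by ring.
      apply is_derive_on_plus; auto. }
  intros x Hx. rewrite (ode_first_order a b f s p Hp); auto.
  - rewrite E. ring.
  - intros y Hy. replace (s * f y)%C with (f' y) ; auto.
    apply Ceq_minus. rewrite <- (Z y Hy). ring.
Qed.

(** * From operators to kernels *)

Lemma smooth_on_jet a b f : smooth_on a b f ->
  exists F, jet a b F /\ forall x, a <= x <= b -> F O x = f x.
Proof. intros [F [H0 H]]. exists F; split; auto. Qed.

Lemma jet_smooth a b F : jet a b F -> smooth_on a b (F O).
Proof. intros H. exists F; split; auto. Qed.

Lemma Derive_on_eq a b f x l : a < b -> a <= x <= b -> is_derive_on a b f x l ->
  Derive_on a b f x = l.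
Proof.
  intros Hab Hx H. unfold Derive_on. apply (iota_unique (V := C_R_CompleteNormedModule)); auto.
  intros y Hy. apply (is_derive_on_unique a b f x); auto.
Qed.

(** The nested [Derive_on] is an iota over a function that itself involves an iota,
    so it is evaluated from the inside. *)
Lemma diffop_eval b b' c u u' u'' x : -1 <= x <= 1 ->
  (forall t, -1 <= t <= 1 -> is_derive_on (-1) 1 b t (b' t)) ->
  (forall t, -1 <= t <= 1 -> is_derive_on (-1) 1 u t (u' t)) ->
  (forall t, -1 <= t <= 1 -> is_derive_on (-1) 1 u' t (u'' t)) ->
  diffop b c u x = (b' x * u' x + b x * u'' x + c x * u x)%C.
Proof.
  intros Hx Hb Hu Hu'. unfold diffop. f_equal.
  apply Derive_on_eq; auto; try lra.
  apply (is_derive_on_ext _ _ (fun t => b t * u' t)%C); auto.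
  - intros y Hy. f_equal. symmetry. apply Derive_on_eq; auto; lra.
  - apply is_derive_on_mult; auto.
Qed.

Lemma CInt_ex f : cont_on (-1) 1 f -> @ex_RInt C_R_CompleteNormedModule f (-1) 1.
Proof.
  intros H. apply (ex_RInt_ext (fun y => f (clamp (-1) 1 y))).
  - intros y Hy. rewrite Rmin_left in Hy; try lra. rewrite Rmax_right in Hy; try lra.
    rewrite clamp_id; auto; lra.
  - apply (ex_RInt_continuous (V := C_R_CompleteNormedModule)).
    intros z _. apply (cont_on_clamp (-1) 1 f); auto; lra.
Qed.

Lemma CInt_is f : cont_on (-1) 1 f -> @is_RInt C_R_NormedModule f (-1) 1 (CInt f).
Proof. intros H. apply (RInt_correct (V := C_R_CompleteNormedModule)). apply CInt_ex; auto. Qed.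

Lemma CInt_unique f l : @is_RInt C_R_NormedModule f (-1) 1 l -> CInt f = l.
Proof. apply (is_RInt_unique (V := C_R_CompleteNormedModule)). Qed.

Lemma CInt_ext f g : (forall y, -1 <= y <= 1 -> f y = g y) -> CInt f = CInt g.
Proof.
  intros H. apply (RInt_ext (V := C_R_CompleteNormedModule)). intros y Hy.
  rewrite Rmin_left in Hy; try lra. rewrite Rmax_right in Hy; try lra. apply H; lra.
Qed.

Lemma CInt_plus f g : cont_on (-1) 1 f -> cont_on (-1) 1 g ->
  CInt (fun y => f y + g y)%C = (CInt f + CInt g)%C.
Proof.
  intros Hf Hg. apply CInt_unique.
  apply (is_RInt_plus (V := C_R_NormedModule)); apply CInt_is; auto.
Qed.

Lemma CInt_scal c f : cont_on (-1) 1 f -> CInt (fun y => c * f y)%C = (c * CInt f)%C.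
Proof.
  intros Hf. apply CInt_unique.
  pose proof (CInt_is f Hf) as H.
  pose proof (is_RInt_fct_extend_fst (U := R_NormedModule) (V := R_NormedModule) f _ _ _ H) as H1.
  pose proof (is_RInt_fct_extend_snd (U := R_NormedModule) (V := R_NormedModule) f _ _ _ H) as H2.
  apply (is_RInt_fct_extend_pair (U := R_NormedModule) (V := R_NormedModule) (fun y => c * f y)%C).
  - unfold Cmult; simpl.
    apply (is_RInt_minus (V := R_NormedModule) (fun y => fst c * fst (f y)) (fun y => snd c * snd (f y)));
    apply (is_RInt_scal (V := R_NormedModule)); auto.
  - unfold Cmult; simpl.
    apply (is_RInt_plus (V := R_NormedModule) (fun y => fst c * snd (f y)) (fun y => snd c * fst (f y)));
    apply (is_RInt_scal (V := R_NormedModule)); auto.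
Qed.

Lemma CInt_bound f M : cont_on (-1) 1 f -> (forall y, -1 <= y <= 1 -> Cmod (f y) <= M) ->
  Cmod (CInt f) <= 2 * M.
Proof.
  intros Hf HM. rewrite <- norm_C_R. replace (2 * M) with ((1 - -1) * M) by ring.
  apply (norm_RInt_le_const (V := C_R_NormedModule) f (-1) 1); try lra.
  - intros. rewrite norm_C_R. auto.
  - apply CInt_is; auto.
Qed.

(** The real part of the integrand is |G|^2, which is continuous and nonnegative, so
    a positive value at an interior point would make the integral positive. *)
Lemma CInt_conj_zero G : jet (-1) 1 G -> CInt (fun y => Cconj (G O y) * G O y)%C = RtoC 0 ->
  forall x, -1 <= x <= 1 -> G O x = RtoC 0.
Proof.
  intros HG H. apply (cont_zero_closed (-1) 1); [lra|apply jet_cont; auto|].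
  intros x Hx. destruct (Ceq_dec (G O x) (RtoC 0)) as [|Hne]; auto. exfalso.
  set (g := fun y => fst (Cconj (G O y) * G O y)%C).
  assert (Hg : forall y, g y = Cmod (G O y) ^ 2).
  { intros y. unfold g. rewrite Cmult_comm. rewrite <- Cmod2_conj. 
    reflexivity. }
  assert (Hc : cont_on (-1) 1 (fun y => Cconj (G O y) * G O y)%C).
  { apply (jet_cont _ _ (jmul (jconj G) G) O). apply jet_mul; auto. apply jet_conj; auto. }
  assert (Hcg : continuity (fun y => g (clamp (-1) 1 y))).
  { unfold g. apply (cont_on_clamp_real (-1) 1 (fun y => Cconj (G O y) * G O y)%C fst); auto; try lra.
    intros u v. eapply Rle_trans; [|apply fst_le_Cmod]. right; f_equal. }
  pose proof (CInt_is _ Hc) as HI. rewrite H in HI.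
  apply (is_RInt_fct_extend_fst (U := R_NormedModule) (V := R_NormedModule)) in HI. simpl in HI.
  set (h := fun y => g (clamp (-1) 1 y)).
  assert (HI' : is_RInt h (-1) 1 0).
  { apply (is_RInt_ext g); auto. intros y Hy. 
    rewrite Rmin_left in Hy; try lra. rewrite Rmax_right in Hy; try lra.
    unfold h. rewrite clamp_id; auto; lra. }
  assert (Hpos : 0 < h x).
  { unfold h. rewrite clamp_id; [|lra]. rewrite Hg. apply pow_lt, Cmod_gt_0; auto. }
  assert (Hnn : forall y, 0 <= h y).
  { intros y. unfold h. rewrite Hg. apply pow2_ge_0. }
  assert (Hch : forall y, continuous h y).
  { intros y. apply continuity_pt_filterlim. apply Hcg. }
  assert (Hex : forall a b, ex_RInt h a b).
  { intros a b. apply (ex_RInt_continuous (V := R_CompleteNormedModule)). auto. }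
  (* h exceeds h(x)/2 > 0 on an interval of radius m around x *)
  destruct (Hcg x (h x / 2) ltac:(lra)) as [d [Hd K]].
  set (m := Rmin d (Rmin (x + 1) (1 - x)) / 2).
  assert (Hm : 0 < m /\ m < d /\ m < x + 1 /\ m < 1 - x).
  { unfold m, Rmin. repeat destruct Rle_dec; lra. }
  assert (P : 0 < RInt h (x - m) (x + m)).
  { apply RInt_gt_0; auto; try lra. intros y Hy.
    destruct (Req_dec y x) as [->|Hn]; auto.
    specialize (K y). simpl in K. unfold R_dist in K.
    assert (Rabs (h y - h x) < h x / 2).
    { apply K. split; [split; [exact I|auto]|]. apply Rabs_def1; lra. }
    apply Rabs_def2 in H0. lra. }
  assert (E : RInt h (-1) 1 = 0) by (apply is_RInt_unique; auto).
  rewrite <- (RInt_Chasles h (-1) (x - m) 1) in E; auto.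
  rewrite <- (RInt_Chasles h (x - m) (x + m) 1) in E; auto.
  pose proof (RInt_ge_0 h (-1) (x - m) ltac:(lra) (Hex _ _) (fun y _ => Hnn y)).
  pose proof (RInt_ge_0 h (x + m) 1 ltac:(lra) (Hex _ _) (fun y _ => Hnn y)).
  unfold plus in E; simpl in E. lra.
Qed.

Lemma is_derive_on_linear a b w t : a <= t <= b ->
  is_derive_on a b (fun y => w * RtoC y)%C t w.
Proof.
  intros Ht. apply is_derive_onP; auto. intros e He. exists 1; split; [lra|]. intros y _ _.
  replace (w * RtoC y - w * RtoC t - RtoC (y - t) * w)%C with (RtoC 0) by (rewrite RtoC_minus; ring).
  rewrite Cmod_0. apply Rmult_le_pos; [lra|apply Rabs_pos].
Qed.

(** The mean value inequality is applied to K n t - t K (n+1) q, whose derivative is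
    O(|t-q|).  The quadratic bound is uniform in the base point q, as
    differentiation under the integral requires. *)
Lemma jet_taylor_bound K n : jet (-2) 2 K -> exists M, 0 <= M /\ forall p q,
  -2 <= p <= 2 -> -2 <= q <= 2 ->
  Cmod (K n p - K n q - RtoC (p - q) * K (S n) q)%C <= M * (Rabs (p - q) * Rabs (p - q)).
Proof.
  intros HK.
  destruct (cont_on_bounded (-2) 2 (K (S (S n))) ltac:(lra) (jet_cont _ _ _ _ HK)) as [M HM].
  assert (HM0 : 0 <= M).
  { eapply Rle_trans; [apply Cmod_ge_0|]. apply (HM 0); lra. }
  exists (4 * M). split; [lra|]. intros p q Hp Hq.
  (* only the segment between p and q is used, on which |t - q| <= |p - q| *)
  set (a := Rmin p q). set (b := Rmax p q).
  assert (Hab : -2 <= a /\ b <= 2 /\ a <= p <= b /\ a <= q <= b /\ forall t, a <= t <= b -> Rabs (t - q) <= Rabs (p - q)).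
  { unfold a, b, Rmin, Rmax. repeat destruct Rle_dec; repeat split; try lra;
    intros t Ht; unfold Rabs; repeat destruct Rcase_abs; lra. }
  destruct Hab as [Ha [Hb [Hp' [Hq' Hd]]]].
  pose proof (mean_value_le a b (fun t => K n t + (- K (S n) q) * RtoC t)%C
    (fun t => K (S n) t + - K (S n) q)%C (2 * M * Rabs (p - q))) as Hmv.
  replace (K n p - K n q - RtoC (p - q) * K (S n) q)%C
    with ((K n p + (- K (S n) q) * RtoC p) - (K n q + (- K (S n) q) * RtoC q))%C
    by (rewrite RtoC_minus; ring).
  replace (4 * M * (Rabs (p - q) * Rabs (p - q))) with (2 * (2 * M * Rabs (p - q)) * Rabs (p - q)) by ring.
  apply Hmv; auto.
  - intros t Ht.
    apply is_derive_on_plus; auto.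
    + apply (is_derive_on_sub (-2) 2); auto. apply HK; lra.
    + apply is_derive_on_linear; auto.
  - intros t Ht. 
    eapply Rle_trans; [apply (mean_value_le (-2) 2 (K (S n)) (K (S (S n))) M); auto; lra|].
    apply Rmult_le_compat_l; [lra|]. auto.
Qed.


Lemma cont_on_plus a b f g : cont_on a b f -> cont_on a b g -> cont_on a b (fun y => f y + g y)%C.
Proof.
  intros Hf Hg x Hx e He.
  destruct (Hf x Hx (e/2) ltac:(lra)) as [d [Hd K]]. destruct (Hg x Hx (e/2) ltac:(lra)) as [d' [Hd' K']].
  exists (Rmin d d'); split; [apply Rmin_pos; auto|]. intros y Hy Hyx.
  apply Rmin_Rgt_l in Hyx as [Q1 Q2]. specialize (K y Hy Q1). specialize (K' y Hy Q2).
  replace (f y + g y - (f x + g x))%C with ((f y - f x) + (g y - g x))%C by ring.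
  eapply Rle_lt_trans; [apply Cmod_triangle|]. lra.
Qed.

Lemma cont_on_scal a b c f : cont_on a b f -> cont_on a b (fun t => c * f t)%C.
Proof.
  intros Hf t Ht eps Heps.
  assert (Hc1 : 0 < Cmod c + 1) by (pose proof (Cmod_ge_0 c); lra).
  destruct (Hf t Ht (eps / (Cmod c + 1))) as [d [Hd Q]]; [apply Rdiv_lt_0_compat; auto|].
  exists d; split; auto. intros s Hs Hst. specialize (Q s Hs Hst).
  replace (c * f s - c * f t)%C with (c * (f s - f t))%C by ring. rewrite Cmod_mult.
  apply Rle_lt_trans with ((Cmod c + 1) * Cmod (f s - f t)%C).
  - apply Rmult_le_compat_r; [apply Cmod_ge_0|lra].
  - apply (Rmult_lt_compat_l _ _ _ Hc1) in Q.
    replace ((Cmod c + 1) * (eps / (Cmod c + 1))) with eps in Q by (field; lra). auto.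
Qed.

Lemma cont_on_ext a b f g : (forall y, a <= y <= b -> f y = g y) -> cont_on a b f -> cont_on a b g.
Proof.
  intros E H x Hx e He. destruct (H x Hx e He) as [d [Hd K]]. exists d; split; auto.
  intros y Hy Hyx. rewrite <- (E y Hy), <- (E x Hx). auto.
Qed.

Lemma conv_cont K n U x : jet (-2) 2 K -> jet (-1) 1 U -> -1 <= x <= 1 ->
  cont_on (-1) 1 (fun y => K n (x - y)%R * U O y)%C.
Proof.
  intros HK HU Hx.
  apply (cont_on_ext _ _ (jmul (jaff x (-1) (fun i => K (n + i)%nat)) U O)).
  - intros y Hy. unfold jmul, jaff; simpl. rewrite Nat.add_0_r.
    replace (x + -1 * y) with (x - y) by ring. ring.
  - apply jet_cont. apply jet_mul; auto. apply (jet_aff (-2) 2); [intros; lra|].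
    intros i t Ht. rewrite <- plus_n_Sm. apply HK; auto.
Qed.

(** Differentiation under the integral sign. *)
Lemma conv_derive K n U : jet (-2) 2 K -> jet (-1) 1 U ->
  forall x, -1 <= x <= 1 ->
  is_derive_on (-1) 1 (convop (K n) (U O)) x (convop (K (S n)) (U O) x).
Proof.
  intros HK HU x Hx.
  assert (Hc := fun m z => conv_cont K m U z HK HU).
  destruct (jet_taylor_bound K n HK) as [M [HM0 HM]].
  destruct (cont_on_bounded (-1) 1 (U O) ltac:(lra) (jet_cont _ _ _ _ HU)) as [N HN].
  assert (HN0 : 0 <= N).
  { eapply Rle_trans; [apply Cmod_ge_0|]. apply (HN 0); lra. }
  apply is_derive_onP; auto. intros e He.
  assert (HMN : 0 <= M * N) by (apply Rmult_le_pos; auto).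
  assert (Hq : 0 < 2 * (M * N) + 1) by lra.
  exists (e / (2 * (M * N) + 1)). split; [apply Rdiv_lt_0_compat; auto|].
  intros y Hy Hyx.
  replace (convop (K n) (U O) y - convop (K n) (U O) x - RtoC (y - x) * convop (K (S n)) (U O) x)%C
    with (CInt (fun t => (K n (y - t)%R * U O t + - RtoC 1 * (K n (x - t)%R * U O t))
                   + (- RtoC (y - x)) * (K (S n) (x - t)%R * U O t))%C).
  2: { rewrite CInt_plus ?CInt_plus ?CInt_scal; auto using cont_on_plus, cont_on_scal.
       unfold convop. ring. }
  eapply Rle_trans.
  { apply (CInt_bound _ (M * (Rabs (y - x) * Rabs (y - x)) * N)).
    - auto using cont_on_plus, cont_on_scal.
    - intros t Ht.
      replace (K n (y - t)%R * U O t + - RtoC 1 * (K n (x - t)%R * U O t)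
                   + (- RtoC (y - x)) * (K (S n) (x - t)%R * U O t))%C
       with ((K n (y - t)%R - K n (x - t)%R - RtoC ((y - t) - (x - t)) * K (S n) (x - t)%R) * U O t)%C.
      + rewrite Cmod_mult. apply Rmult_le_compat; auto using Cmod_ge_0.
        replace (y - x) with ((y - t) - (x - t)) by ring. apply HM; lra.
      + replace ((y - t) - (x - t)) with (y - x) by ring. ring. }
  set (r := Rabs (y - x)) in *.
  assert (Hr : 0 <= r) by apply Rabs_pos.
  replace (2 * (M * (r * r) * N)) with (2 * (M * N) * r * r) by ring.
  apply Rmult_le_compat_r; auto.
  apply Rlt_le in Hyx. apply (Rmult_le_compat_l (2 * (M * N) + 1)) in Hyx; [|lra].
  replace ((2 * (M * N) + 1) * (e / (2 * (M * N) + 1))) with e in Hyx by (field; lra). lra.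
Qed.

(** The two sides are brought to the form of integrals of u times a smooth function
    of y: on the left by symmetry of L_1, so that no integration by parts is
    needed, on the right by differentiating under the integral.  The difference G
    of these functions is itself smooth on [-1,1], so its conjugate is an
    admissible u, and [CInt_conj_zero] gives G = 0. *)
Lemma kernel_relation (k b1 b2 c1 c2 : R -> C) K B1 B2 C1 C2 :
  jet (-2) 2 K -> jet (-1) 1 B1 -> jet (-1) 1 B2 -> jet (-1) 1 C1 -> jet (-1) 1 C2 ->
  (forall z, -2 <= z <= 2 -> K O z = k z) ->
  (forall x, -1 <= x <= 1 -> B1 O x = b1 x /\ B2 O x = b2 x /\ C1 O x = c1 x /\ C2 O x = c2 x) ->
  (forall z : R, -2 <= z <= 2 -> k (- z) = Cconj (k z)) ->
  op_eq (op_comp (convop (fun z => Cconj (k z))) (diffop b1 c1))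
        (op_comp (diffop b2 c2) (convop k)) ->
  is_transpose (diffop b1 c1) (diffop b1 c1) ->
  forall x y, -1 <= x <= 1 -> -1 <= y <= 1 ->
  (B1 O y * K 2%nat (y - x)%R + B1 1%nat y * K 1%nat (y - x)%R + C1 O y * K O (y - x)%R =
   B2 O x * K 2%nat (x - y)%R + B2 1%nat x * K 1%nat (x - y)%R + C2 O x * K O (x - y)%R)%C.
Proof.
  intros HK HB1 HB2 HC1 HC2 EK E Hsa Hs Ht x y Hx Hy.
  set (V := jaff (-x) 1 K).
  assert (HV : jet (-1) 1 V) by (apply (jet_aff (-2) 2); auto; intros; lra).
  assert (EV : forall n t, V n t = K n (t - x)).
  { intros n t. unfold V, jaff. replace (-x + 1 * t) with (t - x) by ring. rewrite Cpow_1_l. ring. }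
  set (W := fun n => jaff x (-1) (fun i => jscal ((RtoC (-1)) ^ n) K (n + i)%nat)).
  assert (HW : forall n, jet (-1) 1 (W n)).
  { intros n. apply (jet_aff (-2) 2); [intros; lra|]. intros i t Ht'. rewrite <- plus_n_Sm.
    apply jet_scal; auto. }
  assert (EW : forall n t, W n O t = (RtoC (-1) ^ n * K n (x - t)%R)%C).
  { intros n t. unfold W, jaff, jscal. rewrite Nat.add_0_r.
    replace (x + -1 * t) with (x - t) by ring. simpl. ring. }
  set (P := jadd (jadd (jmul (jshift B1) (jshift V)) (jmul B1 (jshift (jshift V)))) (jmul C1 V)).
  set (Q := jadd (jadd (jscal (- B2 1%nat x) (W 1%nat)) (jscal (B2 O x) (W 2%nat))) (jscal (C2 O x) (W O))).
  set (G := jadd P (jscal (- RtoC 1) Q)).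
  assert (HP : jet (-1) 1 P).
  { repeat (apply jet_add || apply jet_mul || apply jet_shift); auto. }
  assert (HQ : jet (-1) 1 Q).
  { repeat (apply jet_add || apply jet_scal); auto. }
  assert (HG : jet (-1) 1 G).
  { apply jet_add; auto. apply jet_scal; auto. }
  assert (HU : jet (-1) 1 (jconj G)) by (apply jet_conj; auto).
  set (U := jconj G) in *.
  assert (Hcont : forall F, jet (-1) 1 F -> cont_on (-1) 1 (fun t => U O t * F O t)%C).
  { intros F HF. apply (jet_cont _ _ (jmul U F) O). apply jet_mul; auto. }
  assert (G0 : forall t, -1 <= t <= 1 -> G O t = RtoC 0).
  { apply CInt_conj_zero; auto. change (fun t => (Cconj (G O t) * G O t)%C) with (fun t => (U O t * G O t)%C).
    transitivity (CInt (fun t => U O t * P O t + - RtoC 1 * (U O t * Q O t))%C).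
    { apply CInt_ext. intros t _. unfold G, jadd, jscal. ring. }
    rewrite CInt_plus ?CInt_scal; auto using cont_on_scal.
    assert (L : op_comp (convop (fun z => Cconj (k z))) (diffop b1 c1) (U O) x
       = CInt (fun t => U O t * P O t)%C).
    { unfold op_comp, convop.
      transitivity (CInt (fun t => diffop b1 c1 (U O) t * V O t)%C).
      { apply CInt_ext. intros t Ht'. rewrite EV EK; [|lra]. rewrite Cmult_comm. f_equal.
        rewrite <- Hsa; [|lra]. f_equal. ring. }
      rewrite (Ht (U O) (V O)); [|apply jet_smooth; auto|apply jet_smooth; auto].
      apply CInt_ext. intros t Ht'. f_equal.
      rewrite (diffop_eval b1 (B1 1%nat) c1 (V O) (V 1%nat) (V 2%nat)); auto.
      - destruct (E t Ht') as [E1 [_ [E2 _]]].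
        unfold P, jadd, jmul, jshift; simpl. rewrite E1 E2. ring.
      - intros s Hs'. apply (is_derive_on_ext _ _ (B1 O)); auto. intros r Hr. apply E; auto. }
    assert (Rr : op_comp (diffop b2 c2) (convop k) (U O) x = CInt (fun t => U O t * Q O t)%C).
    { unfold op_comp.
      rewrite (diffop_eval b2 (B2 1%nat) c2 _ (convop (K 1%nat) (U O)) (convop (K 2%nat) (U O))); auto.
      - destruct (E x Hx) as [_ [E1 [_ E2]]]. rewrite <- E1, <- E2.
        assert (Hk : convop k (U O) x = convop (K O) (U O) x).
        { apply CInt_ext. intros t Ht'. rewrite EK; [reflexivity|lra]. }
        rewrite Hk. unfold convop.
        rewrite <- !CInt_scal; auto using conv_cont.
        rewrite <- !CInt_plus; auto using cont_on_plus, cont_on_scal, conv_cont.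
        apply CInt_ext. intros t _. unfold Q, jadd, jscal. rewrite !EW. cbn [Cpow]. ring.
      - intros s Hs'. apply (is_derive_on_ext _ _ (B2 O)); auto. intros r Hr. apply E; auto.
      - intros s Hs'. apply (is_derive_on_ext _ _ (convop (K O) (U O))); auto.
        + intros r Hr. apply CInt_ext. intros t Ht'. rewrite EK; [reflexivity|lra].
        + apply conv_derive; auto.
      - intros s Hs'. apply conv_derive; auto. }
    rewrite <- L, <- Rr. rewrite (Hs (U O) (jet_smooth _ _ _ HU) x Hx). ring. }
  specialize (G0 y Hy). unfold G, P, Q, jadd, jscal, jmul, jshift in G0; simpl in G0.
  rewrite !EW !EV in G0. cbn [Cpow] in G0.
  apply Ceq_minus. rewrite <- G0. ring.
Qed.

(** * Taylor coefficients of the kernel relation *)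

Lemma jet_zero_closed a b F : a < b -> jet a b F ->
  (forall x, a < x < b -> F O x = RtoC 0) -> forall n x, a <= x <= b -> F n x = RtoC 0.
Proof.
  intros Hab HF H n x Hx.
  rewrite (jet_eq a b F (jconst (RtoC 0)) Hab HF (jet_const _ _ _)); auto.
  - destruct n; reflexivity.
  - intros y Hy. apply (cont_zero_closed a b); auto. apply jet_cont; auto.
Qed.

Lemma leib_zero_l n : forall f g, (forall i, f i = RtoC 0) -> leib n f g = RtoC 0.
Proof.
  induction n as [|n IH]; intros f g H; simpl.
  - rewrite H; ring.
  - rewrite !IH; auto. ring.
Qed.

Lemma leib_zero n : forall f g, (forall i, (i <= n)%nat -> g i = RtoC 0) -> leib n f g = RtoC 0.
Proof.
  induction n as [|n IH]; intros f g H; simpl.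
  - rewrite H; auto; ring.
  - rewrite !IH; try ring; intros; apply H; lia.
Qed.

(** In this and the next lemma, if g vanishes to order n then so does the product,
    and its first coefficients only see the first derivatives of f. *)
Lemma leib_lead n : forall f g, (forall i, (i < n)%nat -> g i = RtoC 0) ->
  leib n f g = (f O * g n)%C.
Proof.
  induction n as [|n IH]; intros f g H; simpl; auto.
  rewrite (leib_zero n _ g); [rewrite IH; [ring|]|]; intros; apply H; lia.
Qed.

Lemma leib_lead_S n : forall f g, (forall i, (i < n)%nat -> g i = RtoC 0) ->
  leib (S n) f g = (f O * g (S n) + RtoC (INR (S n)) * f 1%nat * g n)%C.
Proof.
  induction n as [|n IH]; intros f g H.
  - simpl. ring.
  - change (leib (S (S n)) f g) with (leib (S n) (fun i => f (S i)) g + leib (S n) f (fun i => g (S i)))%C.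
    rewrite (leib_lead (S n)); auto. rewrite IH.
    + rewrite (S_INR (S n)) RtoC_plus. cbv beta. ring.
    + intros; apply H; lia.
Qed.

(** The operator (b u')' + c u applied to u(x) = K(x-y), in terms of x and z = x - y;
    D is the jet of c. *)
Definition kform (K B D : nat -> R -> C) (x z : R) : C :=
  (B O x * K 2%nat z + B 1%nat x * K 1%nat z + D O x * K O z)%C.

Definition kernel_rel (e : C) (K B D : nat -> R -> C) : Prop :=
  forall x y, -1 <= x <= 1 -> -1 <= y <= 1 ->
    (kform K B D x (x - y) + e * kform K B D y (y - x) = 0)%C.

(** The function vanishes identically, so its jet does; reflecting z multiplies the
    n-th derivative by (-1)^n. *)
Lemma parity_jet l G e : 0 < l -> jet (-l) l G ->
  (forall z, -l <= z <= l -> (G O z + e * G O (-z)%R = 0)%C) ->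
  forall n z, -l <= z <= l -> (G n z + e * (RtoC (-1) ^ n * G n (-z)%R) = 0)%C.
Proof.
  intros Hl HG H n z Hz.
  assert (HJ : jet (-l) l (jadd G (jscal e (jaff 0 (-1) G)))).
  { apply jet_add; auto. apply jet_scal. apply (jet_aff (-l) l); auto. intros; lra. }
  pose proof (jet_zero_closed (-l) l _ ltac:(lra) HJ) as K.
  specialize (K ltac:(intros x Hx; unfold jadd, jscal, jaff; replace (0 + -1 * x) with (-x) by ring;
    cbn [Cpow]; rewrite Cmult_1_l; apply H; lra) n z Hz).
  unfold jadd, jscal, jaff in K. replace (0 + -1 * z) with (-z) in K by ring. exact K.
Qed.

Notation half := (RtoC (1/2)).

(** The jet of z |-> [kform] (s + z/2) z at a fixed midpoint s = (x+y)/2. *)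
Definition zjet K B D (s : R) : nat -> R -> C :=
  jadd (jadd (jmul (jaff s (1/2) B) (jshift (jshift K))) (jmul (jaff s (1/2) (jshift B)) (jshift K)))
       (jmul (jaff s (1/2) D) K).

Lemma zjet_jet K B D s l : jet (-2) 2 K -> jet (-1) 1 B -> jet (-1) 1 D ->
  (forall z, -l <= z <= l -> -1 <= s + 1/2 * z <= 1) -> l <= 2 -> jet (-l) l (zjet K B D s).
Proof.
  intros HK HB HD H Hl. unfold zjet.
  repeat (apply jet_add || apply jet_mul || apply jet_shift);
  try (apply (jet_aff (-1) 1); auto; apply jet_shift; auto);
  try apply (jet_sub (-2) 2); auto; lra.
Qed.

Lemma zjet_0 K B D s z : zjet K B D s O z = kform K B D (s + 1/2 * z) z.
Proof. unfold zjet, jadd, jmul, jaff, jshift, kform. cbn [leib Cpow]. ring. Qed.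

(** Fixing s, the relation says that the function with jet [zjet] has parity -e, so
    its n-th derivative at 0 vanishes when e (-1)^n differs from -1. *)
Lemma order_condition e K B D : jet (-2) 2 K -> jet (-1) 1 B -> jet (-1) 1 D -> kernel_rel e K B D ->
  forall n s, -1 < s < 1 -> (1 + e * RtoC (-1) ^ n)%C <> RtoC 0 ->
  (leib n (fun i => half ^ i * B i s) (fun i => K (2 + i)%nat 0) +
   leib n (fun i => half ^ i * B (1 + i)%nat s) (fun i => K (1 + i)%nat 0) +
   leib n (fun i => half ^ i * D i s) (fun i => K i 0) = 0)%C.
Proof.
  intros HK HB HD HR n s Hs Hn. set (l := 2 * Rmin (1 - s) (s + 1)).
  assert (Hl : 0 < l /\ l <= 2 /\ l <= 2 * (1 - s) /\ l <= 2 * (s + 1)).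
  { unfold l, Rmin. destruct Rle_dec; lra. }
  pose proof (zjet_jet K B D s l HK HB HD ltac:(intros; lra) ltac:(lra)) as HJ.
  pose proof (parity_jet l _ e ltac:(lra) HJ) as P.
  specialize (P ltac:(intros z Hz; rewrite !zjet_0;
    pose proof (HR (s + 1/2 * z) (s + 1/2 * - z) ltac:(lra) ltac:(lra)) as Q;
    replace (s + 1/2 * z - (s + 1/2 * - z)) with z in Q by field;
    replace (s + 1/2 * - z - (s + 1/2 * z)) with (- z) in Q by field; exact Q) n 0 ltac:(lra)).
  rewrite Ropp_0 in P.
  assert (Z : ((1 + e * RtoC (-1) ^ n) * zjet K B D s n 0 = 0)%C) by (rewrite <- P; ring).
  destruct (Ceq_dec (zjet K B D s n 0) (RtoC 0)) as [E|E].
  2: { exfalso. apply (Cmult_neq_0 _ _ Hn E); auto. }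
  unfold zjet, jadd, jmul, jaff, jshift in E. rewrite Rmult_0_r Rplus_0_r in E. exact E.
Qed.

(** The condition of order n-2: since K vanishes to order n at 0, only the term
    b K'' contributes, and only with b undifferentiated. *)
Lemma lead_same e K B D : jet (-2) 2 K -> jet (-1) 1 B -> jet (-1) 1 D -> kernel_rel e K B D ->
  forall n, (forall i, (i < n)%nat -> K i 0 = RtoC 0) ->
  forall s, -1 < s < 1 -> (2 <= n)%nat -> (1 + e * RtoC (-1) ^ n)%C <> RtoC 0 ->
  (B O s * K n 0 = 0)%C.
Proof.
  intros HK HB HD HR n Hlow s Hs Hn He. destruct n as [|[|m]]; try lia.
  assert (E : (RtoC (-1) ^ S (S m) = RtoC (-1) ^ m)%C) by (cbn [Cpow]; ring).
  rewrite E in He. pose proof (order_condition e K B D HK HB HD HR m s Hs He) as P.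
  rewrite leib_lead in P; [|intros; apply Hlow; lia].
  rewrite !leib_zero in P; [|intros; apply Hlow; lia..].
  rewrite <- P. cbn [Cpow]. change (2 + m)%nat with (S (S m)). ring.
Qed.

(** The condition of order n-1: the term b K'' contributes b K^(n+1)(0) and
    (n-1)/2 b' K^(n)(0), the term b' K' contributes b' K^(n)(0), and c K
    contributes nothing. *)
Lemma lead_next e K B D : jet (-2) 2 K -> jet (-1) 1 B -> jet (-1) 1 D -> kernel_rel e K B D ->
  forall n, (forall i, (i < n)%nat -> K i 0 = RtoC 0) ->
  forall s, -1 < s < 1 -> (1 <= n)%nat -> (1 + e * RtoC (-1) ^ S n)%C <> RtoC 0 ->
  (B O s * K (S n) 0 + RtoC (INR (S n)) * half * B 1%nat s * K n 0 = 0)%C.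
Proof.
  intros HK HB HD HR n Hlow s Hs Hn He. destruct n as [|m]; try lia.
  assert (E : (RtoC (-1) ^ S (S m) = RtoC (-1) ^ m)%C) by (cbn [Cpow]; ring).
  rewrite E in He. pose proof (order_condition e K B D HK HB HD HR m s Hs He) as P.
  rewrite (leib_lead m _ (fun i => K (1 + i)%nat 0)) in P; [|intros; apply Hlow; lia].
  rewrite (leib_zero m _ (fun i => K i 0)) in P; [|intros; apply Hlow; lia].
  destruct m as [|m].
  - cbn [leib Cpow Nat.add] in P. rewrite <- P.
    change (INR 2) with (1 + 1). rewrite RtoC_plus.
    assert ((1 + 1) * half = 1)%C as -> by (rewrite RtoC_div; try lra; field; intros Q; inversion Q; lra).
    ring.
  - rewrite leib_lead_S in P; [|intros; apply Hlow; lia].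
    cbn [leib Cpow Nat.add] in P. rewrite <- P.
    replace (INR (S (S (S m)))) with (INR (S m) + (1 + 1)) by (rewrite !S_INR; ring).
    rewrite !RtoC_plus.
    assert (E2 : ((1 + 1) * half = 1)%C) by (rewrite RtoC_div; try lra; field; intros Q; inversion Q; lra).
    transitivity (B 0%nat s * K (S (S (S m))) 0 + RtoC (INR (S m)) * half * B 1%nat s * K (S (S m)) 0
      + ((1 + 1) * half) * B 1%nat s * K (S (S m)) 0)%C; [ring|]. rewrite E2. ring.
Qed.

Lemma Cmult_integral (a b : C) : (a * b = 0)%C -> a = RtoC 0 \/ b = RtoC 0.
Proof.
  intros H. destruct (Ceq_dec a (RtoC 0)); auto. destruct (Ceq_dec b (RtoC 0)); auto.
  exfalso. apply (Cmult_neq_0 a b); auto.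
Qed.

Lemma pow_m1 n : (RtoC (-1) ^ n)%C = if Nat.even n then RtoC 1 else RtoC (-1).
Proof.
  induction n as [|n IH]; auto. rewrite Nat.even_succ -Nat.negb_even. cbn [Cpow]. rewrite IH.
  destruct (Nat.even n); simpl negb; cbv iota; ring.
Qed.

Lemma RtoC_neq x : x <> 0 -> RtoC x <> RtoC 0.
Proof. intros H E. apply H. apply RtoC_inj; auto. Qed.

(** The equation holds at interior midpoints only, and extends to the closed
    interval by continuity of B and B'. *)
Lemma first_order_closed B p q : jet (-1) 1 B -> q <> RtoC 0 ->
  (forall s, -1 < s < 1 -> (B O s * p + q * B 1%nat s = 0)%C) ->
  forall x, -1 <= x <= 1 -> B O x = (B O 1 * Cexp (- p / q * RtoC (x - 1)))%C.
Proof.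
  intros HB Hq H. apply ode_first_order; [lra|].
  intros x Hx. replace (- p / q * B O x)%C with (B 1%nat x); [apply HB; auto|].
  assert (HJ : jet (-1) 1 (jadd (jscal p B) (jscal q (jshift B)))).
  { apply jet_add; apply jet_scal; auto. apply jet_shift; auto. }
  pose proof (jet_zero_closed (-1) 1 _ ltac:(lra) HJ
    ltac:(intros s Hs; unfold jadd, jscal, jshift; rewrite <- (H s Hs); ring) O x Hx) as Z.
  unfold jadd, jscal, jshift in Z.
  apply Ceq_minus. transitivity ((p * B O x + q * B 1%nat x) / q)%C; [field; auto|]. rewrite Z. field; auto.
Qed.

(** For e = 1 the conditions of even order are available.  If n is even, order n-2
    reads b K^(n)(0) = 0.  If n is odd, order n-1 is a homogeneous first-order
    equation for b with nonzero leading coefficient, and b(1) = 0. *)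
Lemma even_relation_leading_term K B D n : jet (-2) 2 K -> jet (-1) 1 B -> jet (-1) 1 D ->
  kernel_rel (RtoC 1) K B D -> (1 <= n)%nat -> (forall i, (i < n)%nat -> K i 0 = RtoC 0) ->
  K n 0 <> RtoC 0 -> B O 1 = RtoC 0 -> forall m x, -1 <= x <= 1 -> B m x = RtoC 0.
Proof.
  intros HK HB HD HR Hn Hlow Hne H1.
  destruct (Nat.even n) eqn:En.
  - assert (2 <= n)%nat by (destruct n as [|[|]]; simpl in *; try lia; discriminate).
    apply jet_zero_closed; auto; [lra|]. intros s Hs.
    destruct (Cmult_integral (B O s) (K n 0)); auto; [|contradiction].
    apply (lead_same (RtoC 1) K B D) ; auto. rewrite pow_m1 En.
    replace (1 + 1 * 1)%C with (RtoC 2) by ring. apply RtoC_neq; lra.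
  - apply jet_zero_closed; auto; [lra|]. intros s Hs.
    rewrite (first_order_closed B (K (S n) 0) (RtoC (INR (S n)) * half * K n 0)%C); auto; try lra.
    + rewrite H1. ring.
    + repeat apply Cmult_neq_0; auto; apply RtoC_neq; [apply not_0_INR; lia|lra].
    + intros t Ht. rewrite <- (lead_next (RtoC 1) K B D HK HB HD HR n Hlow t Ht Hn).
      * ring.
      * rewrite pow_m1 Nat.even_succ -Nat.negb_even En. simpl negb; cbv iota.
        replace (1 + 1 * 1)%C with (RtoC 2) by ring. apply RtoC_neq; lra.
Qed.

(** * Multiplication by exponentials *)

(** With B replaced by e^{-2mx} B and c by e^{-2mx} (c - m b' + m^2 b), multiplying K
    by e^{mz} multiplies [kform] at (x,x-y) by e^{-m(x+y)}, a factor symmetric in x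
    and y.  This is why the relation survives. *)
Definition gauge_b m B := jmul (jexp (- (m + m))%C) B.
Definition gauge_c m B D :=
  jmul (jexp (- (m + m))%C) (jadd D (jadd (jscal (- m)%C (jshift B)) (jscal (m * m)%C B))).

(** The formulas for the new coefficients are those for which the derivatives of
    the exponentials cancel in [kform]. *)
Lemma gauge e K B D m : kernel_rel e K B D ->
  kernel_rel e (jmul (jexp m) K) (gauge_b m B) (gauge_c m B D).
Proof.
  intros HR x y Hx Hy.
  assert (G : forall x z, kform (jmul (jexp m) K) (gauge_b m B) (gauge_c m B D) x z
     = (Cexp (m * RtoC z) * Cexp (- (m + m) * RtoC x) * kform K B D x z)%C).
  { intros t z. unfold kform, gauge_b, gauge_c, jmul, jexp, jadd, jscal, jshift. cbn [leib Cpow]. ring. }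
  rewrite !G. rewrite <- !Cexp_plus, !RtoC_minus.
  replace (m * (RtoC x - RtoC y) + - (m + m) * RtoC x)%C with (- m * (RtoC x + RtoC y))%C by ring.
  replace (m * (RtoC y - RtoC x) + - (m + m) * RtoC y)%C with (- m * (RtoC x + RtoC y))%C by ring.
  transitivity (Cexp (- m * (RtoC x + RtoC y)) * (kform K B D x (x - y) + e * kform K B D y (y - x)))%C; [ring|].
  rewrite HR; auto. ring.
Qed.

(** * Power series at the origin *)

Definition expands (r : R) (a : nat -> R) (f : R -> R) : Prop :=
  forall z, Rabs z < r -> is_pseries a z (f z).

(** Convergence on |z| < r holds at a point beyond z, so z lies strictly inside the
    disc of convergence. *)
Lemma expands_radius r a f z : expands r a f -> Rabs z < r -> Rbar_lt (Rabs z) (CV_radius a).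
Proof.
  intros H Hz. set (t := (Rabs z + r) / 2).
  pose proof (Rabs_pos z).
  assert (Ht : Rabs t < r) by (rewrite Rabs_pos_eq; unfold t; lra).
  destruct (Rbar_lt_le_dec (Rabs z) (CV_radius a)) as [|Hle]; auto. exfalso.
  apply (CV_disk_outside a t).
  - eapply Rbar_le_lt_trans; [exact Hle|]. simpl. rewrite (Rabs_pos_eq t); unfold t; lra.
  - apply ex_series_lim_0. destruct (ex_intro _ _ (H t Ht) : ex_pseries a t) as [l Hl].
    exists l. apply (is_series_ext (fun k => scal (pow_n t k) (a k))); auto.
    intros n. rewrite pow_n_pow. unfold scal; simpl; unfold mult; simpl. ring.
Qed.

Lemma expands_derive r a f f' : expands r a f ->
  (forall z, Rabs z < r -> is_derive f z (f' z)) -> expands r (PS_derive a) f'.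
Proof.
  intros H Hd z Hz. pose proof (expands_radius r a f z H Hz) as Hr.
  assert (E : f' z = PSeries (PS_derive a) z).
  { rewrite <- (is_derive_unique _ _ _ (Hd z Hz)). apply is_derive_unique.
    apply (is_derive_ext_loc (PSeries a)).
    - assert (0 < r - Rabs z) by lra. exists (mkposreal _ H0). intros y Hy.
      change (Rabs (y - z) < r - Rabs z) in Hy.
      apply is_pseries_unique. apply H.
      replace y with (z + (y - z)) by ring. eapply Rle_lt_trans; [apply Rabs_triang|]. lra.
    - apply is_derive_PSeries; auto. }
  rewrite E. apply PSeries_correct. apply CV_radius_inside. rewrite CV_radius_derive. auto.
Qed.

Lemma expands_zero r a f : 0 < r -> expands r a f -> a O = f 0.
Proof.
  intros Hr H. rewrite <- (PSeries_0 a). apply is_pseries_unique. apply H. rewrite Rabs_R0; auto.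
Qed.

(** The components are expanded separately, as termwise differentiation is a
    statement about real power series. *)
Definition expandsC (r : R) (a1 a2 : nat -> R) (f : R -> C) : Prop :=
  expands r a1 (fun z => fst (f z)) /\ expands r a2 (fun z => snd (f z)).

Lemma expandsC_derive r a1 a2 F : r <= 2 -> jet (-2) 2 F -> expandsC r a1 a2 (F O) ->
  expandsC r (PS_derive a1) (PS_derive a2) (F 1%nat).
Proof.
  intros Hr HF [H1 H2].
  assert (D : forall z, Rabs z < r -> is_derive (fun y => fst (F O y)) z (fst (F 1%nat z)) /\
     is_derive (fun y => snd (F O y)) z (snd (F 1%nat z))).
  { intros z Hz. apply Rabs_def2 in Hz. apply (is_derive_on_components (-2) 2); [lra|]. apply HF; lra. }
  split; eapply expands_derive; eauto; intros z Hz; apply D; auto.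
Qed.

(** If all derivatives at 0 vanish then so do all Taylor coefficients.  The induction
    runs over the index of the coefficient, shifting jet and series together. *)
Lemma expandsC_zero r F : 0 < r -> r <= 2 -> forall a1 a2, jet (-2) 2 F -> expandsC r a1 a2 (F O) ->
  (forall n, F n 0 = RtoC 0) -> forall z, Rabs z < r -> F O z = RtoC 0.
Proof.
  intros Hr Hr2 a1 a2 HF H H0.
  assert (A : forall n (G : nat -> R -> C) a1 a2, jet (-2) 2 G -> expandsC r a1 a2 (G O) ->
     (forall m, G m 0 = RtoC 0) -> a1 n = 0 /\ a2 n = 0).
  { intros n; induction n as [|n IH]; intros G b1 b2 HG HE HZ.
    - destruct HE as [E1 E2]. rewrite (expands_zero _ _ _ Hr E1) (expands_zero _ _ _ Hr E2) HZ. auto.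
    - destruct (IH (jshift G) (PS_derive b1) (PS_derive b2)) as [Q1 Q2].
      + apply jet_shift; auto.
      + apply expandsC_derive; auto.
      + intros m. apply HZ.
      + unfold PS_derive in Q1, Q2. pose proof (not_0_INR (S n) ltac:(lia)).
        split; [apply Rmult_integral in Q1 as [|]|apply Rmult_integral in Q2 as [|]]; auto; contradiction. }
  assert (PZ : forall a z, (forall n, a n = 0) -> PSeries a z = 0).
  { intros a z Ha. rewrite (PSeries_ext a (fun _ => 0)); auto. apply PSeries_const_0. }
  intros z Hz. destruct H as [E1 E2].
  pose proof (is_pseries_unique _ _ _ (E1 z Hz)) as Q1. pose proof (is_pseries_unique _ _ _ (E2 z Hz)) as Q2.
  rewrite PZ in Q1; [|intros n; apply (A n F a1 a2); auto; split; auto].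
  rewrite PZ in Q2; [|intros n; apply (A n F a1 a2); auto; split; auto].
  destruct (F O z) as [u v]; simpl in *. subst. reflexivity.
Qed.

Lemma expandsC_of_analytic k : analytic_at_0 k -> exists r a1 a2, 0 < r /\ r <= 2 /\ expandsC r a1 a2 k.
Proof.
  intros [a [r [Hr H]]].
  assert (S1 : forall (f : nat -> C) n, fst (@sum_n C_R_NormedModule f n) = sum_n (fun i => fst (f i)) n
      /\ snd (@sum_n C_R_NormedModule f n) = sum_n (fun i => snd (f i)) n).
  { intros f n. induction n as [|n [IH1 IH2]].
    - rewrite !sum_O. auto.
    - rewrite !sum_Sn -IH1 -IH2. auto. }
  exists (Rmin r 2), (fun n => fst (a n)), (fun n => snd (a n)).
  split; [apply Rmin_pos; lra|]. split; [apply Rmin_r|].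
  assert (M : forall z, Rabs z < Rmin r 2 -> @is_pseries R_AbsRing C_R_NormedModule a z (k z)).
  { intros z Hz. apply H. eapply Rlt_le_trans; [exact Hz|apply Rmin_l]. }
  split; intros z Hz; specialize (M z Hz).
  - apply (filterlim_ext (fun n => fst (@sum_n C_R_NormedModule (fun i => scal (pow_n z i) (a i)) n))).
    + intros n. rewrite (proj1 (S1 _ n)). apply sum_n_ext. intros i. reflexivity.
    + eapply filterlim_comp; [exact M|].
      destruct (k z) as [u v]; apply (continuous_fst (U := R_UniformSpace) (V := R_UniformSpace) u v).
  - apply (filterlim_ext (fun n => snd (@sum_n C_R_NormedModule (fun i => scal (pow_n z i) (a i)) n))).
    + intros n. rewrite (proj2 (S1 _ n)). apply sum_n_ext. intros i. reflexivity.
    + eapply filterlim_comp; [exact M|].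
      destruct (k z) as [u v]; apply (continuous_snd (U := R_UniformSpace) (V := R_UniformSpace) u v).
Qed.

Lemma expandsC_combination r a1 a2 b1 b2 f g w : expandsC r a1 a2 f -> expandsC r b1 b2 g ->
  exists c1 c2, expandsC r c1 c2 (fun z => f z + w * g z)%C.
Proof.
  intros [F1 F2] [G1 G2].
  exists (PS_plus a1 (PS_plus (PS_scal (fst w) b1) (PS_scal (- snd w) b2))),
         (PS_plus a2 (PS_plus (PS_scal (fst w) b2) (PS_scal (snd w) b1))).
  assert (L : forall (a b c : nat -> R) (z x y t u v : R),
    is_pseries a z x -> is_pseries b z y -> is_pseries c z t ->
    is_pseries (PS_plus a (PS_plus (PS_scal u b) (PS_scal v c))) z (x + (u * y + v * t))).
  { intros a b c z x y t u v Ha Hb Hc.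
    apply (is_pseries_plus (V := R_NormedModule) _ _ z x (u * y + v * t)); auto.
    apply (is_pseries_plus (V := R_NormedModule) _ _ z (u * y) (v * t));
    apply (is_pseries_scal (V := R_NormedModule)); auto; apply Rmult_comm. }
  split; intros z Hz.
  - replace (fst (f z + w * g z)%C) with (fst (f z) + (fst w * fst (g z) + - snd w * snd (g z)))
      by (simpl; ring).
    apply L; auto.
  - replace (snd (f z + w * g z)%C) with (snd (f z) + (fst w * snd (g z) + snd w * fst (g z)))
      by (simpl; ring).
    apply L; auto.
Qed.

(** * Sums of exponentials *)

Notation ipi := (Ci * RtoC PI)%C.

(** A list avoids indices: sums concatenate, and multiplying by an exponential maps
    over the list. *)
Definition esum (L : list (C * C)) (z : R) : C :=
  fold_right (fun p s => fst p * Cexp (snd p * RtoC z) + s)%C (RtoC 0) L.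

Definition is_esum (f : R -> C) : Prop := exists L, forall z, f z = esum L z.

Lemma is_esum_plus f g : is_esum f -> is_esum g -> is_esum (fun z => f z + g z)%C.
Proof.
  intros [L HL] [M HM]. exists (L ++ M). intros z. rewrite HL HM. clear.
  induction L as [|p L IH]; simpl; [ring|]. rewrite <- IH. ring.
Qed.

Lemma is_esum_exp a w f : is_esum f -> is_esum (fun z => a * Cexp (w * RtoC z) * f z)%C.
Proof.
  intros [L HL]. exists (map (fun p => (a * fst p, w + snd p)%C) L). intros z. rewrite HL. clear HL.
  induction L as [|p L IH]; simpl; [ring|]. rewrite <- IH.
  replace ((w + snd p) * RtoC z)%C with (w * RtoC z + snd p * RtoC z)%C by ring.
  rewrite Cexp_plus. ring.
Qed.

Lemma is_esum_ext f g : (forall z, f z = g z) -> is_esum f -> is_esum g.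
Proof. intros E [L HL]. exists L. intros z. rewrite <- E. auto. Qed.

Lemma is_esum_one : is_esum (fun _ => RtoC 1).
Proof.
  exists ((RtoC 1, RtoC 0) :: nil). intros z. simpl.
  replace (RtoC 0 * RtoC z)%C with (RtoC 0) by ring. rewrite Cexp_0. ring.
Qed.

Lemma is_esum_cexp a w : is_esum (fun z => a * Cexp (w * RtoC z))%C.
Proof.
  apply (is_esum_ext (fun z => a * Cexp (w * RtoC z) * RtoC 1)%C); [intros; ring|].
  apply is_esum_exp, is_esum_one.
Qed.

Lemma is_esum_scal a f : is_esum f -> is_esum (fun z => a * f z)%C.
Proof.
  intros H. apply (is_esum_ext (fun z => a * Cexp (RtoC 0 * RtoC z) * f z)%C).
  - intros z. replace (RtoC 0 * RtoC z)%C with (RtoC 0) by ring. rewrite Cexp_0. ring.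
  - apply is_esum_exp; auto.
Qed.

Lemma is_esum_jet f a b : is_esum f -> exists J, jet a b J /\ forall z, J O z = f z.
Proof.
  intros [L HL].
  assert (exists J, jet a b J /\ forall z, J O z = esum L z) as [J [HJ E]].
  { clear HL. induction L as [|p L [J [HJ E]]].
    - exists (jconst (RtoC 0)). split; [apply jet_const|]. reflexivity.
    - exists (jadd (jscal (fst p) (jexp (snd p))) J). split.
      + apply jet_add; auto. apply jet_scal, jet_exp.
      + intros z. unfold jadd, jscal, jexp. rewrite E. simpl. ring. }
  exists J. split; auto. intros z. rewrite E HL. auto.
Qed.

Definition near_trivial (f : R -> C) : Prop := exists r, 0 < r /\ trivial_on (fun z => Rabs z < r) f.

Definition near_esum (f : R -> C) : Prop :=
  exists r g, 0 < r /\ is_esum g /\ forall z, Rabs z < r -> f z = g z.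

(** The number of terms of [exp_sum_on] is one more than its bound; the default
    pair of [nth] contributes the coefficient 0. *)
Lemma near_esum_trivial f : near_esum f -> near_trivial f.
Proof.
  intros [r [g [Hr [[L HL] E]]]]. exists r. split; auto. left.
  exists (length L), (fun i => fst (nth i L (RtoC 0, RtoC 0))), (fun i => snd (nth i L (RtoC 0, RtoC 0))).
  intros z Hz. rewrite E; auto. rewrite HL. clear.
  induction L as [|p L IH]; unfold sum_n.
  - simpl length. rewrite sum_n_n. simpl. ring.
  - simpl length. rewrite sum_Sn_m; [|lia]. simpl esum. rewrite IH.
    rewrite <- sum_n_m_S. reflexivity.
Qed.

Lemma near_esum_gauge m K : near_esum (jmul (jexp m) K O) -> near_esum (K O).
Proof.
  intros [r [g [Hr [Hg E]]]]. exists r, (fun z => RtoC 1 * Cexp (- m * RtoC z) * g z)%C.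
  split; auto. split; [apply is_esum_exp; auto|]. intros z Hz. rewrite <- E; auto.
  unfold jmul, jexp; simpl. pose proof (Cexp_neg m z) as H.
  transitivity ((Cexp (m * RtoC z) * Cexp (- m * RtoC z)) * K O z)%C; [rewrite H; ring|ring].
Qed.

(** X^m - X^-m is divisible by X - X^-1 as a Laurent polynomial, for every integer
    m: X^(m+1) - X^-(m+1) = X (X^m - X^-m) + X^-m (X - X^-1). *)
Lemma geometric_esum rho (m : Z) : exists U, is_esum U /\ forall z,
  (Cexp (RtoC (IZR m) * rho * RtoC z) - Cexp (- (RtoC (IZR m) * rho) * RtoC z)
   = (Cexp (rho * RtoC z) - Cexp (- rho * RtoC z)) * U z)%C.
Proof.
  assert (N : forall n : nat, exists U, is_esum U /\ forall z,
  (Cexp (RtoC (INR n) * rho * RtoC z) - Cexp (- (RtoC (INR n) * rho) * RtoC z)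
   = (Cexp (rho * RtoC z) - Cexp (- rho * RtoC z)) * U z)%C).
  { induction n as [|n [U [HU E]]].
    - exists (fun _ => RtoC 0). split.
      + exists nil. reflexivity.
      + intros z. simpl. replace (- (0 * rho) * RtoC z)%C with (0 * rho * RtoC z)%C by ring. ring.
    - exists (fun z => RtoC 1 * Cexp (rho * RtoC z) * U z + RtoC 1 * Cexp (- (RtoC (INR n) * rho) * RtoC z))%C.
      split.
      + apply is_esum_plus; [apply is_esum_exp; auto|apply is_esum_cexp].
      + intros z. specialize (E z). rewrite S_INR RtoC_plus.
        replace ((RtoC (INR n) + 1) * rho * RtoC z)%C with (RtoC (INR n) * rho * RtoC z + rho * RtoC z)%C by ring.
        replace (- ((RtoC (INR n) + 1) * rho) * RtoC z)%C with (- (RtoC (INR n) * rho) * RtoC z + - rho * RtoC z)%C by ring.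
        rewrite !Cexp_plus.
        set (X := Cexp (rho * RtoC z)) in *. set (Y := Cexp (- rho * RtoC z)) in *.
        set (V := Cexp (- (RtoC (INR n) * rho) * RtoC z)) in *. set (W := Cexp (RtoC (INR n) * rho * RtoC z)) in *.
        transitivity (X * (W - V) + V * (X - Y))%C; [ring|]. rewrite E. ring. }
  destruct (Z_le_gt_dec 0 m) as [H|H].
  - destruct (N (Z.to_nat m)) as [U HU]. exists U. rewrite INR_IZR_INZ Z2Nat.id in HU; auto.
  - destruct (N (Z.to_nat (- m))) as [U [HU E]]. exists (fun z => RtoC (-1) * U z)%C.
    split; [apply is_esum_scal; auto|]. intros z. specialize (E z).
    rewrite INR_IZR_INZ Z2Nat.id in E; [|lia]. rewrite opp_IZR RtoC_opp in E.
    replace (- RtoC (IZR m) * rho * RtoC z)%C with (- (RtoC (IZR m) * rho) * RtoC z)%C in E by ring.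
    replace (- (- RtoC (IZR m) * rho) * RtoC z)%C with (RtoC (IZR m) * rho * RtoC z)%C in E by ring.
    transitivity (- (Cexp (- (RtoC (IZR m) * rho) * RtoC z) - Cexp (RtoC (IZR m) * rho * RtoC z)))%C; [ring|].
    rewrite E. ring.
Qed.

Lemma Cexp_eq_1 w : Cexp w = RtoC 1 -> exists n : Z, w = (RtoC (IZR (2 * n)) * ipi)%C.
Proof.
  destruct w as [x y]. intros H.
  assert (H1 : exp x * cos y = 1) by exact (f_equal fst H).
  assert (H2 : exp x * sin y = 0) by exact (f_equal snd H).
  pose proof (exp_pos x) as Hx.
  assert (Hs : sin y = 0) by (apply Rmult_integral in H2 as [|]; lra).
  pose proof (sin2_cos2 y) as Q. unfold Rsqr in Q. rewrite Hs in Q.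
  assert (Hc : cos y = 1) by nra.
  assert (Hx1 : exp x = 1) by (rewrite Hc in H1; lra).
  assert (Hx0 : x = 0) by (apply exp_inv; rewrite exp_0; auto).
  assert (Hh : sin (y / 2) = 0).
  { pose proof (cos_2a_sin (y / 2)) as E. replace (2 * (y / 2)) with y in E by field. nra. }
  destruct (sin_eq_0_0 _ Hh) as [n Hn]. exists n.
  rewrite mult_IZR. unfold Ci, Cmult, RtoC; simpl. subst x. f_equal; [ring|]. lra.
Qed.

Lemma Cexp_ipi : Cexp ipi = RtoC (-1).
Proof.
  unfold Cexp, Cmult, Ci, Re, Im, RtoC; simpl.
  replace (0 * PI - 1 * 0) with 0 by ring. replace (0 * 0 + 1 * PI) with PI by ring.
  rewrite exp_0 cos_PI sin_PI. f_equal; ring.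
Qed.

Lemma Cexp_half_ipi : Cexp (RtoC (1/2) * ipi) = Ci.
Proof.
  unfold Cexp, Cmult, Ci, Re, Im, RtoC; simpl.
  replace (1 / 2 * (0 * PI - 1 * 0) - 0 * (0 * 0 + 1 * PI)) with 0 by ring.
  replace (1 / 2 * (0 * 0 + 1 * PI) + 0 * (0 * PI - 1 * 0)) with (PI / 2) by field.
  rewrite exp_0 cos_PI2 sin_PI2. f_equal; ring.
Qed.

Lemma ipi_nz : ipi <> RtoC 0.
Proof. apply Cmult_neq_0; [apply Ci_nz|]. apply RtoC_neq. pose proof PI_RGT_0; lra. Qed.

Lemma Cexp_nz w : Cexp w <> RtoC 0.
Proof.
  intros H. assert (E : (Cexp w * Cexp (- w) = 1)%C).
  { rewrite <- Cexp_plus. replace (w + - w)%C with (RtoC 0) by ring. apply Cexp_0. }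
  rewrite H in E. apply C1_nz. rewrite <- E. ring.
Qed.

(** The frequency i pi n/2 of the Dirichlet eigenfunctions of d^2 on [-1,1], whose
    eigenvalues are -(pi n/2)^2. *)
Definition freq (n : Z) : C := (RtoC (IZR n / 2) * ipi)%C.

Lemma freq_nz n : n <> 0%Z -> freq n <> RtoC 0.
Proof.
  intros H. apply Cmult_neq_0; [|apply ipi_nz]. apply RtoC_neq.
  apply eq_IZR_contrapositive in H. lra.
Qed.

(** e^{rho z} - e^{-rho z} vanishes only at the multiples of 2/n, so a function that
    it annihilates is zero near 0, at 0 itself by continuity. *)
Lemma cancel_freq n f : n <> 0%Z -> cont_on (-2) 2 f ->
  (forall z, -2 <= z <= 2 -> (f z * (Cexp (freq n * RtoC z) - Cexp (- freq n * RtoC z)) = 0)%C) ->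
  forall z, Rabs z < / Rabs (IZR n) -> f z = RtoC 0.
Proof.
  intros Hn Hc H.
  assert (Hn1 : 1 <= Rabs (IZR n)).
  { rewrite <- abs_IZR. apply IZR_le. lia. }
  assert (Hi : 0 < / Rabs (IZR n) <= 1).
  { split; [apply Rinv_0_lt_compat; lra|]. rewrite <- Rinv_1. apply Rinv_le_contravar; lra. }
  assert (Nz : forall z, z <> 0 -> Rabs z < / Rabs (IZR n) -> f z = RtoC 0).
  { intros z Hz0 Hz. assert (Hz2 : -2 <= z <= 2) by (apply Rabs_def2 in Hz; lra).
    destruct (Cmult_integral _ _ (H z Hz2)) as [|E]; auto. exfalso.
    assert (E1 : Cexp (freq n * RtoC z + freq n * RtoC z)%C = RtoC 1).
    { rewrite Cexp_plus. apply Ceq_minus in E. rewrite {2}E. apply Cexp_neg. }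
    destruct (Cexp_eq_1 _ E1) as [p Hp].
    assert (E2 : (ipi * RtoC (IZR n * z - IZR (2 * p)) = 0)%C).
    { rewrite RtoC_minus RtoC_mult.
      transitivity (freq n * RtoC z + freq n * RtoC z - RtoC (IZR (2 * p)) * ipi)%C; [|rewrite Hp; ring].
      unfold freq, Rdiv. rewrite RtoC_mult.
      transitivity ((RtoC (/ 2) + RtoC (/2)) * (ipi * (RtoC (IZR n) * RtoC z)) - RtoC (IZR (2 * p)) * ipi)%C; [|ring].
      rewrite <- RtoC_plus. replace (/ 2 + / 2) with 1 by field. ring. }
    apply Cmult_integral in E2 as [E2|E2]; [exact (ipi_nz E2)|].
    apply RtoC_inj in E2. rewrite mult_IZR in E2.
    assert (Hlt : Rabs (2 * IZR p) < 1).
    { replace (2 * IZR p) with (IZR n * z) by lra. rewrite Rabs_mult.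
      apply (Rmult_lt_compat_l (Rabs (IZR n))) in Hz; [|lra]. rewrite Rinv_r in Hz; lra. }
    assert (p = 0%Z).
    { apply Rabs_def2 in Hlt as [L1 L2].
      assert (IZR p < 1) by lra. assert (-1 < IZR p) by lra.
      apply lt_IZR in H0. apply lt_IZR in H1. lia. }
    subst p. assert (Eq : IZR n * z = 0) by lra.
    apply Rmult_integral in Eq as [Eq|Eq]; auto. rewrite Eq Rabs_R0 in Hn1. lra. }
  intros z Hz. destruct (Req_dec z 0) as [->|]; auto.
  set (r := / Rabs (IZR n)) in *.
  apply (cont_zero_closed 0 r f); try lra.
  - intros x Hx eps He. destruct (Hc x ltac:(lra) eps He) as [d [Hd Q]]. exists d; split; auto.
    intros y Hy. apply Q. lra.
  - intros x Hx. apply Nz; [lra|]. rewrite Rabs_pos_eq; lra.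
Qed.

(** * The Dirichlet eigenvalue problem *)

(** The value at 0 gives a + a' = 0, the derivative at 0 gives a - a' = 0. *)
Lemma exp_independent a a' rho eps : rho <> RtoC 0 -> 0 < eps ->
  (forall s, -eps <= s <= eps -> (a * Cexp (rho * RtoC s) + a' * Cexp (- rho * RtoC s) = 0)%C) ->
  a = RtoC 0 /\ a' = RtoC 0.
Proof.
  intros Hr He H.
  assert (HJ : jet (-eps) eps (jadd (jscal a (jexp rho)) (jscal a' (jexp (- rho)%C)))).
  { apply jet_add; apply jet_scal, jet_exp. }
  assert (Z : forall n, jadd (jscal a (jexp rho)) (jscal a' (jexp (- rho)%C)) n 0 = RtoC 0).
  { intros n. apply (jet_zero_closed (-eps) eps); auto; try lra.
    intros x Hx. rewrite <- (H x); [|lra]. unfold jadd, jscal, jexp. cbn [Cpow]. ring. }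
  pose proof (Z O) as Z0. pose proof (Z 1%nat) as Z1.
  unfold jadd, jscal, jexp in Z0, Z1. cbn [Cpow] in Z0, Z1.
  replace (rho * RtoC 0)%C with (RtoC 0) in * by ring.
  replace (- rho * RtoC 0)%C with (RtoC 0) in * by ring. rewrite Cexp_0 in Z0, Z1.
  assert (S0 : (a + a' = 0)%C) by (rewrite <- Z0; ring).
  assert (S1 : (a - a' = 0)%C).
  { assert (E : (rho * (a - a') = 0)%C) by (rewrite <- Z1; ring).
    apply Cmult_integral in E as [E|E]; auto; contradiction. }
  assert (N2 : RtoC 2 <> RtoC 0) by (apply RtoC_neq; lra).
  split.
  - assert (E : (2 * a = 0)%C) by (transitivity ((a + a') + (a - a'))%C; [ring|rewrite S0 S1; ring]).
    apply Cmult_integral in E as [E|E]; auto; contradiction.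
  - assert (E : (2 * a' = 0)%C) by (transitivity ((a + a') - (a - a'))%C; [ring|rewrite S0 S1; ring]).
    apply Cmult_integral in E as [E|E]; auto; contradiction.
Qed.

Definition jlin (c : C) : nat -> R -> C :=
  fun n t => match n with O => c * RtoC t | 1%nat => c | _ => RtoC 0 end%C.

Lemma jet_lin a b c : jet a b (jlin c).
Proof.
  intros [|[|n]] t Ht; unfold jlin.
  - apply is_derive_on_linear; auto.
  - apply is_derive_on_const; auto.
  - apply is_derive_on_const; auto.
Qed.

Lemma second_order_closed B kap : jet (-1) 1 B ->
  (forall s, -1 < s < 1 -> B 2%nat s = (kap * B O s)%C) ->
  forall s, -1 <= s <= 1 -> B 2%nat s = (kap * B O s)%C.
Proof.
  intros HB H s Hs. apply Ceq_minus.
  assert (HJ : jet (-1) 1 (jadd (jshift (jshift B)) (jscal (- kap)%C B))).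
  { apply jet_add; [repeat apply jet_shift; auto|apply jet_scal; auto]. }
  rewrite <- (jet_zero_closed (-1) 1 _ ltac:(lra) HJ) with (n := O) (x := s); auto.
  - unfold jadd, jscal, jshift. ring.
  - intros t Ht. unfold jadd, jscal, jshift. rewrite H; auto. ring.
Qed.

(** With kap = rho^2, the solution that vanishes at -1 is a multiple of
    sinh(rho (s+1)), or of s+1 when rho = 0.  Vanishing at 1 excludes the linear
    one and gives e^{4 rho} = 1.  Both exponentials then occur in B. *)
Lemma dirichlet_eigen B kap : jet (-1) 1 B -> B O (-1) = RtoC 0 -> B O 1 = RtoC 0 ->
  (forall s, -1 < s < 1 -> B 2%nat s = (kap * B O s)%C) -> (exists x, -1 <= x <= 1 /\ B O x <> RtoC 0) ->
  exists n A A', n <> 0%Z /\ A <> RtoC 0 /\ A' <> RtoC 0 /\ kap = (freq n * freq n)%C /\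
    forall s, -1 <= s <= 1 -> B O s = (A * Cexp (freq n * RtoC s) + A' * Cexp (- freq n * RtoC s))%C.
Proof.
  intros HB Hm Hp H [x0 [Hx0 Hne]].
  pose proof (second_order_closed B kap HB H) as H2.
  destruct (Csqrt_exists kap) as [rho Hrho].
  set (c := B 1%nat (-1)).
  assert (U : forall F, jet (-1) 1 F -> (forall s, F 2%nat s = (kap * F O s)%C) ->
     F O (-1) = RtoC 0 -> F 1%nat (-1) = c -> forall s, -1 <= s <= 1 -> B O s = F O s).
  { intros F HF F2 F0 F1 s Hs. apply Ceq_minus.
    assert (HJ : jet (-1) 1 (jadd B (jscal (- RtoC 1) F))) by (apply jet_add; auto; apply jet_scal; auto).
    pose proof (ode_second_order_zero (-1) 1 (jadd B (jscal (- RtoC 1) F) O)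
      (jadd B (jscal (- RtoC 1) F) 1%nat) kap (-1) ltac:(lra)) as Q.
    assert (jadd B (jscal (- RtoC 1) F) O s = RtoC 0).
    { apply Q; auto.
      - intros t Ht. replace (kap * jadd B (jscal (- RtoC 1) F) O t)%C with (jadd B (jscal (- RtoC 1) F) 2%nat t); [apply HJ; auto|].
        unfold jadd, jscal. rewrite H2; auto. rewrite F2. ring.
      - unfold jadd, jscal. rewrite Hm F0. ring.
      - unfold jadd, jscal. rewrite F1. fold c. ring. }
    rewrite <- H0. unfold jadd, jscal. ring. }
  destruct (Ceq_dec c (RtoC 0)) as [Hc|Hc].
  { exfalso. apply Hne. rewrite (U (jconst (RtoC 0))); auto; try apply jet_const.
    intros s. unfold jconst. ring. }
  destruct (Ceq_dec rho (RtoC 0)) as [Hr|Hr].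
  { exfalso. 
    assert (E : B O 1 = (c * RtoC (1 + 1))%C).
    { rewrite (U (jadd (jlin c) (jconst c))); try lra.
      - unfold jadd, jlin, jconst. rewrite RtoC_plus. ring.
      - apply jet_add; [apply jet_lin|apply jet_const].
      - intros s. unfold jadd, jlin, jconst. rewrite <- Hrho, Hr. ring.
      - unfold jadd, jlin, jconst. ring.
      - unfold jadd, jlin, jconst. ring. }
    rewrite Hp in E. symmetry in E. apply Cmult_integral in E as [E|E]; auto.
    apply RtoC_inj in E. lra. }
  set (A := (c / (RtoC 2 * rho) * Cexp rho)%C). set (A' := (- (c / (RtoC 2 * rho)) * Cexp (- rho))%C).
  assert (N2 : RtoC 2 <> RtoC 0) by (apply RtoC_neq; lra).
  assert (Nq : (c / (RtoC 2 * rho))%C <> RtoC 0).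
  { intros E. apply Hc. transitivity (c / (RtoC 2 * rho) * (RtoC 2 * rho))%C; [field; auto|rewrite E; ring]. }
  assert (Ee : (Cexp rho * Cexp (- rho) = 1)%C).
  { rewrite <- Cexp_plus. replace (rho + - rho)%C with (RtoC 0) by ring. apply Cexp_0. }
  assert (EB : forall s, -1 <= s <= 1 -> B O s = (A * Cexp (rho * RtoC s) + A' * Cexp (- rho * RtoC s))%C).
  { intros s Hs.
    rewrite (U (jadd (jscal A (jexp rho)) (jscal A' (jexp (- rho)%C)))); auto.
    - unfold jadd, jscal, jexp. cbn [Cpow]. ring.
    - apply jet_add; apply jet_scal, jet_exp.
    - intros t. unfold jadd, jscal, jexp. cbn [Cpow]. rewrite <- Hrho. ring.
    - unfold jadd, jscal, jexp, A, A'. cbn [Cpow].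
      replace (rho * RtoC (-1))%C with (- rho)%C by ring. replace (- rho * RtoC (-1))%C with rho by ring.
      ring.
    - unfold jadd, jscal, jexp, A, A'. cbn [Cpow].
      replace (rho * RtoC (-1))%C with (- rho)%C by ring. replace (- rho * RtoC (-1))%C with rho by ring.
      transitivity (c / (RtoC 2 * rho) * (2 * rho) * (Cexp rho * Cexp (- rho)))%C; [ring|]. rewrite Ee. field. auto. }
  assert (E4 : Cexp (RtoC 4 * rho)%C = RtoC 1).
  { pose proof (EB 1 ltac:(lra)) as E. rewrite Hp in E. unfold A, A' in E.
    replace (rho * RtoC 1)%C with rho in E by ring. replace (- rho * RtoC 1)%C with (- rho)%C in E by ring.
    assert (E' : (c / (RtoC 2 * rho) * (Cexp rho * Cexp rho - Cexp (- rho) * Cexp (- rho)) = 0)%C) by (rewrite E; ring).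
    apply Cmult_integral in E' as [E'|E']; [contradiction|].
    apply Ceq_minus in E'.
    replace (RtoC 4 * rho)%C with (rho + rho + (rho + rho))%C by ring. rewrite !Cexp_plus.
    rewrite {1}E'. transitivity ((Cexp rho * Cexp (- rho)) * (Cexp rho * Cexp (- rho)))%C; [ring|]. rewrite Ee. ring. }
  destruct (Cexp_eq_1 _ E4) as [n Hn].
  assert (Er : rho = freq n).
  { unfold freq. transitivity (RtoC (/4) * (RtoC 4 * rho))%C.
    - rewrite Cmult_assoc -RtoC_mult. replace (/ 4 * 4) with 1 by field. ring.
    - rewrite Hn Cmult_assoc -RtoC_mult mult_IZR. f_equal. f_equal. field. }
  exists n, A, A'. rewrite <- Er. repeat split; auto.
  - intros ->. apply Hr. rewrite Er. unfold freq. replace (0 / 2) with 0 by field. ring.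
  - apply Cmult_neq_0; auto. apply Cexp_nz.
  - apply Cmult_neq_0; [|apply Cexp_nz]. intros E. apply Nq. 
    transitivity (- - (c / (RtoC 2 * rho)))%C; [ring|]. rewrite E. ring.
Qed.

Notation hw w := (half * w)%C.

(** * Kernels attached to two opposite frequencies *)

Lemma half2 : (half + half = 1)%C.
Proof. rewrite <- RtoC_plus. f_equal. field. Qed.

(** The combination e^{wz/2} K(z) + e e^{-wz/2} K(-z).  It is what the relation makes of
    b(x) = e^{wx}: with s = (x+y)/2, b(x) K(z) + e b(y) K(-z) is e^{ws} times it. *)
Definition twist (w e : C) (K : nat -> R -> C) : nat -> R -> C :=
  jadd (jmul (jexp (hw w)) K) (jscal e (jaff 0 (-1) (jmul (jexp (hw w)) K))).

Lemma twist_jet w e K : jet (-2) 2 K -> jet (-2) 2 (twist w e K).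
Proof.
  intros HK. assert (jet (-2) 2 (jmul (jexp (hw w)) K)) by (apply jet_mul; auto; apply jet_exp).
  apply jet_add; auto. apply jet_scal. apply (jet_aff (-2) 2); auto. intros; lra.
Qed.

Lemma twist_0 w e K z :
  twist w e K O z = (Cexp (hw w * RtoC z) * K O z + e * (Cexp (- hw w * RtoC z) * K O (- z)%R))%C.
Proof.
  unfold twist, jadd, jscal, jaff, jmul, jexp. replace (0 + -1 * z) with (- z) by ring.
  cbn [leib Cpow]. rewrite RtoC_opp. replace (hw w * - RtoC z)%C with (- hw w * RtoC z)%C by ring. ring.
Qed.

Lemma twist_1 w e K :
  twist w e K 1%nat 0 = ((1 - e) * (K 1%nat 0 + hw w * K O 0))%C.
Proof.
  unfold twist, jadd, jscal, jaff, jmul, jexp. replace (0 + -1 * 0) with 0 by ring.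
  cbn [leib Cpow]. replace (hw w * RtoC 0)%C with (RtoC 0) by ring. rewrite Cexp_0. ring.
Qed.

Lemma twist_2 w e K z : twist w e K 2%nat z =
  (Cexp (hw w * RtoC z) * (K 2%nat z + w * K 1%nat z + hw w * hw w * K O z)
   + e * (Cexp (- hw w * RtoC z) * (K 2%nat (-z)%R + w * K 1%nat (-z)%R + hw w * hw w * K O (-z)%R)))%C.
Proof.
  unfold twist, jadd, jscal, jaff, jmul, jexp. replace (0 + -1 * z) with (- z) by ring.
  cbn [leib Cpow]. rewrite RtoC_opp. replace (hw w * - RtoC z)%C with (- hw w * RtoC z)%C by ring.
  pose proof half2 as H2.
  transitivity (Cexp (hw w * RtoC z) * (K 2%nat z + (half + half) * w * K 1%nat z + hw w * hw w * K O z)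
   + e * (Cexp (- hw w * RtoC z) * (K 2%nat (-z)%R + (half + half) * w * K 1%nat (-z)%R + hw w * hw w * K O (-z)%R)))%C.
  - ring.
  - rewrite H2. ring.
Qed.

Lemma two_exponentials_derivative B rho A A' : jet (-1) 1 B ->
  (forall s, -1 <= s <= 1 -> B O s = (A * Cexp (rho * RtoC s) + A' * Cexp (- rho * RtoC s))%C) ->
  forall s, -1 <= s <= 1 ->
     B 1%nat s = (A * (rho * Cexp (rho * RtoC s)) + A' * (- rho * Cexp (- rho * RtoC s)))%C.
Proof.
  intros HB EB s Hs.
  rewrite (jet_eq (-1) 1 B (jadd (jscal A (jexp rho)) (jscal A' (jexp (- rho)%C)))); auto; try lra.
  - unfold jadd, jscal, jexp. cbn [Cpow]. ring.
  - apply jet_add; apply jet_scal, jet_exp.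
  - intros t Ht. rewrite EB; auto. unfold jadd, jscal, jexp. cbn [Cpow]. ring.
Qed.

(** For fixed z the relation is a combination of e^{rho s} and e^{-rho s}, s in an
    interval, so both coefficients vanish.  Since c is d times b on the component
    of frequency rho, the coefficient of e^{rho s} is Z'' - (rho^2/4 - d) Z for
    Z = [twist] rho e K; likewise for -rho and d'.  The interval for s shrinks to a
    point as |z| tends to 2, where continuity in z is used. *)
Lemma twist_ode e K B D rho A A' d d' : jet (-2) 2 K -> kernel_rel e K B D -> jet (-1) 1 B ->
  rho <> RtoC 0 -> A <> RtoC 0 -> A' <> RtoC 0 ->
  (forall s, -1 <= s <= 1 -> B O s = (A * Cexp (rho * RtoC s) + A' * Cexp (- rho * RtoC s))%C) ->
  (forall s, -1 <= s <= 1 -> D O s = (A * d * Cexp (rho * RtoC s) + A' * d' * Cexp (- rho * RtoC s))%C) ->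
  forall z, -2 <= z <= 2 ->
   twist rho e K 2%nat z = ((hw rho * hw rho - d) * twist rho e K O z)%C /\
   twist (- rho) e K 2%nat z = ((hw rho * hw rho - d') * twist (- rho) e K O z)%C.
Proof.
  intros HK HR HB Hr HA HA' EB ED.
  pose proof (two_exponentials_derivative B rho A A' HB EB) as EB1.
  set (Xp := fun z => (twist rho e K 2%nat z - (hw rho * hw rho - d) * twist rho e K O z)%C).
  set (Xm := fun z => (twist (- rho) e K 2%nat z - (hw rho * hw rho - d') * twist (- rho) e K O z)%C).
  assert (Hin : forall z, -2 < z < 2 -> Xp z = RtoC 0 /\ Xm z = RtoC 0).
  { intros z Hz.
    assert (He : 0 < Rmin (2 - z) (2 + z) / 2) by (apply Rdiv_lt_0_compat; [apply Rmin_pos|]; lra).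
    destruct (exp_independent (A * Xp z) (A' * Xm z) rho _ Hr He) as [E1 E2].
    - intros s Hs.
      assert (Hx : -1 <= s + z / 2 <= 1 /\ -1 <= s - z / 2 <= 1).
      { pose proof (Rmin_l (2 - z) (2 + z)). pose proof (Rmin_r (2 - z) (2 + z)). lra. }
      destruct Hx as [Hx Hy]. pose proof (HR _ _ Hx Hy) as Q.
      replace (s + z / 2 - (s - z / 2)) with z in Q by field.
      replace (s - z / 2 - (s + z / 2)) with (- z) in Q by field.
      rewrite <- Q. unfold Xp, Xm. rewrite !twist_0 !twist_2. unfold kform. rewrite !EB ?EB1 ?ED; auto.
      assert (Ez : RtoC (z / 2) = (half * RtoC z)%C) by (rewrite <- RtoC_mult; f_equal; field).
      rewrite RtoC_plus RtoC_minus Ez.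
      replace (rho * (RtoC s + half * RtoC z))%C with (rho * RtoC s + hw rho * RtoC z)%C by ring.
      replace (- rho * (RtoC s + half * RtoC z))%C with (- rho * RtoC s + - hw rho * RtoC z)%C by ring.
      replace (rho * (RtoC s - half * RtoC z))%C with (rho * RtoC s + - hw rho * RtoC z)%C by ring.
      replace (- rho * (RtoC s - half * RtoC z))%C with (- rho * RtoC s + hw rho * RtoC z)%C by ring.
      replace (half * - rho * RtoC z)%C with (- hw rho * RtoC z)%C by ring.
      replace (- (half * - rho) * RtoC z)%C with (hw rho * RtoC z)%C by ring.
      rewrite !Cexp_plus. ring.
    - split; [apply Cmult_integral in E1 as [|]|apply Cmult_integral in E2 as [|]]; auto; contradiction. }
  assert (Hj : forall w t, jet (-2) 2 (jadd (jshift (jshift (twist w e K))) (jscal (- t) (twist w e K)))).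
  { intros w t. pose proof (twist_jet w e K HK). apply jet_add; [repeat apply jet_shift; auto|apply jet_scal; auto]. }
  assert (Hcl : forall w t, (forall z, -2 < z < 2 -> (twist w e K 2%nat z - t * twist w e K O z = 0)%C) ->
     forall z, -2 <= z <= 2 -> twist w e K 2%nat z = (t * twist w e K O z)%C).
  { intros w t H z Hz. apply Ceq_minus.
    pose proof (jet_zero_closed (-2) 2 _ ltac:(lra) (Hj w t)) as Q.
    specialize (Q ltac:(intros x Hx; rewrite <- (H x Hx); unfold jadd, jscal, jshift; ring) O z Hz).
    rewrite <- Q. unfold jadd, jscal, jshift. ring. }
  intros z Hz. split; apply Hcl; auto; intros y Hy; apply Hin; auto.
Qed.

Lemma jet_second_order_unique l F G t : 0 < l -> jet (-l) l F -> jet (-l) l G ->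
  (forall z, -l <= z <= l -> F 2%nat z = (t * F O z)%C) -> (forall z, G 2%nat z = (t * G O z)%C) ->
  F O 0 = G O 0 -> F 1%nat 0 = G 1%nat 0 -> forall z, -l <= z <= l -> F O z = G O z.
Proof.
  intros Hl HF HG F2 G2 E0 E1 z Hz. apply Ceq_minus.
  set (J := jadd F (jscal (- RtoC 1) G)).
  assert (HJ : jet (-l) l J) by (apply jet_add; auto; apply jet_scal; auto).
  assert (E : J O z = RtoC 0).
  { apply (ode_second_order_zero (-l) l (J O) (J 1%nat) t 0); auto; try lra.
    - intros x Hx. replace (t * J O x)%C with (J 2%nat x); [apply HJ; auto|].
      unfold J, jadd, jscal. rewrite F2; auto. rewrite G2. ring.
    - unfold J, jadd, jscal. rewrite E0. ring.
    - unfold J, jadd, jscal. rewrite E1. ring. }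
  rewrite <- E. unfold J, jadd, jscal. ring.
Qed.

(** At z = 2/n the numbers e^{rho z} and e^{-rho z} coincide, with value -1. *)
Lemma freq_point n : n <> 0%Z -> (freq n * RtoC (2 / IZR n) = ipi)%C /\ -2 <= 2 / IZR n <= 2 /\ 2 / IZR n <> 0.
Proof.
  intros Hn. assert (Hn' := eq_IZR_contrapositive _ _ Hn).
  split; [|split].
  - unfold freq. transitivity (RtoC (IZR n / 2 * (2 / IZR n)) * ipi)%C; [rewrite RtoC_mult; ring|].
    replace (IZR n / 2 * (2 / IZR n)) with 1 by (field; auto). ring.
  - apply Rabs_le_between. unfold Rdiv. rewrite Rabs_mult Rabs_inv (Rabs_pos_eq 2); [|lra].
    assert (1 <= Rabs (IZR n)) by (rewrite <- abs_IZR; apply IZR_le; lia).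
    assert (/ Rabs (IZR n) <= 1) by (rewrite <- Rinv_1; apply Rinv_le_contravar; lra). lra.
  - apply Rmult_integral_contrapositive. split; [lra|]. apply Rinv_neq_0_compat; auto.
Qed.

Lemma freq_multiple n t (p : Z) : n <> 0%Z -> (t * RtoC (2 / IZR n) = RtoC (IZR p) * ipi)%C ->
  t = (RtoC (IZR p) * freq n)%C.
Proof.
  intros Hn H. destruct (freq_point n Hn) as [E [_ Hz]]. apply RtoC_neq in Hz.
  rewrite <- E in H. apply Ceq_minus.
  assert (Q : ((t - RtoC (IZR p) * freq n) * RtoC (2 / IZR n) = 0)%C).
  { transitivity (t * RtoC (2 / IZR n) - RtoC (IZR p) * (freq n * RtoC (2 / IZR n)))%C; [ring|]. rewrite H. ring. }
  apply Cmult_integral in Q as [|]; auto; contradiction.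
Qed.

Lemma near_esum_of_cancel n F g : n <> 0%Z -> jet (-2) 2 F -> is_esum g ->
  (forall z, -2 <= z <= 2 ->
    ((F O z - g z) * (Cexp (freq n * RtoC z) - Cexp (- freq n * RtoC z)) = 0)%C) -> near_esum (F O).
Proof.
  intros Hn HF Hg H. exists (/ Rabs (IZR n)), g.
  split; [apply Rinv_0_lt_compat, Rabs_pos_lt, eq_IZR_contrapositive; auto|].
  split; auto. intros z Hz. apply Ceq_minus.
  apply (cancel_freq n (fun z => F O z - g z)%C Hn); auto.
  destruct (is_esum_jet g (-2) 2 Hg) as [J [HJ EJ]].
  assert (HJ' : jet (-2) 2 (jadd F (jscal (- RtoC 1) J))) by (apply jet_add; auto; apply jet_scal; auto).
  apply (cont_on_ext _ _ (jadd F (jscal (- RtoC 1) J) O)); [|apply jet_cont; auto].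
  intros y Hy. unfold jadd, jscal. rewrite EJ. ring.
Qed.

Definition cosh_jet (a s : C) : nat -> R -> C := jadd (jscal a (jexp s)) (jscal a (jexp (- s)%C)).

(** At z = 2/n, e^{rho z/2} = i, and e^{-rho z/2} = -i, so exchanging rho and -rho changes
    the sign of the twist. *)
Lemma twist_half_point n e K : n <> 0%Z -> let z := 2 / IZR n in
  twist (freq n) e K O z = (Ci * K O z - e * Ci * K O (- z)%R)%C /\
  twist (- freq n) e K O z = (- Ci * K O z + e * Ci * K O (- z)%R)%C.
Proof.
  intros Hn z. destruct (freq_point n Hn) as [E _]. fold z in E.
  assert (H1 : Cexp (hw (freq n) * RtoC z) = Ci).
  { rewrite <- Cmult_assoc, E. apply Cexp_half_ipi. }
  assert (H2 : Cexp (- hw (freq n) * RtoC z) = (- Ci)%C).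
  { pose proof (Cexp_neg (hw (freq n)) z) as Q. rewrite H1 in Q.
    assert (Hi : (Ci * Ci = - 1)%C) by (unfold Ci, Cmult, Copp, RtoC; simpl; f_equal; ring).
    transitivity (- (Ci * Ci) * Cexp (- hw (freq n) * RtoC z))%C; [rewrite Hi; ring|].
    transitivity (- Ci * (Ci * Cexp (- hw (freq n) * RtoC z)))%C; [ring|]. rewrite Q. ring. }
  rewrite !twist_0.
  replace (half * - freq n * RtoC z)%C with (- hw (freq n) * RtoC z)%C by ring.
  replace (- (half * - freq n) * RtoC z)%C with (hw (freq n) * RtoC z)%C by ring.
  rewrite H1 H2. split; ring.
Qed.

(** Put Z = [twist] rho 1 K and Z' = [twist] (-rho) 1 K.  The condition of order 0
    expresses c through b, so by [twist_ode] both solve equations of second order;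
    having zero derivative at 0 they are K(0) (e^{sg z} + e^{-sg z}) and the same
    with sg'.  They sum to zero at z = 2/n, that is cosh(sg z) + cosh(sg' z) = 0
    there, which factors and gives sg = s + (2q+1) rho with s = sg' or s = -sg'.
    Finally K (e^{rho z} - e^{-rho z}) = e^{rho z/2} Z - e^{-rho z/2} Z', and for such
    sg the right-hand side is divisible by the factor on the left. *)
Lemma even_two_frequencies K B D n A A' : jet (-2) 2 K -> kernel_rel (RtoC 1) K B D -> jet (-1) 1 B -> n <> 0%Z ->
  A <> RtoC 0 -> A' <> RtoC 0 ->
  (forall s, -1 <= s <= 1 -> B O s = (A * Cexp (freq n * RtoC s) + A' * Cexp (- freq n * RtoC s))%C) ->
  K O 0 <> RtoC 0 ->
  (forall s, -1 <= s <= 1 -> (B O s * K 2%nat 0 + B 1%nat s * K 1%nat 0 + D O s * K O 0 = 0)%C) ->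
  near_esum (K O).
Proof.
  intros HK HR HB Hn HA HA' EB Hk0 H0.
  set (rho := freq n) in *. assert (Hrho : rho <> RtoC 0) by (apply freq_nz; auto).
  pose proof (two_exponentials_derivative B rho A A' HB EB) as EB1.
  set (d := (- (K 2%nat 0 + rho * K 1%nat 0) / K O 0)%C).
  set (d' := (- (K 2%nat 0 - rho * K 1%nat 0) / K O 0)%C).
  pose proof (twist_ode (RtoC 1) K B D rho A A' d d' HK HR HB Hrho HA HA' EB) as T.
  specialize (T ltac:(intros s Hs; pose proof (H0 s Hs) as Q; rewrite EB in Q; auto; rewrite EB1 in Q; auto;
    apply Ceq_minus; unfold d, d';
    match goal with |- ?u = _ => transitivity (((A * Cexp (rho * RtoC s) + A' * Cexp (- rho * RtoC s)) * K 2%nat 0 +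
     (A * (rho * Cexp (rho * RtoC s)) + A' * (- rho * Cexp (- rho * RtoC s))) * K 1%nat 0 +
     D O s * K O 0) / K O 0)%C end; [field; auto|rewrite Q; field; auto])).
  destruct (Csqrt_exists (hw rho * hw rho - d)%C) as [sg Hsg].
  destruct (Csqrt_exists (hw rho * hw rho - d')%C) as [sg' Hsg'].
  assert (Z : forall w s, (forall z, -2 <= z <= 2 -> twist w (RtoC 1) K 2%nat z = (s * s * twist w (RtoC 1) K O z)%C) ->
    forall z, -2 <= z <= 2 -> twist w (RtoC 1) K O z = (K O 0 * (Cexp (s * RtoC z) + Cexp (- s * RtoC z)))%C).
  { intros w s Hw z Hz.
    rewrite (jet_second_order_unique 2 (twist w (RtoC 1) K) (cosh_jet (K O 0) s) (s * s)%C); auto; try lra.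
    - unfold cosh_jet, jadd, jscal, jexp. cbn [Cpow]. ring.
    - apply twist_jet; auto.
    - apply jet_add; apply jet_scal, jet_exp.
    - intros y. unfold cosh_jet, jadd, jscal, jexp. cbn [Cpow]. ring.
    - rewrite twist_0. unfold cosh_jet, jadd, jscal, jexp. cbn [Cpow].
      rewrite Ropp_0. replace (hw w * RtoC 0)%C with (RtoC 0) by ring. replace (- hw w * RtoC 0)%C with (RtoC 0) by ring.
      replace (s * RtoC 0)%C with (RtoC 0) by ring. replace (- s * RtoC 0)%C with (RtoC 0) by ring. rewrite Cexp_0. ring.
    - rewrite twist_1. unfold cosh_jet, jadd, jscal, jexp. cbn [Cpow].
      replace (s * RtoC 0)%C with (RtoC 0) by ring. replace (- s * RtoC 0)%C with (RtoC 0) by ring. rewrite Cexp_0. ring. }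
  assert (Z1 := Z rho sg ltac:(intros z Hz; rewrite Hsg; apply T; auto)).
  assert (Z2 := Z (- rho)%C sg' ltac:(intros z Hz; rewrite Hsg'; apply T; auto)). clear Z.
  (* cosh a + cosh b = 0 is (e^{a+b} + 1) (e^{a-b} + 1) = 0 after multiplication by 2 e^a *)
  destruct (freq_point n Hn) as [Ez [Hz Hz0]]. set (zs := 2 / IZR n) in *.
  destruct (twist_half_point n (RtoC 1) K Hn) as [P1 P2]. fold zs rho in P1, P2.
  assert (S : exists s'' (q : Z), (forall z : R, Cexp (s'' * RtoC z) + Cexp (- s'' * RtoC z)
       = Cexp (sg' * RtoC z) + Cexp (- sg' * RtoC z))%C /\ sg = (s'' + RtoC (IZR (2 * q + 1)) * rho)%C).
  { assert (E : (Cexp (sg * RtoC zs) + Cexp (- sg * RtoC zs) + (Cexp (sg' * RtoC zs) + Cexp (- sg' * RtoC zs)) = 0)%C).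
    { assert (Q : (K O 0 * (Cexp (sg * RtoC zs) + Cexp (- sg * RtoC zs) + (Cexp (sg' * RtoC zs) + Cexp (- sg' * RtoC zs))) = 0)%C).
      { transitivity (twist rho (RtoC 1) K O zs + twist (- rho) (RtoC 1) K O zs)%C.
        - rewrite Z1; auto. rewrite Z2; auto. ring.
        - rewrite P1 P2. ring. }
      apply Cmult_integral in Q as [|]; auto; contradiction. }
    assert (F : ((Cexp ((sg + sg') * RtoC zs) + 1) * (Cexp ((sg - sg') * RtoC zs) + 1) = 0)%C).
    { replace ((sg + sg') * RtoC zs)%C with (sg * RtoC zs + sg' * RtoC zs)%C by ring.
      replace ((sg - sg') * RtoC zs)%C with (sg * RtoC zs + - sg' * RtoC zs)%C by ring.
      rewrite !Cexp_plus.
      pose proof (Cexp_neg sg zs) as N1. pose proof (Cexp_neg sg' zs) as N2.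
      set (a := Cexp (sg * RtoC zs)) in *. set (b := Cexp (- sg * RtoC zs)) in *.
      set (a' := Cexp (sg' * RtoC zs)) in *. set (b' := Cexp (- sg' * RtoC zs)) in *.
      transitivity (a * a * (a' * b') + a * a' + a * b' + 1)%C; [ring|]. rewrite N2.
      transitivity (a * (a + b + (a' + b')) + (1 - a * b))%C; [ring|]. rewrite E N1. ring. }
    assert (G : forall t, (Cexp (t * RtoC zs) + 1 = 0)%C -> exists q : Z, t = (RtoC (IZR (2 * q + 1)) * rho)%C).
    { intros t Ht. 
      assert (E1 : Cexp (t * RtoC zs + ipi)%C = RtoC 1).
      { rewrite Cexp_plus Cexp_ipi.
        transitivity ((Cexp (t * RtoC zs) + 1) * RtoC (-1) + 1)%C; [ring|]. rewrite Ht. ring. }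
      destruct (Cexp_eq_1 _ E1) as [q Hq]. exists (q - 1)%Z. apply freq_multiple; auto. fold zs.
      transitivity (t * RtoC zs + ipi - ipi)%C; [ring|]. rewrite Hq.
      replace (2 * (q - 1) + 1)%Z with (2 * q - 1)%Z by ring. rewrite minus_IZR RtoC_minus. ring. }
    apply Cmult_integral in F as [F|F]; destruct (G _ F) as [q Hq]; exists (sg - RtoC (IZR (2 * q + 1)) * rho)%C, q; split; try ring.
    - intros z. replace (sg - RtoC (IZR (2 * q + 1)) * rho)%C with (- sg')%C by (rewrite <- Hq; ring).
      replace (- - sg')%C with sg' by ring. ring.
    - intros z. replace (sg - RtoC (IZR (2 * q + 1)) * rho)%C with sg' by (rewrite <- Hq; ring). ring. }
  destruct S as [s [q [Es Hs]]].
  destruct (geometric_esum rho (q + 1)) as [U [HU EU]]. destruct (geometric_esum rho q) as [V [HV EV]].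
  set (h := (RtoC (IZR q) * rho + hw rho)%C).
  apply (near_esum_of_cancel n K (fun z => K O 0 * Cexp ((s + h) * RtoC z) * U z + - K O 0 * Cexp (- (s + h) * RtoC z) * V z)%C); auto.
  { apply is_esum_plus; apply is_esum_exp; auto. }
  intros z Hzz. fold rho.
  set (X := (Cexp (rho * RtoC z) - Cexp (- rho * RtoC z))%C) in *.
  transitivity (K O z * X - K O 0 * (Cexp ((s + h) * RtoC z) * (X * U z) - Cexp (- (s + h) * RtoC z) * (X * V z)))%C; [ring|].
  unfold X at 2 3. rewrite <- EU, <- EV.
  assert (L : (K O z * X = Cexp (hw rho * RtoC z) * twist rho (RtoC 1) K O z
        - Cexp (- hw rho * RtoC z) * twist (- rho) (RtoC 1) K O z)%C).
  { rewrite !twist_0. unfold X.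
    replace (half * - rho * RtoC z)%C with (- hw rho * RtoC z)%C by ring.
    replace (- (half * - rho) * RtoC z)%C with (hw rho * RtoC z)%C by ring.
    replace (rho * RtoC z)%C with (hw rho * RtoC z + hw rho * RtoC z)%C
      by (transitivity ((half + half) * (rho * RtoC z))%C; [ring|rewrite half2; ring]).
    replace (- rho * RtoC z)%C with (- hw rho * RtoC z + - hw rho * RtoC z)%C
      by (transitivity ((half + half) * (- rho * RtoC z))%C; [ring|rewrite half2; ring]).
    rewrite !Cexp_plus. ring. }
  rewrite L Z1; auto. rewrite Z2; auto. rewrite <- Es.
  assert (Hh : rho = (hw rho + hw rho)%C).
  { transitivity ((half + half) * rho)%C; [rewrite half2; ring|ring]. }
  assert (W1 : (Cexp (hw rho * RtoC z) * Cexp (sg * RtoC z)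
     = Cexp ((s + h) * RtoC z) * Cexp (RtoC (IZR (q + 1)) * rho * RtoC z))%C).
  { rewrite <- !Cexp_plus. f_equal. rewrite Hs. unfold h. rewrite !plus_IZR mult_IZR !RtoC_plus RtoC_mult. set (t := hw rho) in *. rewrite Hh. ring. }
  assert (W2 : (Cexp (- hw rho * RtoC z) * Cexp (s * RtoC z)
     = Cexp ((s + h) * RtoC z) * Cexp (- (RtoC (IZR (q + 1)) * rho) * RtoC z))%C).
  { rewrite <- !Cexp_plus. f_equal. unfold h. rewrite plus_IZR RtoC_plus. set (t := hw rho) in *. rewrite Hh. ring. }
  assert (W3 : (Cexp (hw rho * RtoC z) * Cexp (- sg * RtoC z)
     = Cexp (- (s + h) * RtoC z) * Cexp (- (RtoC (IZR q) * rho) * RtoC z))%C).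
  { rewrite <- !Cexp_plus. f_equal. rewrite Hs. unfold h. rewrite plus_IZR mult_IZR RtoC_plus RtoC_mult. set (t := hw rho) in *. rewrite Hh. ring. }
  assert (W4 : (Cexp (- hw rho * RtoC z) * Cexp (- s * RtoC z)
     = Cexp (- (s + h) * RtoC z) * Cexp (RtoC (IZR q) * rho * RtoC z))%C).
  { rewrite <- !Cexp_plus. f_equal. unfold h. ring. }
  transitivity (K O 0 * ((Cexp (hw rho * RtoC z) * Cexp (sg * RtoC z) + Cexp (hw rho * RtoC z) * Cexp (- sg * RtoC z))
     - (Cexp (- hw rho * RtoC z) * Cexp (s * RtoC z) + Cexp (- hw rho * RtoC z) * Cexp (- s * RtoC z)))
   - K O 0 * (Cexp ((s + h) * RtoC z) * (Cexp (RtoC (IZR (q + 1)) * rho * RtoC z) - Cexp (- (RtoC (IZR (q + 1)) * rho) * RtoC z)) - Cexp (- (s + h) * RtoC z) * (Cexp (RtoC (IZR q) * rho * RtoC z) - Cexp (- (RtoC (IZR q) * rho) * RtoC z))))%C; [ring|].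
  rewrite W1 W2 W3 W4. ring.
Qed.

(** For odd K the twist with e = -1 is (e^{rho z/2} + e^{-rho z/2}) K.  It solves an
    equation of second order, vanishes at 0, and vanishes at 2/n because its first
    factor does.  So it is a multiple of sinh(sg z) with sg an integral multiple of
    rho.  Multiplying by e^{rho z/2} - e^{-rho z/2} makes the denominator
    e^{rho z} - e^{-rho z}, which divides sinh(sg z). *)
Lemma odd_two_frequencies K B D n A A' eta : jet (-2) 2 K -> kernel_rel (- RtoC 1)%C K B D -> jet (-1) 1 B -> n <> 0%Z ->
  A <> RtoC 0 -> A' <> RtoC 0 ->
  (forall s, -1 <= s <= 1 -> B O s = (A * Cexp (freq n * RtoC s) + A' * Cexp (- freq n * RtoC s))%C) ->
  (forall s, -1 <= s <= 1 -> D O s = (eta * B O s)%C) ->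
  (forall z, -2 <= z <= 2 -> K O (- z)%R = (- K O z)%C) -> K 1%nat 0 <> RtoC 0 ->
  near_esum (K O).
Proof.
  intros HK HR HB Hn HA HA' EB ED Hodd Hk1.
  set (rho := freq n) in *. assert (Hrho : rho <> RtoC 0) by (apply freq_nz; auto).
  assert (N2 : RtoC 2 <> RtoC 0) by (apply RtoC_neq; lra).
  assert (K0 : K O 0 = RtoC 0).
  { pose proof (Hodd 0 ltac:(lra)) as Q. rewrite Ropp_0 in Q.
    assert (E : (2 * K O 0 = 0)%C) by (transitivity (K O 0 - - K O 0)%C; [ring|rewrite <- Q; ring]).
    apply Cmult_integral in E as [E|E]; auto; contradiction. }
  pose proof (twist_ode (- RtoC 1)%C K B D rho A A' eta eta HK HR HB Hrho HA HA' EB) as T.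
  specialize (T ltac:(intros s Hs; rewrite ED; auto; rewrite EB; auto; ring)).
  destruct (Csqrt_exists (hw rho * hw rho - eta)%C) as [sg Hsg].
  destruct (freq_point n Hn) as [Ez [Hz Hz0]]. set (zs := 2 / IZR n) in *.
  destruct (twist_half_point n (- RtoC 1)%C K Hn) as [P1 _]. fold zs rho in P1.
  assert (P0 : twist rho (- RtoC 1)%C K O zs = RtoC 0).
  { rewrite P1 Hodd; auto. ring. }
  assert (I0 : twist rho (- RtoC 1)%C K O 0 = RtoC 0).
  { rewrite twist_0 Ropp_0 K0. ring. }
  assert (I1 : twist rho (- RtoC 1)%C K 1%nat 0 = (2 * K 1%nat 0)%C).
  { rewrite twist_1 K0. ring. }
  destruct (Ceq_dec sg (RtoC 0)) as [Hs0|Hs0].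
  (* a linear twist with nonzero slope does not vanish at 2/n *)
  { exfalso.
    assert (E : twist rho (- RtoC 1)%C K O zs = jlin (2 * K 1%nat 0)%C O zs).
    { apply (jet_second_order_unique 2 _ _ (RtoC 0)); auto; try lra.
      - apply twist_jet; auto.
      - apply jet_lin.
      - intros z Hzz. rewrite (proj1 (T z Hzz)). rewrite <- Hsg, Hs0. ring.
      - intros z. unfold jlin. ring.
      - rewrite I0. unfold jlin. ring. }
    rewrite P0 in E. unfold jlin in E. symmetry in E. apply Cmult_integral in E as [E|E].
    - apply Cmult_integral in E as [E|E]; contradiction.
    - apply (RtoC_neq _ Hz0); auto. }
  set (c := (K 1%nat 0 / sg)%C).
  assert (HZ : forall z, -2 <= z <= 2 -> twist rho (- RtoC 1)%C K O z = (c * (Cexp (sg * RtoC z) - Cexp (- sg * RtoC z)))%C).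
  { intros z Hzz.
    rewrite (jet_second_order_unique 2 (twist rho (- RtoC 1)%C K) (jadd (jscal c (jexp sg)) (jscal (- c)%C (jexp (- sg)%C))) (sg * sg)%C); auto; try lra.
    - unfold jadd, jscal, jexp. cbn [Cpow]. ring.
    - apply twist_jet; auto.
    - apply jet_add; apply jet_scal, jet_exp.
    - intros y Hy. rewrite Hsg. apply T; auto.
    - intros y. unfold jadd, jscal, jexp. cbn [Cpow]. ring.
    - rewrite I0. unfold jadd, jscal, jexp. cbn [Cpow].
      replace (sg * RtoC 0)%C with (RtoC 0) by ring. replace (- sg * RtoC 0)%C with (RtoC 0) by ring. ring.
    - rewrite I1. unfold jadd, jscal, jexp, c. cbn [Cpow].
      replace (sg * RtoC 0)%C with (RtoC 0) by ring. replace (- sg * RtoC 0)%C with (RtoC 0) by ring. rewrite Cexp_0.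
      field; auto. }
  assert (Hl : exists l : Z, sg = (RtoC (IZR l) * rho)%C).
  { rewrite HZ in P0; auto. apply Cmult_integral in P0 as [P0|P0].
    - exfalso. apply Hk1. transitivity (c * sg)%C; [unfold c; field; auto|rewrite P0; ring].
    - apply Ceq_minus in P0.
      assert (E1 : Cexp (RtoC 2 * sg * RtoC zs)%C = RtoC 1).
      { replace (RtoC 2 * sg * RtoC zs)%C with (sg * RtoC zs + sg * RtoC zs)%C by ring.
        rewrite Cexp_plus {2}P0. apply Cexp_neg. }
      destruct (Cexp_eq_1 _ E1) as [l Hl]. exists l. apply freq_multiple; auto. fold zs.
      rewrite mult_IZR RtoC_mult in Hl. apply Ceq_minus.
      assert (E : (2 * (sg * RtoC zs - RtoC (IZR l) * ipi) = 0)%C).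
      { transitivity (RtoC 2 * sg * RtoC zs - RtoC 2 * RtoC (IZR l) * ipi)%C; [ring|]. rewrite Hl. ring. }
      apply Cmult_integral in E as [|]; auto; contradiction. }
  destruct Hl as [l Hl]. destruct (geometric_esum rho l) as [U [HU EU]].
  apply (near_esum_of_cancel n K (fun z => c * Cexp (hw rho * RtoC z) * U z + - c * Cexp (- hw rho * RtoC z) * U z)%C); auto.
  { apply is_esum_plus; apply is_esum_exp; auto. }
  intros z Hzz. fold rho.
  set (X := (Cexp (rho * RtoC z) - Cexp (- rho * RtoC z))%C) in *.
  transitivity (K O z * X - c * (Cexp (hw rho * RtoC z) - Cexp (- hw rho * RtoC z)) * (X * U z))%C; [ring|].
  unfold X at 2. rewrite <- EU, <- Hl.
  transitivity (K O z * X - (Cexp (hw rho * RtoC z) - Cexp (- hw rho * RtoC z)) * (c * (Cexp (sg * RtoC z) - Cexp (- sg * RtoC z))))%C; [ring|].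
  rewrite <- HZ; auto. rewrite twist_0 Hodd; auto. unfold X.
  replace (rho * RtoC z)%C with (hw rho * RtoC z + hw rho * RtoC z)%C
    by (transitivity ((half + half) * (rho * RtoC z))%C; [ring|rewrite half2; ring]).
  replace (- rho * RtoC z)%C with (- hw rho * RtoC z + - hw rho * RtoC z)%C
    by (transitivity ((half + half) * (- rho * RtoC z))%C; [ring|rewrite half2; ring]).
  rewrite !Cexp_plus. ring.
Qed.

(** * The even relation *)

Lemma least_nonzero (f : nat -> C) : (exists n, f n <> RtoC 0) ->
  exists n, f n <> RtoC 0 /\ forall i, (i < n)%nat -> f i = RtoC 0.
Proof.
  intros [n Hn]. revert Hn. induction n as [n IH] using lt_wf_ind. intros Hn.
  destruct (classic (exists i, (i < n)%nat /\ f i <> RtoC 0)) as [[i [Hi Hne]]|Hno].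
  - apply (IH i); auto.
  - exists n. split; auto. intros i Hi. apply NNPP. intros Hne. apply Hno. exists i; auto.
Qed.

Lemma C2_nz : RtoC 2 <> RtoC 0.
Proof. apply RtoC_neq; lra. Qed.

Lemma twice_zero (a : C) : (2 * a = 0)%C -> a = RtoC 0.
Proof. intros H. apply Cmult_integral in H as [H|]; auto. destruct (C2_nz H). Qed.

(** The condition of order 0, read at x = y, where it also covers the endpoints. *)
Lemma diagonal_relation K B D : kernel_rel (RtoC 1) K B D -> forall s, -1 <= s <= 1 ->
  (B O s * K 2%nat 0 + B 1%nat s * K 1%nat 0 + D O s * K O 0 = 0)%C.
Proof.
  intros HR s Hs. apply twice_zero. pose proof (HR s s Hs Hs) as Q.
  replace (s - s) with 0 in Q by ring. rewrite <- Q. unfold kform. ring.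
Qed.

Lemma gauge_zero w B x : jmul (jexp w) B O x = RtoC 0 <-> B O x = RtoC 0.
Proof.
  unfold jmul, jexp. cbn [leib Cpow]. split; intros H.
  - apply Cmult_integral in H as [H|]; auto. exfalso. apply Cmult_integral in H as [H|H].
    + apply C1_nz; auto.
    + apply (Cexp_nz _ H).
  - rewrite H. ring.
Qed.

Lemma jet_gauge a b w F : jet a b F -> jet a b (jmul (jexp w) F).
Proof. intros H. apply jet_mul; auto. apply jet_exp. Qed.

Lemma jet_gauge_c a b m B D : jet a b B -> jet a b D -> jet a b (gauge_c m B D).
Proof.
  intros HB HD. apply jet_gauge. repeat (apply jet_add || apply jet_scal || apply jet_shift); auto.
Qed.

Lemma zero_jet B : jet (-1) 1 B -> (forall x, -1 <= x <= 1 -> B O x = RtoC 0) ->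
  forall n x, -1 <= x <= 1 -> B n x = RtoC 0.
Proof. intros HB H. apply jet_zero_closed; auto; [lra|]. intros; apply H; lra. Qed.

Lemma zero_or_not B : (forall x, -1 <= x <= 1 -> B O x = RtoC 0) \/
  (exists x, -1 <= x <= 1 /\ (B : nat -> R -> C) O x <> RtoC 0).
Proof.
  destruct (classic (exists x, -1 <= x <= 1 /\ B O x <> RtoC 0)) as [|H]; auto.
  left. intros x Hx. apply NNPP. intros Hne. apply H. eauto.
Qed.

(** Write k_i for the i-th derivative of K at 0.  Eliminating c from the condition of
    order 2 cancels b''' and leaves
      (k_0 k_2 - k_1^2) b'' + 2 (k_0 k_3 - k_1 k_2) b' + (k_0 k_4 - k_2^2) b = 0.
    If the leading coefficient is nonzero, a gauge removes the first-order term and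
    [dirichlet_eigen] applies.  If it is zero, then L = e^{-wz} K with w = k_1/k_0 has
    vanishing first and second derivatives at 0.  Then c = 0 after the gauge, so the
    relation does not see the constant L(0) and holds for L - L(0), to which
    [even_relation_leading_term] applies unless its jet at 0 is zero. *)
Lemma even_relation_nonvanishing_kernel r a1 a2 K B D : 0 < r -> r <= 2 -> expandsC r a1 a2 (K O) ->
  jet (-2) 2 K -> jet (-1) 1 B -> jet (-1) 1 D -> kernel_rel (RtoC 1) K B D ->
  K O 0 <> RtoC 0 -> B O (-1) = RtoC 0 -> B O 1 = RtoC 0 ->
  (forall x, -1 <= x <= 1 -> B O x = RtoC 0) \/ near_esum (K O).
Proof.
  intros Hr Hr2 Han HK HB HD HR Hk0 Hm Hp.
  set (k := fun i => K i 0). assert (Ek : forall i, K i 0 = k i) by reflexivity.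
  rewrite Ek in Hk0.
  destruct (Ceq_dec (k O * k 2%nat - k 1%nat * k 1%nat)%C (RtoC 0)) as [Hd|Hd].
  (* K has the 2-jet of k_0 e^{wz} at 0 *)
  - set (w := (k 1%nat / k O)%C).
    set (L := jmul (jexp (- w)%C) K).
    assert (HL : jet (-2) 2 L) by (apply jet_gauge; auto).
    assert (E0 : Cexp (- w * RtoC 0) = RtoC 1).
    { replace (- w * RtoC 0)%C with (RtoC 0) by ring. apply Cexp_0. }
    assert (L0 : L O 0 = k O).
    { unfold L, jmul, jexp. cbn [leib Cpow]. rewrite E0 !Ek. ring. }
    assert (L1 : L 1%nat 0 = RtoC 0).
    { unfold L, jmul, jexp. cbn [leib Cpow]. rewrite E0 !Ek. unfold w. field; auto. }
    assert (L2 : L 2%nat 0 = RtoC 0).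
    { unfold L, jmul, jexp. cbn [leib Cpow]. rewrite E0 !Ek. unfold w.
      transitivity ((k O * k 2%nat - k 1%nat * k 1%nat) / k O)%C; [field; auto|]. rewrite Hd. field; auto. }
    pose proof (gauge _ _ _ _ (- w)%C HR) as HR'. fold L in HR'.
    set (B' := gauge_b (- w)%C B) in HR'.
    assert (HB' : jet (-1) 1 B') by (apply jet_gauge; auto).
    set (D' := gauge_c (- w)%C B D) in HR'.
    assert (HD' : jet (-1) 1 D') by (apply jet_gauge_c; auto).
    assert (D0 : forall s, -1 <= s <= 1 -> D' O s = RtoC 0).
    { intros s Hs. pose proof (diagonal_relation _ _ _ HR' s Hs) as Q. rewrite L0 L1 L2 in Q.
      destruct (Cmult_integral (D' O s) (k O)); auto; [|contradiction]. rewrite <- Q. ring. }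
    destruct (classic (exists n, L (S n) 0 <> RtoC 0)) as [Hex|Hno].
    (* S n is the first order in which K and k_0 e^{wz} differ *)
    + left.
      destruct (least_nonzero (fun n => L (S n) 0) Hex) as [n [Hn Hlow]].
      set (M := jadd L (jconst (- k O)%C)).
      assert (HM : jet (-2) 2 M) by (apply jet_add; auto; apply jet_const).
      assert (HRM : kernel_rel (RtoC 1) M B' D').
      { intros x y Hx Hy. rewrite <- (HR' x y Hx Hy).
        assert (Kf : forall t z, -1 <= t <= 1 -> kform M B' D' t z = kform L B' D' t z).
        { intros t z Ht. unfold kform, M, jadd, jconst. rewrite (D0 t Ht). ring. }
        rewrite !Kf; auto. }
      intros x Hx. apply (gauge_zero (- (- w + - w))%C). 
      apply (even_relation_leading_term M B' D' (S n)); auto; try lia.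
      * intros [|i] Hi; unfold M, jadd, jconst.
        -- rewrite L0. ring.
        -- rewrite Hlow; [ring|lia].
      * unfold M, jadd, jconst. rewrite Cplus_0_r. auto.
      * apply gauge_zero. auto.
    (* H = K' - w K has zero jet at 0, so K' = w K near 0 by analyticity *)
    + right.
      assert (HLz : forall n, L (S n) 0 = RtoC 0).
      { intros n. apply NNPP. intros Hne. apply Hno. eauto. }
      set (H := jadd (jshift K) (jscal (- w)%C K)).
      assert (HH : jet (-2) 2 H) by (apply jet_add; [apply jet_shift|apply jet_scal]; auto).
      destruct (expandsC_combination r _ _ _ _ _ _ (- w)%C
        (expandsC_derive r a1 a2 K Hr2 HK Han) Han) as [c1 [c2 Hc]].
      assert (EH : forall n z, -2 <= z <= 2 -> H n z = jmul (jexp w) (jshift L) n z).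
      { apply jet_eq; auto; [lra|apply jet_gauge, jet_shift; auto|].
        intros z Hz. unfold H, L, jadd, jscal, jshift, jmul, jexp. cbn [leib Cpow].
        pose proof (Cexp_neg w z) as Q.
        transitivity ((Cexp (w * RtoC z) * Cexp (- w * RtoC z)) * (K 1%nat z + - w * K O z))%C; [rewrite Q; ring|ring]. }
      assert (HZ : forall z, Rabs z < r -> H O z = RtoC 0).
      { apply (expandsC_zero r H Hr Hr2 c1 c2); auto. intros n. rewrite EH; [|lra].
        apply leib_zero. intros i _. apply HLz. }
      exists (r / 2), (fun z => k O * Cexp (w * RtoC z))%C. split; [lra|]. split; [apply is_esum_cexp|].
      intros z Hz. apply Rabs_def2 in Hz.
      rewrite (ode_first_order (- (r / 2)) (r / 2) (K O) w 0); try lra.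
      * rewrite Rminus_0_r. reflexivity.
      * intros x Hx. replace (w * K O x)%C with (K 1%nat x).
        -- apply (is_derive_on_sub (-2) 2); auto; try lra. apply HK; lra.
        -- apply Ceq_minus. rewrite <- (HZ x); [unfold H, jadd, jscal, jshift; ring|].
           apply Rabs_def1; lra.
  (* m is the gauge that removes the first-order term of the equation for B *)
  - set (d := (k O * k 2%nat - k 1%nat * k 1%nat)%C) in *.
    set (q := (k O * k 3%nat - k 1%nat * k 2%nat)%C).
    set (p := (k O * k 4%nat - k 2%nat * k 2%nat)%C).
    assert (ED : forall n s, -1 <= s <= 1 -> D n s = (- (k 2%nat * B n s + k 1%nat * B (S n) s) / k O)%C).
    { assert (HJ : jet (-1) 1 (jadd (jscal (- k 2%nat / k O)%C B) (jscal (- k 1%nat / k O)%C (jshift B)))).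
      { apply jet_add; apply jet_scal; auto. apply jet_shift; auto. }
      intros n s Hs. rewrite (jet_eq (-1) 1 D _ ltac:(lra) HD HJ); auto.
      - unfold jadd, jscal, jshift. field; auto.
      - intros x Hx. unfold jadd, jscal, jshift. apply Ceq_minus.
        pose proof (diagonal_relation _ _ _ HR x Hx) as Q. rewrite !Ek in Q.
        transitivity ((B O x * k 2%nat + B 1%nat x * k 1%nat + D O x * k O) / k O)%C; [field; auto|].
        rewrite Q. field; auto. }
    assert (ODE : forall s, -1 < s < 1 -> (d * B 2%nat s + 2 * q * B 1%nat s + p * B O s = 0)%C).
    { intros s Hs.
      pose proof (order_condition (RtoC 1) K B D HK HB HD HR 2 s Hs) as Q.
      specialize (Q ltac:(rewrite pow_m1; simpl; replace (1 + 1 * 1)%C with (RtoC 2) by ring; apply C2_nz)).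
      cbn [leib Cpow Nat.add] in Q. rewrite !ED in Q; try lra. rewrite !Ek in Q.
      assert (Hh : half = (/ RtoC 2)%C) by (rewrite -RtoC_inv; [f_equal; field|lra]).
      rewrite Hh in Q. pose proof C2_nz as N2.
      match type of Q with ?u = _ => transitivity (u * k O)%C; [unfold d, q, p; field; auto|rewrite Q; ring] end. }
    set (m := (- q / (2 * d))%C).
    assert (N2 := C2_nz).
    pose proof (gauge _ _ _ _ m HR) as HR'.
    set (B' := gauge_b m B) in HR'.
    assert (HB' : jet (-1) 1 B') by (apply jet_gauge; auto).
    destruct (zero_or_not B') as [Z|Hne].
    { left. intros x Hx. apply (gauge_zero (- (m + m))%C). apply Z; auto. }
    right.
    destruct (dirichlet_eigen B' (- (4 * m * m * d + 4 * m * q + p) / d)%C) as [n [A [A' [Hn [HA [HA' [_ EB]]]]]]]; auto.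
    + apply gauge_zero; auto.
    + apply gauge_zero; auto.
    + intros s Hs. pose proof (ODE s Hs) as Q. unfold B', gauge_b, jmul, jexp. cbn [leib Cpow].
      set (e := Cexp (- (m + m) * RtoC s)).
      apply Ceq_minus.
      transitivity (e * (d * B 2%nat s + 2 * q * B 1%nat s + p * B O s) / d)%C; [|rewrite Q; field; auto].
      unfold m. field; auto.
    + apply (near_esum_gauge m).
      apply (even_two_frequencies _ B' _ n A A' (jet_gauge _ _ m K HK) HR'); auto.
      * unfold jmul, jexp. cbn [leib Cpow]. replace (m * RtoC 0)%C with (RtoC 0) by ring. rewrite Cexp_0 Ek.
        intros E. apply Hk0. rewrite <- E. ring.
      * apply diagonal_relation; auto.
Qed.

(** With b = 0 the relation is c(x) K(z) + c(y) K(-z) = 0.  Let n be the first order in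
    which K does not vanish at 0.  If n is even, c K^(n)(0) = 0.  If n is odd, the
    condition of order n+1 makes c a multiple of e^{mu s}, and for c <> 0 the points
    x = z/2 and y = -z/2 show that e^{mu z/2} K(z) is odd. *)
Lemma even_relation_zero_order K B D : jet (-2) 2 K -> jet (-1) 1 B -> jet (-1) 1 D -> kernel_rel (RtoC 1) K B D ->
  (forall x, -1 <= x <= 1 -> B O x = RtoC 0) -> (exists n, K n 0 <> RtoC 0) ->
  (forall x, -1 <= x <= 1 -> D O x = RtoC 0) \/
  (exists m, forall z, -2 <= z <= 2 ->
     jmul (jexp m) K O (- z) = (- jmul (jexp m) K O z)%C).
Proof.
  intros HK HB HD HR HB0 Hex. pose proof (zero_jet B HB HB0) as BZ.
  destruct (least_nonzero _ Hex) as [n [Hn Hlow]].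
  assert (OC : forall i s, -1 < s < 1 -> Nat.even i = true -> leib i (fun j => half ^ j * D j s)%C (fun j => K j 0) = RtoC 0).
  { intros i s Hs Hi. pose proof (order_condition (RtoC 1) K B D HK HB HD HR i s Hs) as Q.
    specialize (Q ltac:(rewrite pow_m1 Hi; replace (1 + 1 * 1)%C with (RtoC 2) by ring; apply C2_nz)).
    rewrite !(leib_zero_l i (fun j => half ^ j * B _ s)%C) in Q; [|intros j; rewrite BZ; [ring|lra]..].
    rewrite <- Q. ring. }
  destruct (Nat.even n) eqn:En.
  - left. intros x Hx. apply jet_zero_closed with (-1) 1; auto; [lra|]. intros s Hs.
    pose proof (OC n s Hs En) as Q. rewrite leib_lead in Q; auto. cbn [Cpow] in Q.
    destruct (Cmult_integral (D O s) (K n 0)); auto; [|contradiction]. rewrite <- Q. ring.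
  - set (q := (RtoC (INR (S n)) * half * K n 0)%C).
    assert (Hq : q <> RtoC 0).
    { repeat apply Cmult_neq_0; auto; apply RtoC_neq; [apply not_0_INR; lia|lra]. }
    pose proof (first_order_closed D (K (S n) 0) q HD Hq) as F.
    specialize (F ltac:(intros s Hs; rewrite <- (OC (S n) s Hs ltac:(rewrite Nat.even_succ -Nat.negb_even En; reflexivity));
      rewrite leib_lead_S; auto; unfold q; cbn [Cpow]; ring)).
    set (mu := (- K (S n) 0 / q)%C) in F.
    destruct (Ceq_dec (D O 1) (RtoC 0)) as [E|E].
    { left. intros x Hx. rewrite F; auto. rewrite E. ring. }
    right. exists (hw mu). intros z Hz.
    assert (Hx : -1 <= z / 2 <= 1) by lra. assert (Hy : -1 <= - (z / 2) <= 1) by lra.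
    pose proof (HR _ _ Hx Hy) as Q. unfold kform in Q. rewrite !BZ in Q; auto. rewrite (F _ Hx) (F _ Hy) in Q.
    replace (z / 2 - - (z / 2)) with z in Q by field. replace (- (z / 2) - z / 2) with (- z) in Q by field.
    unfold jmul, jexp. cbn [leib Cpow].
    assert (E1 : (mu * RtoC (z / 2 - 1) = hw mu * RtoC z + - mu)%C).
    { rewrite RtoC_minus. unfold Rdiv. rewrite RtoC_mult. replace (1 * / 2) with (/ 2) by ring. ring. }
    assert (E2 : (mu * RtoC (- (z / 2) - 1) = hw mu * RtoC (- z)%R + - mu)%C).
    { rewrite RtoC_minus !RtoC_opp. unfold Rdiv. rewrite RtoC_mult. replace (1 * / 2) with (/ 2) by ring. ring. }
    rewrite E1 E2 !Cexp_plus in Q.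
    assert (Q' : (D O 1 * Cexp (- mu) * (Cexp (hw mu * RtoC z) * K O z + Cexp (hw mu * RtoC (- z)%R) * K O (- z)%R) = 0)%C).
    { rewrite <- Q. ring. }
    apply Cmult_integral in Q' as [Q'|Q'].
    { exfalso. apply Cmult_integral in Q' as [Q'|Q']; auto. apply (Cexp_nz _ Q'). }
    apply Ceq_minus. rewrite <- Q'. ring.
Qed.

(** * The odd relation *)

(** For fixed z the relation can be differentiated n times in s.  The bounds on s and
    z keep both x and y inside the interval. *)
Lemma relation_shift e K B D : kernel_rel e K B D -> jet (-1) 1 B -> jet (-1) 1 D ->
  forall n s z, -3/4 <= s <= 3/4 -> -1/4 <= z <= 1/4 ->
  (kform K (fun i => B (n + i)%nat) (fun i => D (n + i)%nat) (s + z / 2) z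
   + e * kform K (fun i => B (n + i)%nat) (fun i => D (n + i)%nat) (s - z / 2) (- z) = 0)%C.
Proof.
  intros HR HB HD n s z Hs Hz.
  set (T := fun (F : nat -> R -> C) (c : C) (p : R) => jscal c (jaff p 1 F)).
  set (J := jadd (jadd (jadd (T B (K 2%nat z) (z / 2)) (T (jshift B) (K 1%nat z) (z / 2))) (T D (K O z) (z / 2)))
    (jadd (jadd (T B (e * K 2%nat (- z)%R)%C (- (z / 2))) (T (jshift B) (e * K 1%nat (- z)%R)%C (- (z / 2)))) (T D (e * K O (- z)%R)%C (- (z / 2))))).
  assert (HJ : jet (-3/4) (3/4) J).
  { assert (HT : forall F c p, jet (-1) 1 F -> -1/8 <= p <= 1/8 -> jet (-3/4) (3/4) (T F c p)).
    { intros F c p HF Hp. apply jet_scal. apply (jet_aff (-1) 1); auto. intros; lra. }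
    repeat apply jet_add; apply HT; auto; try apply jet_shift; auto; lra. }
  assert (EJ : forall i t, J i t = (kform K (fun j => B (i + j)%nat) (fun j => D (i + j)%nat) (t + z / 2) z
   + e * kform K (fun j => B (i + j)%nat) (fun j => D (i + j)%nat) (t - z / 2) (- z))%C).
  { intros i t. unfold J, T, jadd, jscal, jaff, jshift, kform. rewrite Cpow_1_l !Nat.add_0_r Nat.add_1_r.
    replace (z / 2 + 1 * t) with (t + z / 2) by ring. replace (- (z / 2) + 1 * t) with (t - z / 2) by ring. ring. }
  rewrite -EJ. apply (jet_zero_closed (-3/4) (3/4)); auto; [lra|].
  intros t Ht. rewrite EJ.
  pose proof (HR (t + z / 2) (t - z / 2) ltac:(lra) ltac:(lra)) as Q.
  replace (t + z / 2 - (t - z / 2)) with z in Q by field.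
  replace (t - z / 2 - (t + z / 2)) with (- z) in Q by field. exact Q.
Qed.

Lemma affine_of_zero_second F : jet (-1) 1 F -> (forall s, -1 <= s <= 1 -> F 2%nat s = RtoC 0) ->
  forall s, -1 <= s <= 1 -> F 1%nat s = F 1%nat 0 /\ F O s = (F O 0 + RtoC s * F 1%nat 0)%C.
Proof.
  intros HF H2.
  assert (H1 : forall s, -1 <= s <= 1 -> F 1%nat s = F 1%nat 0).
  { intros s Hs. apply (zero_derive_const (-1) 1 (F 1%nat)); auto; try lra.
    intros x Hx. rewrite <- (H2 x Hx). apply HF; auto. }
  intros s Hs. split; auto.
  assert (E : (F O s + - F 1%nat 0 * RtoC s = F O 0 + - F 1%nat 0 * RtoC 0)%C).
  { apply (zero_derive_const (-1) 1 (fun t => F O t + - F 1%nat 0 * RtoC t)%C); try lra.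
    intros x Hx. replace (RtoC 0) with (F 1%nat x + - F 1%nat 0)%C.
    - apply is_derive_on_plus; auto. apply is_derive_on_linear; auto.
    - rewrite H1; auto. ring. }
  transitivity (F O s + - F 1%nat 0 * RtoC s + RtoC s * F 1%nat 0)%C; [ring|]. rewrite E. ring.
Qed.

(** The gauged kernel is a multiple of sinh(sg z), or of z when a = 0; the latter is
    the only place where a kernel of the form e^{alpha z} p(z) arises. *)
Lemma harmonic_kernel_trivial m K a l : 0 < l <= 2 -> jet (-2) 2 K ->
  (forall z, -l <= z <= l -> jmul (jexp m) K 2%nat z = (a * jmul (jexp m) K O z)%C) ->
  jmul (jexp m) K O 0 = RtoC 0 -> near_trivial (K O).
Proof.
  intros Hl HK HO O0.
  set (L := jmul (jexp m) K) in *.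
  assert (HL : jet (-l) l L) by (apply (jet_sub (-2) 2); try lra; apply jet_gauge; auto).
  destruct (Csqrt_exists a) as [sg Hsg]. set (c1 := L 1%nat 0).
  destruct (Ceq_dec sg (RtoC 0)) as [Hs|Hs].
  - exists l. split; [lra|]. right.
    exists (- m)%C, 1%nat, (fun i => match i with O => RtoC 0 | _ => c1 end). intros z Hz.
    apply Rabs_def2 in Hz.
    assert (E : L O z = (c1 * RtoC z)%C).
    { apply (jet_second_order_unique l L (jlin c1) a); auto; try lra.
      - apply jet_lin.
      - intros y. unfold jlin. rewrite <- Hsg, Hs. ring.
      - rewrite O0. unfold jlin. ring. }
    rewrite sum_Sn sum_O. unfold plus; simpl.
    transitivity (Cexp (- m * RtoC z) * L O z)%C.
    + unfold L, jmul, jexp. cbn [leib Cpow]. pose proof (Cexp_neg m z) as Q.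
      transitivity ((Cexp (m * RtoC z) * Cexp (- m * RtoC z)) * K O z)%C; [rewrite Q; ring|ring].
    + rewrite E. ring.
  - apply near_esum_trivial, (near_esum_gauge m).
    set (c := (c1 / (2 * sg))%C). pose proof C2_nz as N2.
    exists l, (fun z => c * Cexp (sg * RtoC z) + - c * Cexp (- sg * RtoC z))%C.
    split; [lra|]. split; [apply is_esum_plus; apply is_esum_cexp|]. intros z Hz. apply Rabs_def2 in Hz.
    change (L O z = (c * Cexp (sg * RtoC z) + - c * Cexp (- sg * RtoC z))%C).
    rewrite (jet_second_order_unique l L (jadd (jscal c (jexp sg)) (jscal (- c)%C (jexp (- sg)%C))) a); auto; try lra.
    + unfold jadd, jscal, jexp. cbn [Cpow]. ring.
    + apply jet_add; apply jet_scal, jet_exp.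
    + intros y. unfold jadd, jscal, jexp. cbn [Cpow]. rewrite <- Hsg. ring.
    + rewrite O0. unfold jadd, jscal, jexp. cbn [Cpow].
      replace (sg * RtoC 0)%C with (RtoC 0) by ring. replace (- sg * RtoC 0)%C with (RtoC 0) by ring. ring.
    + fold c1. unfold jadd, jscal, jexp, c. cbn [Cpow].
      replace (sg * RtoC 0)%C with (RtoC 0) by ring. replace (- sg * RtoC 0)%C with (RtoC 0) by ring. rewrite Cexp_0.
      field; auto.
Qed.

(** After the gauge the kernel L is odd.  Its first nonzero derivative at 0 must be
    the first one, as otherwise [lead_same] gives b = 0.  Write a_i for the i-th
    derivative of L at 0 divided by the first, and q = a_5 - a_3^2.  The conditions
    of orders 1, 3 and 5 read
      c = - a_3 b - b''/2,
      b'''' = 4 a_3 b'' + 4 q b,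
      4 q b'' + (a_7 - a_3 a_5 - 2 a_3 q) b = 0.
    If q <> 0, then b'' = kap b.  If q = 0, then f = b'' - 4 a_3 b satisfies f'' = 0; the
    relation is linear and stable under differentiation in s, so it holds for f, with
    -a_3 f for c, and reads 2 f(s) (L'' - a_3 L) = 0.  Either L'' = a_3 L near 0, or
    f = 0 and again b'' = kap b. *)
Lemma odd_relation_trivial K B D m : jet (-2) 2 K -> jet (-1) 1 B -> jet (-1) 1 D -> kernel_rel (- RtoC 1)%C K B D ->
  (forall z, -2 <= z <= 2 -> jmul (jexp m) K O (- z) = (- jmul (jexp m) K O z)%C) ->
  (exists n, K n 0 <> RtoC 0) -> B O (-1) = RtoC 0 -> B O 1 = RtoC 0 ->
  (exists x, -1 <= x <= 1 /\ B O x <> RtoC 0) -> near_trivial (K O).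
Proof.
  intros HK HB HD HR Hodd Hex Hm Hp Hne.
  pose proof (gauge _ _ _ _ m HR) as HR'.
  set (L := jmul (jexp m) K) in *. 
  assert (HL : jet (-2) 2 L) by (apply jet_gauge; auto).
  set (B' := gauge_b m B) in HR'.
  assert (HB' : jet (-1) 1 B') by (apply jet_gauge; auto).
  set (D' := gauge_c m B D) in HR'.
  assert (HD' : jet (-1) 1 D') by (apply jet_gauge_c; auto).
  assert (Hm' : B' O (-1) = RtoC 0) by (apply gauge_zero; auto).
  assert (Hp' : B' O 1 = RtoC 0) by (apply gauge_zero; auto).
  assert (Hne' : exists x, -1 <= x <= 1 /\ B' O x <> RtoC 0).
  { destruct Hne as [x [Hx Hne]]. exists x. split; auto. intros E. apply Hne.
    apply (gauge_zero (- (m + m))%C). auto. }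
  clearbody B' D'. clear Hm Hp Hne HR HB HD B D. rename B' into B. rename D' into D.
  pose proof C2_nz as N2.
  assert (Lev : forall n, Nat.even n = true -> L n 0 = RtoC 0).
  { intros n Hn. apply twice_zero.
    assert (Q : (L n 0 + 1 * (RtoC (-1) ^ n * L n (- 0)%R) = 0)%C).
    { apply (parity_jet 2 L); auto; try lra. intros z Hz. rewrite Hodd; auto. ring. }
    rewrite Ropp_0 pow_m1 Hn in Q. rewrite <- Q. ring. }
  assert (HexL : exists n, L n 0 <> RtoC 0).
  { destruct Hex as [n Hn]. apply NNPP. intros Hno. apply Hn.
    assert (EK : forall z, -2 <= z <= 2 -> K n z = jmul (jexp (- m)%C) L n z).
    { apply jet_eq; auto; [lra|apply jet_gauge; auto|]. intros z Hz.
      unfold L, jmul, jexp. cbn [leib Cpow]. pose proof (Cexp_neg m z) as Q.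
      transitivity ((Cexp (m * RtoC z) * Cexp (- m * RtoC z)) * K O z)%C; [rewrite Q; ring|ring]. }
    rewrite EK; [|lra]. apply leib_zero. intros i _. apply NNPP. intros Hi. apply Hno. eauto. }
  destruct (least_nonzero _ HexL) as [n [Hn Hlow]].
  assert (One : forall i, Nat.even i = false -> (1 + - RtoC 1 * RtoC (-1) ^ i)%C <> RtoC 0).
  { intros i Hi. rewrite pow_m1 Hi. cbv iota. replace (1 + - RtoC 1 * RtoC (-1))%C with (RtoC 2) by ring. exact N2. }
  assert (En : Nat.even n = false).
  { destruct (Nat.even n) eqn:E; auto. exfalso. apply Hn. auto. }
  destruct (classic (2 <= n)%nat) as [H2|H2].
  { exfalso. destruct Hne' as [x [Hx Hne]]. apply Hne.
    apply jet_zero_closed with (-1) 1; auto; [lra|]. intros s Hs.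
    destruct (Cmult_integral (B O s) (L n 0)); auto; [|contradiction].
    apply (lead_same (- RtoC 1)%C L B D); auto. }
  assert (n = 1%nat) as -> by (destruct n as [|[|]]; simpl in En; try discriminate; try lia; auto).
  clear H2 Hlow HexL En.
  set (a := fun i => (L i 0 / L 1%nat 0)%C).
  assert (Ea : forall i, L i 0 = (a i * L 1%nat 0)%C) by (intros i; unfold a; field; auto).
  assert (a1 : a 1%nat = RtoC 1) by (unfold a; field; auto).
  assert (aev : forall i, Nat.even i = true -> a i = RtoC 0).
  { intros i Hi. unfold a. rewrite Lev; auto. field; auto. }
  clearbody a.
  set (h := half). assert (Hh : h = (/ RtoC 2)%C) by (unfold h; rewrite -RtoC_inv; [f_equal; field|lra]).
  assert (OC : forall i s, -1 < s < 1 -> Nat.even i = false ->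
   (leib i (fun i => h ^ i * B i s) (fun i => a (2 + i)%nat) +
    leib i (fun i => h ^ i * B (1 + i)%nat s) (fun i => a (1 + i)%nat) +
    leib i (fun i => h ^ i * D i s) (fun i => a i) = 0)%C).
  { assert (Ls : forall i f (g : nat -> C) c, leib i f (fun j => g j * c)%C = (leib i f g * c)%C).
    { intros i. induction i as [|i IH]; intros f g c; simpl; [ring|]. rewrite !IH. ring. }
    assert (Le : forall i f g g', (forall j, g j = g' j) -> leib i f g = leib i f g').
    { intros i. induction i as [|i IH]; intros f g g' E; simpl; [rewrite E; auto|].
      rewrite (IH _ g g' E) (IH _ (fun j => g (S j)) (fun j => g' (S j))); auto. }
    intros i s Hs Hi. pose proof (order_condition (- RtoC 1)%C L B D HL HB' HD' HR' i s Hs (One i Hi)) as Q.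
    rewrite (Le i _ (fun j => L (2 + j)%nat 0) _ (fun j => Ea (2 + j)%nat)) in Q.
    rewrite (Le i _ (fun j => L (1 + j)%nat 0) _ (fun j => Ea (1 + j)%nat)) in Q.
    rewrite (Le i _ (fun j => L j 0) _ (fun j => Ea j)) in Q. rewrite !Ls in Q.
    match type of Q with (?u * ?c + ?v * ?c + ?w * ?c)%C = _ =>
      assert (Q' : ((u + v + w) * c = 0)%C) by (rewrite <- Q; ring) end.
    apply Cmult_integral in Q' as [Q'|]; [exact Q'|contradiction]. }
  assert (ED : forall i s, -1 <= s <= 1 -> D i s = (- a 3%nat * B i s - h * B (S (S i)) s)%C).
  { assert (HJ : jet (-1) 1 (jadd D (jadd (jscal (a 3%nat) B) (jscal h (jshift (jshift B)))))).
    { repeat (apply jet_add || apply jet_scal || apply jet_shift); auto. }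
    intros i s Hs. apply Ceq_minus.
    rewrite <- (jet_zero_closed (-1) 1 _ ltac:(lra) HJ) with (n := i) (x := s); auto.
    - unfold jadd, jscal, jshift. ring.
    - intros t Ht. pose proof (OC 1%nat t Ht eq_refl) as Q. cbn [leib Cpow Nat.add] in Q.
      rewrite a1 (aev 2%nat) ?(aev O) in Q; auto. rewrite <- Q. unfold jadd, jscal, jshift. ring. }
  set (q := (a 5%nat - a 3%nat * a 3%nat)%C).
  assert (E4 : forall i s, -1 <= s <= 1 -> B (4 + i)%nat s = (4 * a 3%nat * B (2 + i)%nat s + 4 * q * B i s)%C).
  { assert (HJ : jet (-1) 1 (jadd (fun i => B (4 + i)%nat) (jadd (jscal (- (4 * a 3%nat))%C (fun i => B (2 + i)%nat)) (jscal (- (4 * q))%C B)))).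
    { assert (HBn : forall p, jet (-1) 1 (fun i => B (p + i)%nat)).
      { intros p i x Hx. rewrite <- plus_n_Sm. apply HB'; auto. }
      repeat (apply jet_add || apply jet_scal); auto; apply HBn. }
    intros i s Hs. apply Ceq_minus.
    rewrite <- (jet_zero_closed (-1) 1 _ ltac:(lra) HJ) with (n := i) (x := s); auto.
    - unfold jadd, jscal. ring.
    - intros t Ht. pose proof (OC 3%nat t Ht eq_refl) as Q. cbn [leib Cpow Nat.add] in Q.
      rewrite a1 (aev 2%nat) ?(aev O) ?(aev 4%nat) in Q; auto.
      rewrite !ED in Q; try lra. 
      unfold jadd, jscal. cbn [Nat.add].
      match type of Q with ?u = _ => transitivity (u * (- (4))%C)%C; [unfold q; rewrite Hh; field; auto|rewrite Q; ring] end. }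
  assert (E6 : forall s, -1 < s < 1 -> (4 * q * B 2%nat s + (a 7%nat - a 3%nat * a 5%nat - 2 * a 3%nat * q) * B O s = 0)%C).
  { intros t Ht. pose proof (OC 5%nat t Ht eq_refl) as Q. cbn [leib Cpow Nat.add] in Q.
    rewrite a1 (aev 2%nat) ?(aev O) ?(aev 4%nat) ?(aev 6%nat) in Q; auto.
    rewrite !ED in Q; try lra. 
    assert (B6 := E4 2%nat t ltac:(lra)). assert (B4 := E4 O t ltac:(lra)).
    assert (B7 := E4 3%nat t ltac:(lra)). assert (B5 := E4 1%nat t ltac:(lra)).
    cbn [Nat.add] in B6, B4, B7, B5.
    rewrite ?B7 ?B6 ?B5 ?B4 in Q.
    rewrite <- Q. unfold q. rewrite Hh. field. }
  assert (Eigen : forall kap, (forall s, -1 < s < 1 -> B 2%nat s = (kap * B O s)%C) -> near_trivial (K O)).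
  { intros kap Hkap.
    destruct (dirichlet_eigen B kap) as [n [A [A' [Hn0 [HA [HA' [_ EB]]]]]]]; auto.
    apply near_esum_trivial, (near_esum_gauge m).
    apply (odd_two_frequencies L B D n A A' (- a 3%nat - h * kap)%C); auto.
    intros s Hs. rewrite ED; auto.
    rewrite (second_order_closed B kap HB' Hkap s Hs). ring. }
  destruct (Ceq_dec q (RtoC 0)) as [Hq|Hq].
  2: { apply (Eigen (- (a 7%nat - a 3%nat * a 5%nat - 2 * a 3%nat * q) / (4 * q))%C).
    intros s Hs. apply Ceq_minus.
    assert (N4 : RtoC 4 <> RtoC 0) by (apply RtoC_neq; lra).
    transitivity ((4 * q * B 2%nat s + (a 7%nat - a 3%nat * a 5%nat - 2 * a 3%nat * q) * B O s) / (4 * q))%C.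
    - field; auto.
    - rewrite E6; auto. field; auto. }
  set (f := jadd (jshift (jshift B)) (jscal (- (4 * a 3%nat))%C B)).
  assert (Hf : jet (-1) 1 f) by (apply jet_add; [repeat apply jet_shift; auto|apply jet_scal; auto]).
  assert (f2 : forall s, -1 <= s <= 1 -> f 2%nat s = RtoC 0).
  { intros s Hs. pose proof (E4 O s Hs) as Q. cbn [Nat.add] in Q. unfold f, jadd, jscal, jshift. rewrite Q Hq. ring. }
  pose proof (affine_of_zero_second f Hf f2) as Faff.
  assert (Rf : forall s z, -3/4 <= s <= 3/4 -> -1/4 <= z <= 1/4 ->
     (f O s * (L 2%nat z - a 3%nat * L O z) = 0)%C).
  { intros s z Hs Hz.
    pose proof (relation_shift _ _ _ _ HR' HB' HD' 2 s z Hs Hz) as Q2.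
    pose proof (relation_shift _ _ _ _ HR' HB' HD' 0 s z Hs Hz) as Q0.
    unfold kform in Q2, Q0. cbn [Nat.add] in Q2, Q0.
    assert (Hx : -1 <= s + z / 2 <= 1) by lra. assert (Hy : -1 <= s - z / 2 <= 1) by lra.
    rewrite !ED in Q2; try lra. rewrite !ED in Q0; try lra.
    assert (LO : L O (- z)%R = (- L O z)%C) by (apply Hodd; lra).
    assert (LJ : forall i, (L i z + RtoC 1 * (RtoC (-1) ^ i * L i (- z)%R))%C = RtoC 0).
    { intros i. apply (parity_jet 2 L); auto; try lra. intros y Hy'. rewrite Hodd; auto. ring. }
    assert (LT : L 2%nat (- z)%R = (- L 2%nat z)%C).
    { pose proof (LJ 2%nat) as T. cbn [Cpow] in T. apply Ceq_minus. rewrite <- T. ring. }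
    assert (L1 : L 1%nat (- z)%R = L 1%nat z).
    { pose proof (LJ 1%nat) as T. cbn [Cpow] in T. symmetry. apply Ceq_minus. rewrite <- T. ring. }
    rewrite LO LT L1 in Q2, Q0.
    destruct (Faff _ Hx) as [F1x F0x]. destruct (Faff _ Hy) as [F1y F0y]. destruct (Faff s ltac:(lra)) as [_ F0s].
    pose proof (f2 _ Hx) as F2x. pose proof (f2 _ Hy) as F2y.
    set (x := s + z / 2) in *. set (y := s - z / 2) in *.
    assert (S0 : (f O x + f O y = 2 * f O s)%C).
    { rewrite F0x F0y F0s. unfold x, y. rewrite RtoC_plus RtoC_minus. ring. }
    assert (S1 : (f 1%nat x - f 1%nat y = 0)%C) by (rewrite F1x F1y; ring).
    apply twice_zero.
    transitivity ((f O x + f O y) * L 2%nat z + (f 1%nat x - f 1%nat y) * L 1%nat z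
      - a 3%nat * (f O x + f O y) * L O z - h * (f 2%nat x + f 2%nat y) * L O z)%C.
    { rewrite S0 S1 F2x F2y. ring. }
    match type of Q2 with ?u = _ => match type of Q0 with ?v = _ =>
      transitivity (u - 4 * a 3%nat * v)%C; [unfold f, jadd, jscal, jshift; ring|rewrite Q2 Q0; ring] end end. }
  destruct (classic (exists s, -3/4 <= s <= 3/4 /\ f O s <> RtoC 0)) as [[s [Hs Hfs]]|Hno].
  - apply (harmonic_kernel_trivial m K (a 3%nat) (1/4) ltac:(lra) HK); [|apply (Lev O); reflexivity].
    intros z Hz. apply Ceq_minus.
    destruct (Cmult_integral _ _ (Rf s z Hs ltac:(lra))) as [|E]; auto; contradiction.
  (* an affine function that vanishes at 0 and 1/2 is zero *)
  - assert (Z0 : f O 0 = RtoC 0) by (apply NNPP; intros E; apply Hno; exists 0; split; auto; lra).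
    assert (Z1 : f O (1/2) = RtoC 0) by (apply NNPP; intros E; apply Hno; exists (1/2); split; auto; lra).
    assert (Z2 : f 1%nat 0 = RtoC 0).
    { destruct (Faff (1/2) ltac:(lra)) as [_ E]. rewrite Z1 Z0 in E.
      assert (E' : (half * f 1%nat 0 = 0)%C) by (rewrite E; ring).
      apply Cmult_integral in E' as [E'|]; auto. exfalso. revert E'. apply RtoC_neq; lra. }
    apply (Eigen (4 * a 3%nat)%C). intros s Hs. apply Ceq_minus.
    destruct (Faff s ltac:(lra)) as [_ E]. rewrite Z0 Z2 in E.
    transitivity (f O s); [unfold f, jadd, jscal, jshift; ring|]. rewrite E. ring.
Qed.

(** * The theorem *)

Theorem theorem1 (k b1 b2 c1 c2 : R -> C)
  (hk : smooth_on (-2) 2 k)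
  (hb1 : smooth_on (-2) 2 b1) (hb2 : smooth_on (-2) 2 b2)
  (hc1 : smooth_on (-2) 2 c1) (hc2 : smooth_on (-2) 2 c2)
  (hb1_end : b1 (-1) = RtoC 0 /\ b1 1 = RtoC 0)
  (hb2_end : b2 (-1) = RtoC 0 /\ b2 1 = RtoC 0)
  (hb1_order : second_order b1) (hb2_order : second_order b2)
  (hk_nontrivial : nontrivial_kernel k)
  (hk_selfadjoint : forall z : R, -2 <= z <= 2 -> k (- z) = Cconj (k z))
  (hk_analytic : analytic_at_0 k)
  (hk_nonzero : not_zero_near_0 k)
  (hsesqui : op_eq (op_comp (convop (fun z => Cconj (k z))) (diffop b1 c1))
                   (op_comp (diffop b2 c2) (convop k)))
  (hL1_sym : is_transpose (diffop b1 c1) (diffop b1 c1))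
  (hL2_sym : is_transpose (diffop b2 c2) (diffop b2 c2)) :
  op_eq (diffop b1 c1) (diffop b2 c2) \/
  op_eq (diffop b1 c1) (op_opp (diffop b2 c2)).
Proof.
  left.
  destruct (smooth_on_jet _ _ _ hk) as [K [HK EK]].
  destruct (smooth_on_jet _ _ _ hb1) as [B1 [HB1 EB1]]. destruct (smooth_on_jet _ _ _ hb2) as [B2 [HB2 EB2]].
  destruct (smooth_on_jet _ _ _ hc1) as [C1 [HC1 EC1]]. destruct (smooth_on_jet _ _ _ hc2) as [C2 [HC2 EC2]].
  assert (Sub : forall F, jet (-2) 2 F -> jet (-1) 1 F) by (intros F HF; apply (jet_sub (-2) 2); auto; lra).
  apply Sub in HB1. apply Sub in HB2. apply Sub in HC1. apply Sub in HC2.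
  assert (base := kernel_relation k b1 b2 c1 c2 K B1 B2 C1 C2 HK HB1 HB2 HC1 HC2 EK
    ltac:(intros x Hx; rewrite EB1 ?EB2 ?EC1 ?EC2; auto; lra) hk_selfadjoint hsesqui hL1_sym).
  set (Bm := jadd B1 (jscal (- RtoC 1)%C B2)). set (Dm := jadd C1 (jscal (- RtoC 1)%C C2)).
  set (Bp := jadd B1 B2). set (Dp := jadd C1 C2).
  assert (HBm : jet (-1) 1 Bm) by (apply jet_add; auto; apply jet_scal; auto).
  assert (HDm : jet (-1) 1 Dm) by (apply jet_add; auto; apply jet_scal; auto).
  assert (HBp : jet (-1) 1 Bp) by (apply jet_add; auto).
  assert (HDp : jet (-1) 1 Dp) by (apply jet_add; auto).
  assert (Rm : kernel_rel (RtoC 1) K Bm Dm).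
  { intros x y Hx Hy. pose proof (base x y Hx Hy) as Q1. pose proof (base y x Hy Hx) as Q2.
    unfold kform, Bm, Dm, jadd, jscal.
    match type of Q1 with ?u1 = ?v1 => match type of Q2 with ?u2 = ?v2 =>
      transitivity ((u1 - v1) + (u2 - v2))%C; [ring|rewrite Q1 Q2; ring] end end. }
  assert (Rp : kernel_rel (- RtoC 1)%C K Bp Dp).
  { intros x y Hx Hy. pose proof (base x y Hx Hy) as Q1. pose proof (base y x Hy Hx) as Q2.
    unfold kform, Bp, Dp, jadd.
    match type of Q1 with ?u1 = ?v1 => match type of Q2 with ?u2 = ?v2 =>
      transitivity ((u2 - v2) - (u1 - v1))%C; [ring|rewrite Q1 Q2; ring] end end. }
  assert (Ends : B1 O (-1) = RtoC 0 /\ B1 O 1 = RtoC 0 /\ B2 O (-1) = RtoC 0 /\ B2 O 1 = RtoC 0).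
  { rewrite !EB1 ?EB2; try lra. tauto. }
  destruct Ends as [e1 [e2 [e3 e4]]].
  assert (Nontriv : ~ near_trivial (K O)).
  { intros [r [Hr H]]. apply (hk_nontrivial (Rmin r 2)); [apply Rmin_pos; lra|].
    assert (E : forall z, Rabs z < Rmin r 2 -> Rabs z < r /\ k z = K O z).
    { intros z Hz. apply Rmin_Rgt_l in Hz as [Q1 Q2]. split; [lra|]. symmetry. apply EK.
      apply Rabs_def2 in Q2. lra. }
    destruct H as [[N [a [al H]]]|[al [N [p H]]]].
    - left. exists N, a, al. intros z Hz. destruct (E z Hz) as [Hr' ->]. auto.
    - right. exists al, N, p. intros z Hz. destruct (E z Hz) as [Hr' ->]. auto. }
  destruct (expandsC_of_analytic k hk_analytic) as [r [a1 [a2 [Hr [Hr2 Han]]]]].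
  assert (Han' : expandsC r a1 a2 (K O)).
  { destruct Han as [A1 A2]. split; intros z Hz; rewrite EK; auto; apply Rabs_def2 in Hz; lra. }
  assert (Hex : exists n, K n 0 <> RtoC 0).
  { apply NNPP. intros Hno. destruct (hk_nonzero r Hr) as [z [Hz Hkz]]. apply Hkz.
    rewrite <- EK; [|apply Rabs_def2 in Hz; lra].
    apply (expandsC_zero r K Hr Hr2 a1 a2); auto. intros n. apply NNPP. eauto. }
  assert (BmZ : forall x, -1 <= x <= 1 -> Bm O x = RtoC 0).
  { destruct (Ceq_dec (K O 0) (RtoC 0)) as [Hk0|Hk0].
    - destruct (least_nonzero _ Hex) as [n [Hn Hlow]].
      apply (even_relation_leading_term K Bm Dm n); auto.
      + destruct n; [contradiction|lia].
      + unfold Bm, jadd, jscal. rewrite e2 e4. ring.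
    - destruct (even_relation_nonvanishing_kernel r a1 a2 K Bm Dm) as [|H]; auto.
      + unfold Bm, jadd, jscal. rewrite e1 e3. ring.
      + unfold Bm, jadd, jscal. rewrite e2 e4. ring.
      + exfalso. apply Nontriv, near_esum_trivial, H. }
  assert (DmZ : forall x, -1 <= x <= 1 -> Dm O x = RtoC 0).
  { destruct (even_relation_zero_order K Bm Dm HK HBm HDm Rm BmZ Hex) as [|[m Hm]]; auto.
    exfalso. apply Nontriv. apply (odd_relation_trivial K Bp Dp m); auto.
    - unfold Bp, jadd. rewrite e1 e3. ring.
    - unfold Bp, jadd. rewrite e2 e4. ring.
    - destruct hb1_order as [x [Hx Hne]]. exists x. split; auto. intros E. apply Hne.
      rewrite <- EB1; [|lra]. apply twice_zero.
      transitivity (Bp O x + Bm O x)%C; [unfold Bp, Bm, jadd, jscal; ring|]. rewrite E BmZ; auto. ring. }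
  intros u Hu x Hx. destruct (smooth_on_jet _ _ _ Hu) as [U [HU EU]].
  assert (HU0 : forall t, -1 <= t <= 1 -> is_derive_on (-1) 1 u t (U 1%nat t)).
  { intros t Ht. apply (is_derive_on_ext _ _ (U O)); auto. }
  assert (HJ : forall n t, -1 <= t <= 1 -> B1 n t = B2 n t).
  { apply jet_eq; auto; [lra|]. intros t Ht. apply Ceq_minus. rewrite <- (BmZ t Ht). unfold Bm, jadd, jscal. ring. }
  rewrite (diffop_eval b1 (B1 1%nat) c1 u (U 1%nat) (U 2%nat)); auto.
  - rewrite (diffop_eval b2 (B2 1%nat) c2 u (U 1%nat) (U 2%nat)); auto.
    + rewrite HJ; auto. rewrite -EB1 -?EB2 -?EC1 -?EC2; try lra. rewrite HJ; auto.
      assert (Ec : C1 O x = C2 O x) by (apply Ceq_minus; rewrite <- (DmZ x Hx); unfold Dm, jadd, jscal; ring).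
      rewrite Ec. reflexivity.
    + intros t Ht. apply (is_derive_on_ext _ _ (B2 O)); auto. intros y Hy. apply EB2; lra.
  - intros t Ht. apply (is_derive_on_ext _ _ (B1 O)); auto. intros y Hy. apply EB1; lra.
Qed.
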